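(* Fix $\theta\in\mathbb{R}^P$ and $\sigma>0$, and let $p_*=\max\{p_0(\theta),\mathcal O\}$. Then, as $n\to\infty$, $G^*_{n,\theta,\sigma}(t)$ and $G_{n,\theta,\sigma}(t)$ converge in total variation to the cdf $$\Phi_{\infty,p_*}(t)\prod_{q=p_*+1}^P\Delta_{\sigma\xi_{\infty,q}}(0,c_q\sigma\xi_{\infty,q})+\sum_{p=p_*+1}^P\int_{z\le t}\big(1-\Delta_{\sigma\zeta_{\infty,p}}(b_{\infty,p}z,\,c_p\sigma\xi_{\infty,p})\big)\Phi_{\infty,p}(dz)\times\prod_{q=p+1}^P\Delta_{\sigma\xi_{\infty,q}}(0,c_q\sigma\xi_{\infty,q}),$$ and, for $\mathcal O\le p\le P$, the model selection probabilities $\pi_{n,\theta,\sigma}(p)=P_{n,\theta,\sigma}(\hat p=p)$ and $\pi^*_{n,\theta,\sigma}(p)=P_{n,\theta,\sigma}(\hat p^*=p)$ both converge to $$\begin{cases}\big(1-\Delta_{\sigma\xi_{\infty,p}}(0,c_p\sigma\xi_{\infty,p})\big)\prod_{q=p+1}^P\Delta_{\sigma\xi_{\infty,q}}(0,c_q\sigma\xi_{\infty,q})&\text{if }p>p_*,\\ \prod_{q=p_*+1}^P\Delta_{\sigma\xi_{\infty,q}}(0,c_q\sigma\xi_{\infty,q})&\text{if }p=p_*,\\0&\text{if }p<p_*.\end{cases}$$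
   Context: Model: for each sample size $n>P\ge1$, $Y=X\theta+u$ with $X=X_n$ a non-stochastic $n\times P$ matrix of rank $P$, $u\sim N(0,\sigma^2I_n)$, $\theta\in\mathbb{R}^P$, $\sigma>0$; $P_{n,\theta,\sigma}$ is the corresponding probability measure. It is assumed that $Q=\lim_{n\to\infty}X'X/n$ exists and is non-singular. $A$ is a fixed non-stochastic $k\times P$ matrix of rank $k$, $1\le k\le P$; $\mathcal O$ is a fixed integer with $0\le\mathcal O<P$. Inequalities between vectors are componentwise; empty products equal one. The order of $\theta$ is $p_0(\theta)=\min\{p:0\le p\le P,\ \theta_{p+1}=\dots=\theta_P=0\}$. Notation: for a matrix $D$ with $P$ columns, $D[p]$ is the matrix of its first $p$ columns. Estimators: for $0\le p\le P$, $\tilde\theta(p)\in\mathbb{R}^P$ is the restricted least-squares estimator with first $p$ components $(X[p]'X[p])^{-1}X[p]'Y$ and last $P-p$ components zero ($\tilde\theta(0)=0$); $\tilde\theta_p(p)$ is its $p$-th component. $\hat\sigma^2=(n-P)^{-1}(Y-X\tilde\theta(P))'(Y-X\tilde\theta(P))$. For $0<p\le P$, $\xi_{n,p}=\big([(X[p]'X[p]/n)^{-1}]_{p,p}\big)^{1/2}$, $T_p=\sqrt n\,\tilde\theta_p(p)/(\hat\sigma\xi_{n,p})$ and $T^*_p=\sqrt n\,\tilde\theta_p(p)/(\sigma\xi_{n,p})$; $T_0=T_0^*=0$. Critical values, not depending on $n$: $0<c_p<\infty$ for $\mathcal O<p\le P$ and $c_{\mathcal O}=0$. Model selectors: $\hat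 p=\max\{p:|T_p|\ge c_p,\ \mathcal O\le p\le P\}$ and $\hat p^*=\max\{p:|T^*_p|\ge c_p,\ \mathcal O\le p\le P\}$. Post-model-selection estimators: $\tilde\theta=\sum_{p=\mathcal O}^P\tilde\theta(p)\mathbf 1\{\hat p=p\}$, $\tilde\theta^*=\sum_{p=\mathcal O}^P\tilde\theta(p)\mathbf 1\{\hat p^*=p\}$. Cdfs: $G_{n,\theta,\sigma}(t)=P_{n,\theta,\sigma}(\sqrt nA(\tilde\theta-\theta)\le t)$, $G^*_{n,\theta,\sigma}(t)=P_{n,\theta,\sigma}(\sqrt nA(\tilde\theta^*-\theta)\le t)$, $t\in\mathbb{R}^k$. Limit quantities: $Q[p:p]$ is the upper-left $p\times p$ block of $Q$. $\Phi_{\infty,p}$ is the cdf (and measure) on $\mathbb{R}^k$ of the centered Gaussian distribution with covariance matrix $\sigma^2A[p]Q[p:p]^{-1}A[p]'$ for $0<p\le P$, and of point mass at $0$ for $p=0$. For $1\le p\le P$: $C_\infty^{(p)}=A[p]Q[p:p]^{-1}e_p$ with $e_p$ the $p$-th standard basis vector in $\mathbb{R}^p$; $\xi_{\infty,p}^2=(Q[p:p]^{-1})_{p,p}$; $b_{\infty,p}=C_\infty^{(p)\prime}(A[p]Q[p:p]^{-1}A[p]')^-$; $\zeta_{\infty,p}^2=\xi_{\infty,p}^2-b_{\infty,p}C_\infty^{(p)}$; $\xi_{\infty,p},\zeta_{\infty,p}\ge0$; $(\cdot)^-$ is a generalized inverse ($b_{\infty,p}z$ does not depend on its choice for $z$ in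 the column space of $A[p]$). $\Delta_s(a,b)=P(|M-a|<b)$ for $M\sim N(0,s^2)$, $s\ge0$ ($M=0$ if $s=0$, so $\Delta_0(a,b)=1$ if $|a|<b$ and $0$ otherwise). *)

(* Defs.v *)
From HB Require Import structures.
From mathcomp Require Import all_boot all_order all_algebra.
From mathcomp Require Import all_classical all_reals all_analysis.
Set Implicit Arguments.
Unset Strict Implicit.
Unset Printing Implicit Defensive.
Import Order.TTheory GRing.Theory Num.Theory.
Import numFieldNormedType.Exports.
Local Open Scope classical_set_scope.
Local Open Scope ring_scope.

(* R^m is 'cV[R]_m, with the sigma-algebra generated by the coordinates (the
   Borel one), built as the library does for m.-tuple T. *)
Definition measure_cV_display : measure_display.
Proof. exact: default_measure_display. Qed.

Section measurable_cV.
Context {R : realType} {m : nat}.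

Let coord (i : 'I_m) (v : 'cV[R]_m) : measurableTypeR R := v i 0.

Let cV_set0 : g_sigma_preimage coord set0.
Proof. exact: sigma_algebra0. Qed.

Let cV_setC A : g_sigma_preimage coord A -> g_sigma_preimage coord (~` A).
Proof. exact: sigma_algebraC. Qed.

Let cV_bigcup (F : (set 'cV[R]_m)^nat) :
  (forall i, g_sigma_preimage coord (F i)) ->
  g_sigma_preimage coord (\bigcup_i (F i)).
Proof. exact: sigma_algebra_bigcup. Qed.

HB.instance Definition _ :=
  @isMeasurable.Build measure_cV_display
  'cV[R]_m (g_sigma_preimage coord) cV_set0 cV_setC cV_bigcup.

End measurable_cV.

Section laws.
Context {R : realType}.

(* [set z | z <= t], componentwise *)
Definition below k (t : 'cV[R]_k) : set 'cV[R]_k :=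
  [set z | forall i, z i 0 <= t i 0].

Definition tv_dist d (T : measurableType d) (mu nu : set T -> \bar R) : \bar R :=
  ereal_sup [set `|mu E - nu E|%E | E in measurable].

(* The laws L n converge in total variation to the distribution with cdf F;
   in particular F is the cdf of a probability measure on R^k, which is unique. *)
Definition cvg_tv_to_cdf k (L : nat -> set 'cV[R]_k -> \bar R)
    (F : 'cV[R]_k -> R) : Prop :=
  exists mu : probability 'cV[R]_k R,
    (forall t, mu (below t) = (F t)%:E) /\
    tv_dist (L n) mu @[n --> \oo] --> 0%E.

(* m independent N(0, 1) coordinates *)
Definition std_gaussian m (nu : probability 'cV[R]_m R) : Prop :=
  forall E : 'I_m -> set (measurableTypeR R), (forall i, measurable (E i)) ->
    nu [set z | forall i, E i (z i 0)] = (\prod_(i < m) normal_prob 0 1 (E i))%E.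

(* mu = N(0, S): mu is the law of B Z for a standard Gaussian vector Z and some
   B with B B' = S, so that S may be singular. *)
Definition centered_gaussian m (S : 'M[R]_m) (mu : set 'cV[R]_m -> \bar R) : Prop :=
  exists (r : nat) (B : 'M[R]_(m, r)) (nu : probability 'cV[R]_r R),
    [/\ std_gaussian nu, B *m B^T = S &
      forall E, measurable E -> mu E = nu [set z | E (B *m z)]].

(* The degenerate law is singled out since normal_prob 0 0 is not a point mass. *)
Definition Delta (s a b : R) : R :=
  if s == 0 then (if `|a| < b then 1 else 0)
  else fine (normal_prob 0 s [set x | `|x - a| < b]).

End laws.

(* Orders p with 0 <= p <= P are elements of 'I_P.+1. *)
Section estimators.
Context {R : realType} {P : nat}.

(* D[p] *)
Definition first_cols m (D : 'M[R]_(m, P)) (p : 'I_P.+1) : 'M[R]_(m, p) :=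
  colsub (widen_ord (leq_ord p)) D.

(* Q[p:p] *)
Definition upper_left (Q : 'M[R]_P) (p : 'I_P.+1) : 'M[R]_p :=
  mxsub (widen_ord (leq_ord p)) (widen_ord (leq_ord p)) Q.

(* The p-th (last) standard basis vector of R^p; it is empty for p = 0. *)
Definition last_unit (p : nat) : 'cV[R]_p := \col_(i < p) (i.+1 == p)%:R.

(* The p-th component of a vector, resp. the (p, p) entry of a matrix. *)
Definition last_comp p (v : 'cV[R]_p) : R := ((last_unit p)^T *m v) 0 0.
Definition last_entry p (M : 'M[R]_p) : R := last_comp (M *m last_unit p).

(* p_0(theta); component q of theta is theta (q - 1) in 0-based indexing. *)
Definition order_of (theta : 'cV[R]_P) : 'I_P.+1 :=
  [arg min_(p < ord_max | [forall i : 'I_P, (p <= i)%N ==> (theta i 0%R == 0%R)])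
     (p : nat)]%N.

Section sample.
Context {n : nat}.
Variables (X : 'M[R]_(n, P)) (Y : 'cV[R]_n).

Definition gram (p : 'I_P.+1) : 'M[R]_p := (first_cols X p)^T *m first_cols X p.

Definition ls_coef (p : 'I_P.+1) : 'cV[R]_p :=
  invmx (gram p) *m (first_cols X p)^T *m Y.

(* The matrix (I_P)[p] pads a vector of R^p with P - p zeros. *)
Definition ls (p : 'I_P.+1) : 'cV[R]_P := first_cols 1%:M p *m ls_coef p.

Definition residual : 'cV[R]_n := Y - X *m ls ord_max.

Definition sigma_hat : R :=
  Num.sqrt ((n%:R - P%:R)^-1 * (residual^T *m residual) 0 0).

Definition xi_n (p : 'I_P.+1) : R :=
  Num.sqrt (last_entry (invmx (n%:R^-1 *: gram p))).

(* T_p for s = sigma_hat, T*_p for s = sigma *)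
Definition tstat (s : R) (p : 'I_P.+1) : R :=
  if p == ord0 then 0
  else Num.sqrt n%:R * last_comp (ls_coef p) / (s * xi_n p).

Variables (O : 'I_P.+1) (c : 'I_P.+1 -> R).

Definition selector (s : R) : nat :=
  \max_(p < P.+1 | (O <= p)%N && (c p <= `|tstat s p|)) p.

Definition pms (s : R) : 'cV[R]_P :=
  \sum_(p < P.+1 | (O <= p)%N) (selector s == p)%:R *: ls p.

End sample.

Section limits.
Context {k : nat}.
Variables (A : 'M[R]_(k, P)) (Q : 'M[R]_P).

Definition Qinv (p : 'I_P.+1) : 'M[R]_p := invmx (upper_left Q p).

Definition AQA (p : 'I_P.+1) : 'M[R]_k :=
  first_cols A p *m Qinv p *m (first_cols A p)^T.

Definition C_inf (p : 'I_P.+1) : 'cV[R]_k :=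
  first_cols A p *m Qinv p *m last_unit p.

Definition xi_inf (p : 'I_P.+1) : R := Num.sqrt (last_entry (Qinv p)).

(* ginv p is a generalized inverse of AQA p *)
Variable ginv : 'I_P.+1 -> 'M[R]_k.

Definition b_inf (p : 'I_P.+1) : 'rV[R]_k := (C_inf p)^T *m ginv p.

Definition zeta_inf (p : 'I_P.+1) : R :=
  Num.sqrt (xi_inf p ^+ 2 - (b_inf p *m C_inf p) 0 0).

Variables (sigma : R) (c : 'I_P.+1 -> R) (Phi : 'I_P.+1 -> probability 'cV[R]_k R).

Definition Delta0 (q : 'I_P.+1) : R :=
  Delta (sigma * xi_inf q) 0 (c q * sigma * xi_inf q).

Definition tail_prod (p : 'I_P.+1) : R := \prod_(q < P.+1 | (p < q)%N) Delta0 q.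

Definition limit_cdf (pstar : 'I_P.+1) (t : 'cV[R]_k) : R :=
  fine (Phi pstar (below t)) * tail_prod pstar +
  \sum_(p < P.+1 | (pstar < p)%N)
    (\int[Phi p]_(z in below t)
       (1 - Delta (sigma * zeta_inf p) ((b_inf p *m z) 0 0)
                  (c p * sigma * xi_inf p))) * tail_prod p.

Definition limit_sel_prob (pstar p : 'I_P.+1) : R :=
  if (pstar < p)%N then (1 - Delta0 p) * tail_prod p
  else if p == pstar then tail_prod pstar
  else 0.

End limits.

End estimators.

(* M G M = M *)
Definition is_ginv (R : realType) k (M G : 'M[R]_k) : Prop := M *m G *m M = M.

(* Main.v *)
From HB Require Import structures.
Require Import Defs.
From mathcomp Require Import all_boot all_order all_algebra all_fingroup.
From mathcomp Require Import all_classical all_reals all_analysis.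
From mathcomp Require Import measurable_realfun.
From mathcomp Require Import ring lra.
Set Implicit Arguments.
Unset Strict Implicit.
Unset Printing Implicit Defensive.
Import Order.TTheory GRing.Theory Num.Theory.
Import numFieldNormedType.Exports.
Local Open Scope classical_set_scope.
Local Open Scope ring_scope.

(* Writing W = n^(-1/2) X'u and Q_n = X'X/n, a Gram-Schmidt matrix D_n (with
   D_n Q_n D_n' = I) turns W into sigma Z with Z standard Gaussian on R^P for
   every n. For every order q > p_0 the statistic T*_q is exactly the q-th
   coordinate of Z, while T*_p diverges at p = p_* whenever p_* > O; replacing
   sigma by a consistent estimator only matters when some |Z_q| is close to c_q.
   Hence, outside an event of vanishing probability, the selected order is the
   largest p >= p_* such that p = p_* or |Z_p| >= c_p, a fixed function of Z, and
   on {selected order = p} the error is a linear function of Z whose matrix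
   depends on Q_n and converges. Convergence in total variation is then Scheffe's
   lemma for the Gaussian Jacobian of a linear change of variables close to the
   identity. The limit law is computed by independence of the coordinates of Z: the
   error after order p depends on the first p coordinates only, and conditioning
   its joint Gaussian law with Z_p on the value z of the error gives b_p z and
   zeta_p. *)

(** * Standard Gaussian vectors *)

(** Total variation is therefore controlled on R^P, for invertible square matrices, and transferred
    to R^k by a fixed linear image. This requires the event that p is selected to be the preimage of
    one set not depending on n: completing the coefficients of order p by the coordinates of Z above
    p keeps the later tests readable, while the test of order p, read on the last coefficient, has
    its threshold scaled by xi. The mismatch between the scales at Q_n and at Q matters only on a
    thin band around c_p, which has small Gaussian mass. The sample spaces change with n, so the
    whitened noise is compared with one reference Gaussian measure by law only. Gaussian laws are
    identified from their covariance through orthogonal invariance, a consequence of the same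
    Jacobian formula. The Jacobian of a homothety also yields the law of large numbers behind the
    consistency of the variance estimator. *)

Section cV_measurable.
Context {R : realType}.

Let coord m (i : 'I_m) (v : 'cV[R]_m) : measurableTypeR R := v i 0.

Lemma measurable_coord m (i : 'I_m) :
  measurable_fun [set: 'cV[R]_m] (fun v : 'cV[R]_m => v i 0 : measurableTypeR R).
Proof.
move=> _ Y mY; rewrite setTI; apply: sub_sigma_algebra => /=.
rewrite -bigcup_seq/=; exists i => /=; first by rewrite mem_index_enum.
by exists Y => //; rewrite setTI.
Qed.

Lemma measurable_cVP d (T : measurableType d) m (f : T -> 'cV[R]_m) :
  measurable_fun [set: T] f <->
  forall i, measurable_fun [set: T] (fun x => f x i 0 : measurableTypeR R).
Proof.
split=> [mf i|mf].
  exact: (measurableT_comp (measurable_coord i) mf).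
pose G := \big[setU/set0]_(i < m) preimage_set_system setT (@coord m i) measurable.
have : G `<=` [set A | measurable (f @^-1` A)].
  rewrite /G; elim/big_ind: _ => //; first by move=> A B sA sB C [/sA|/sB].
  move=> i _ _ [B mB <-] /=; rewrite setTI.
  by have := mf i measurableT B mB; rewrite setTI.
move=> GA _ A mA; rewrite setTI; move: A mA.
apply: smallest_sub => //; split => //=.
- by rewrite preimage_set0.
- by move=> A mA; rewrite setTD preimage_setC; exact: measurableC.
- by move=> F mF; rewrite preimage_bigcup; exact: bigcup_measurable.
Qed.

Lemma measurable_sumr d (T : measurableType d) I (s : seq I) (h : I -> T -> R) :
  (forall i, measurable_fun setT (h i)) ->
  measurable_fun setT (fun x => \sum_(i <- s) h i x).
Proof. by move=> mh; exact: measurable_sum. Qed.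

Lemma measurable_mulmx m n (B : 'M[R]_(m, n)) :
  measurable_fun [set: 'cV[R]_n] (fun z => B *m z : 'cV[R]_m).
Proof.
apply/measurable_cVP => i.
rewrite (_ : (fun _ => _) = fun z : 'cV[R]_n => \sum_j B i j * z j 0).
  apply: measurable_sumr => j; apply: measurable_funM => //.
  exact: measurable_coord.
by apply/funext => z; rewrite mxE.
Qed.

End cV_measurable.

Definition image_prob d d' (T : measurableType d) (T' : measurableType d')
    (R : realType) (Pr : probability T R) (f : T -> T')
    (mf : measurable_fun [set: T] f) : probability T' R :=
  distribution Pr (mfun_Sub (mem_set mf)).

Lemma image_probE d d' (T : measurableType d) (T' : measurableType d')
    (R : realType) (Pr : probability T R) (f : T -> T')
    (mf : measurable_fun [set: T] f) A : image_prob Pr mf A = Pr (f @^-1` A).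
Proof. by []. Qed.

Lemma ge0_integral_image_prob d d' (T : measurableType d) (T' : measurableType d')
    (R : realType) (Pr : probability T R) (f : T -> T')
    (mf : measurable_fun [set: T] f) (g : T' -> \bar R) :
  measurable_fun setT g -> (forall y, 0 <= g y)%E ->
  (\int[image_prob Pr mf]_y g y = \int[Pr]_x g (f x))%E.
Proof. by move=> mg g0; rewrite ge0_integral_distribution. Qed.

Lemma image_prob_prodE d1 d2 d' (T1 : measurableType d1) (T2 : measurableType d2)
    (T' : measurableType d') (R : realType) (P1 : probability T1 R)
    (P2 : probability T2 R) (f : T1 * T2 -> T')
    (mf : measurable_fun [set: T1 * T2] f) E A B :
  measurable A -> measurable B -> f @^-1` E = A `*` B ->
  image_prob (P1 \x P2)%E mf E = (P1 A * P2 B)%E.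
Proof.
by move=> mA mB fE; rewrite [LHS]image_probE fE; exact: product_measure1E.
Qed.

(* Probabilities which agree on measurable sets are equal only up to their
   junk values on the other sets. *)
Lemma eq_prob_integral d (T : measurableType d) (R : realType)
    (m1 m2 : probability T R) (f : T -> \bar R) :
  (forall A, measurable A -> m1 A = m2 A) ->
  (\int[m1]_x f x = \int[m2]_x f x)%E.
Proof. by move=> h; apply: eq_measure_integral => A mA _; exact: h. Qed.

Lemma prob_unique d (T : measurableType d) (R : realType) (G : set (set T))
    (m1 m2 : probability T R) :
  measurable = <<s G >> -> setI_closed G -> G setT ->
  (forall A, G A -> m1 A = m2 A) ->
  forall A, measurable A -> m1 A = m2 A.
Proof.
move=> mG GI GT h A mA; apply: (measure_unique G (fun=> setT)) => //.
- by apply/seteqP; split => // x _; exists 0%N.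
- move=> k; apply: (@le_lt_trans _ _ 1%E); [exact: probability_le1|exact: ltry].
Qed.

Section std_gaussian_theory.
Context {R : realType}.
Local Notation N01 := (@normal_prob R 0 1).

Definition box m (E : 'I_m -> set (measurableTypeR R)) : set 'cV[R]_m :=
  [set z | forall i, E i (z i 0)].

Lemma measurable_box m (E : 'I_m -> set (measurableTypeR R)) :
  (forall i, measurable (E i)) -> measurable (box E).
Proof.
move=> mE.
rewrite (_ : box E = \big[setI/setT]_(i < m)
   ((fun v : 'cV[R]_m => v i 0 : measurableTypeR R) @^-1` E i)).
  apply: bigsetI_measurable => i _.
  by rewrite -[X in measurable X]setTI; exact: measurable_coord.
apply/seteqP; split => z /=.
  move=> h; apply: (big_ind (fun A : set 'cV[R]_m => A z)) => // i _.
  exact: h.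
move=> h i; move: h; rewrite (bigD1 i)//= => -[h _]; exact: h.
Qed.

Definition boxes m : set (set 'cV[R]_m) :=
  [set A | exists2 E, (forall i, measurable (E i)) & A = box E].

Lemma measurable_boxes m :
  @measurable measure_cV_display 'cV[R]_m = <<s @boxes m >>.
Proof.
apply/seteqP; split; last first.
  apply: smallest_sub; first exact: sigma_algebra_measurable.
  by move=> _ [E mE ->]; exact: measurable_box.
apply: smallest_sub; first exact: smallest_sigma_algebra.
suff h (i : 'I_m) (B : set (measurableTypeR R)) : measurable B ->
    <<s @boxes m >> [set v : 'cV[R]_m | B (v i 0)].
  elim/big_ind: _ => //; first by move=> A B sA sB C [/sA|/sB].
  by move=> i _ _ [B mB <-]; rewrite setTI; exact: h.
move=> mB; apply: sub_sigma_algebra.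
exists (fun j => if j == i then B else setT).
  by move=> j; case: ifP.
apply/seteqP; split => v /=; last by move/(_ i); rewrite eqxx.
by move=> Bv j; case: eqP => [->|].
Qed.

Lemma boxes_setI m : setI_closed (@boxes m).
Proof.
move=> _ _ [E mE ->] [F mF ->]; exists (fun i => E i `&` F i).
  by move=> i; exact: measurableI.
by apply/seteqP; split=> z /= => [[h1 h2] i|h]; [split|split=> i; case: (h i)].
Qed.

Lemma boxesT m : @boxes m setT.
Proof. by exists (fun=> setT) => //; apply/seteqP; split. Qed.

Lemma prob_cV_unique m (m1 m2 : probability 'cV[R]_m R) :
  (forall E : 'I_m -> set (measurableTypeR R), (forall i, measurable (E i)) ->
     m1 (box E) = m2 (box E)) ->
  forall A, measurable A -> m1 A = m2 A.
Proof.
move=> h; apply: (@prob_unique _ _ _ (@boxes m)).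
- exact: measurable_boxes.
- exact: boxes_setI.
- exact: boxesT.
- by move=> _ [E mE ->]; exact: h.
Qed.

Definition upd m (i : 'I_m) (xz : R * 'cV[R]_m) : 'cV[R]_m :=
  \col_j if j == i then xz.1 else xz.2 j 0.

Lemma measurable_upd m (i : 'I_m) :
  measurable_fun [set: measurableTypeR R * 'cV[R]_m] (upd i).
Proof.
apply/measurable_cVP => j; rewrite /upd.
have [ji|ji] := eqVneq j i.
  rewrite (_ : (fun _ => _) = fst) //; last first.
    by apply/funext => x; rewrite mxE ji eqxx.
rewrite (_ : (fun _ => _) = fun x : measurableTypeR R * 'cV[R]_m =>
    x.2 j 0 : measurableTypeR R).
  exact: (measurableT_comp (measurable_coord j) measurable_snd).
by apply/funext => x; rewrite mxE (negbTE ji).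
Qed.

(** Resampling coordinate i from an independent N(0, 1) changes nothing: on a box, the old factor i
    is integrated out to 1 and replaced by the same factor for the new coordinate. This gives Fubini
    in one coordinate without splitting R^m as a product. *)
Lemma std_gaussian_upd m (nu : probability 'cV[R]_m R) (i : 'I_m) :
  std_gaussian nu -> forall A, measurable A ->
  nu A = image_prob (N01 \x nu)%E (measurable_upd i) A.
Proof.
move=> hnu; apply: prob_cV_unique => E mE.
pose F j := if j == i then setT else E j.
have mF j : measurable (F j) by rewrite /F; case: ifP.
rewrite [RHS](@image_prob_prodE _ _ _ _ _ _ _ _ _ _ _ _ (E i) (box F))//.
- rewrite [LHS](hnu E mE) [X in _ = (_ * X)%E](hnu F mF).
  rewrite [LHS](bigD1 i)//= [X in _ = (_ * X)%E](bigD1 i)//= /F eqxx.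
  have -> : N01 setT = 1%E by exact: probability_setT.
  rewrite mul1e; congr (_ * _)%E; apply: eq_bigr => j ji.
  by rewrite (negbTE ji).
- exact: measurable_box.
apply/seteqP; split => [[x z]|[x z]] /=; rewrite /upd /box /F /=.
  move=> h; split=> [|j]; first by have := h i; rewrite mxE eqxx.
  by case: ifP => // ji; have := h j; rewrite mxE ji.
by move=> [Ex h] j; rewrite mxE; case: eqP => [->//|/eqP ji]; have := h j; rewrite (negbTE ji).
Qed.

Lemma integral_upd m (nu : probability 'cV[R]_m R) (i : 'I_m)
    (f : 'cV[R]_m -> \bar R) : std_gaussian nu ->
  measurable_fun setT f -> (forall z, 0 <= f z)%E ->
  (\int[nu]_z f z = \int[nu]_z \int[N01]_x f (upd i (x, z)))%E.
Proof.
move=> hnu mf f0; rewrite (eq_prob_integral _ (std_gaussian_upd i hnu)).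
rewrite ge0_integral_image_prob// fubini_tonelli2//=.
by apply: measurableT_comp => //; exact: measurable_upd.
Qed.

Lemma measurable_col_mx m n :
  measurable_fun [set: 'cV[R]_m * 'cV[R]_n] (fun x => col_mx x.1 x.2).
Proof.
apply/measurable_cVP => i; case: (split_ordP i) => j ->.
  rewrite (_ : (fun _ => _) = fun x : 'cV[R]_m * 'cV[R]_n =>
    x.1 j 0 : measurableTypeR R).
    exact: (measurableT_comp (measurable_coord j) measurable_fst).
  by apply/funext => x; rewrite col_mxEu.
rewrite (_ : (fun _ => _) = fun x : 'cV[R]_m * 'cV[R]_n =>
    x.2 j 0 : measurableTypeR R).
  exact: (measurableT_comp (measurable_coord j) measurable_snd).
by apply/funext => x; rewrite col_mxEd.
Qed.

Lemma std_gaussian_col_mx m n (n1 : probability 'cV[R]_m R)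
    (n2 : probability 'cV[R]_n R) : std_gaussian n1 -> std_gaussian n2 ->
  std_gaussian (image_prob (n1 \x n2)%E (@measurable_col_mx m n)).
Proof.
move=> h1 h2 E mE.
rewrite [LHS](@image_prob_prodE _ _ _ _ _ _ _ _ _ _ _ _
  (box (fun i => E (lshift n i))) (box (fun i => E (rshift m i)))).
- rewrite big_split_ord /=.
  by congr (_ * _)%E; [exact: h1|exact: h2].
- exact: measurable_box.
- exact: measurable_box.
apply/seteqP; split=> [[z w] /= h|[z w] /= [h1' h2'] i].
  split=> i /=; first by have := h (lshift n i); rewrite col_mxEu.
  by have := h (rshift m i); rewrite col_mxEd.
case: (split_ordP i) => j ->; rewrite ?col_mxEu ?col_mxEd.
  exact: h1'.
exact: h2'.
Qed.

End std_gaussian_theory.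

Section std_gaussian_existence.
Context {R : realType}.

Lemma std_gaussian0 : exists nu : probability 'cV[R]_0 R, std_gaussian nu.
Proof.
exists \d_(0 : 'cV[R]_0) => E mE; rewrite big_ord0 [LHS]diracE mem_set//.
by move=> i; have := ltn_ord i; rewrite ltn0.
Qed.

Lemma measurable_const_cV1 :
  measurable_fun [set: measurableTypeR R] (fun x => const_mx x : 'cV[R]_1).
Proof.
apply/measurable_cVP => i; rewrite (_ : (fun _ => _) = id) //.
by apply/funext => x; rewrite mxE.
Qed.

Lemma std_gaussian1 : exists nu : probability 'cV[R]_1 R, std_gaussian nu.
Proof.
exists (image_prob (normal_prob (0 : R) 1) measurable_const_cV1) => E mE.
rewrite [LHS]image_probE big_ord1; congr (normal_prob _ _ _).
apply/seteqP; split => x /=; first by move/(_ ord0); rewrite mxE.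
by move=> Ex i; rewrite mxE (ord1 i).
Qed.

Lemma exists_std_gaussian m : exists nu : probability 'cV[R]_m R, std_gaussian nu.
Proof.
elim: m => [|m [nu hnu]]; first exact: std_gaussian0.
have [n1 hn1] := std_gaussian1.
by eexists; exact: (std_gaussian_col_mx hn1 hnu).
Qed.

End std_gaussian_existence.

(** * One-dimensional affine substitution *)

Section normal_affine.
Context {R : realType}.
Local Notation N01 := (@normal_prob R 0 1).
Local Notation leb := (@lebesgue_measure R).
Local Open Scope ereal_scope.

Let affine (s m : R) : measurableTypeR R -> measurableTypeR R :=
  fun x => (s * x + m)%R.

Let measurable_affine s m :
  measurable_fun [set: measurableTypeR R] (affine s m).
Proof. by apply: measurable_funD => //; exact: measurable_funM. Qed.

(** By uniqueness of Lebesgue measure it suffices to test half-open intervals. For negative s the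
    preimage of such an interval is closed on the left and open on the right, with the same length
    formula. *)
Lemma lebesgue_measure_affine (s m : R) (A : set (measurableTypeR R)) :
  s != 0%R -> measurable A ->
  leb A = `|s|%:E * leb ((fun x => s * x + m)%R @^-1` A).
Proof.
move=> s0 mA.
have maff := measurable_affine s m.
have s0' : (0 <= `|s|)%R by [].
pose pf : measure (measurableTypeR R) R :=
  measure_function_pushforward__canonical__measure_function_Measure leb maff.
pose mu : measure (measurableTypeR R) R := mscale (NngNum s0') pf.
rewrite (@lebesgue_measure_unique _ mu) //.
move=> _ [[a b]] _ <-; rewrite -[RHS]/(`|s|%:E * leb (affine s m @^-1` `]a, b])) /affine.
case: (ltgtP 0%R s) s0 => // [sp|sn] _.
  rewrite (_ : _ @^-1` _ = `]((a - m) / s)%R, ((b - m) / s)%R]%classic).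
    rewrite !lebesgue_measure_itv /= !lte_fin ltr_pM2r ?invr_gt0//.
    rewrite ltrD2r; case: ifP => ab; last by rewrite mule0.
    rewrite -!EFinB -EFinM gtr0_norm//; congr EFin.
    by field; rewrite gt_eqF.
  apply/seteqP; split=> x /=; rewrite !in_itv /= ltr_pdivrMr// ler_pdivlMr//;
   by rewrite ltrBlDr lerBrDr (mulrC x).
rewrite (_ : _ @^-1` _ = `[((b - m) / s)%R, ((a - m) / s)%R[%classic).
  rewrite !lebesgue_measure_itv /= !lte_fin ltr_nM2r ?invr_lt0//.
  rewrite ltrD2r; case: ifP => ab; last by rewrite mule0.
  rewrite -!EFinB -EFinM ltr0_norm//; congr EFin.
  by field; rewrite lt_eqF.
apply/seteqP; split=> x /=; rewrite !in_itv /= ltr_ndivlMr// ler_ndivrMr//;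
  by rewrite ltrBlDr lerBrDr (mulrC x) andbC.
Qed.

Lemma ge0_integral_affine (s m : R) (f : measurableTypeR R -> \bar R) :
  s != 0%R -> measurable_fun setT f -> (forall x, 0 <= f x) ->
  \int[leb]_x f x = \int[leb]_x (f (s * x + m)%R * `|s|%:E).
Proof.
move=> s0 mf f0.
have maff := measurable_affine s m.
have s0' : (0 <= `|s|)%R by [].
pose pf : measure (measurableTypeR R) R :=
  measure_function_pushforward__canonical__measure_function_Measure leb maff.
rewrite (@eq_measure_integral _ _ _ _ (mscale (NngNum s0') pf)); last first.
  by move=> A mA _; exact: lebesgue_measure_affine.
rewrite ge0_integral_mscale// ge0_integral_pushforward//.
rewrite [RHS]ge0_integralZr//=; first by rewrite muleC.
exact: (measurableT_comp mf maff).
Qed.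

(** The Radon-Nikodym derivative of N(0, 1) agrees almost everywhere with the normal density,
    because both have the same integral over every measurable set. *)
Lemma ge0_integral_normal01 (f : measurableTypeR R -> \bar R) :
  measurable_fun setT f -> (forall x, 0 <= f x) ->
  \int[N01]_x f x = \int[leb]_x (f x * (normal_pdf 0 1 x)%:E).
Proof.
move=> mf f0; have dom := @normal_prob_dominates R 0 1.
rewrite -(Radon_Nikodym_SigmaFinite.change_of_variables dom f0 measurableT mf).
have mpdf : measurable_fun setT (fun x => (normal_pdf 0 1 x)%:E : \bar R).
  by apply/measurable_EFinP; exact: measurable_normal_pdf.
have fi := Radon_Nikodym_SigmaFinite.f_integrable dom.
have ae : ae_eq leb setT (Radon_Nikodym_SigmaFinite.f N01 leb)
    (fun x => (normal_pdf 0 1 x)%:E).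
  apply: (integral_ae_eq measurableT fi mpdf) => E _ mE.
  exact/esym/(Radon_Nikodym_SigmaFinite.f_integral dom).
apply: ge0_ae_eq_integral => //.
- by apply: emeasurable_funM => //; exact: measurable_int fi.
- exact: emeasurable_funM.
- by move=> x _; rewrite mule_ge0//; exact: Radon_Nikodym_SigmaFinite.f_ge0.
- by move=> x _; rewrite mule_ge0// lee_fin normal_pdf_ge0.
by apply: filterS ae => x h _; rewrite h.
Qed.

Lemma normal01_affine (s m : R) (f : measurableTypeR R -> \bar R) :
  s != 0%R -> measurable_fun setT f -> (forall x, 0 <= f x) ->
  \int[N01]_x f x = \int[N01]_x (f (s * x + m)%R *
    (`|s| * expR (- ((s * x + m) ^+ 2 - x ^+ 2) / 2))%:E).
Proof.
move=> s0 mf f0.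
have maff := measurable_affine s m.
rewrite !ge0_integral_normal01//; last 2 first.
- apply: emeasurable_funM; first exact: (measurableT_comp mf maff).
  apply/measurable_EFinP; apply: measurable_funM => //.
  apply: measurableT_comp => //=; apply: measurable_funM => //.
  apply: measurable_funN; apply: measurable_funB; exact: measurable_funX.
- by move=> x; rewrite mule_ge0// lee_fin mulr_ge0 ?expR_ge0.
rewrite (@ge0_integral_affine s m)//; last 2 first.
- apply: emeasurable_funM => //.
  by apply/measurable_EFinP; exact: measurable_normal_pdf.
- by move=> x; rewrite mule_ge0// lee_fin normal_pdf_ge0.
apply: eq_integral => x _; rewrite -!muleA; congr (_ * _).
rewrite -!EFinM; congr EFin.
rewrite !normal_pdfE ?oner_eq0// /normal_fun !subr0 expr1n.
have -> : expR (- (s * x + m) ^+ 2 / (1 *+ 2)) =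
    (expR (- ((s * x + m) ^+ 2 - x ^+ 2) / 2) * expR (- x ^+ 2 / (1 *+ 2)))%R.
  by rewrite -expRD; congr expR; field.
by ring.
Qed.

End normal_affine.

(** * Linear change of variables *)

Section change_of_variables.
Context {R : realType}.
Local Notation N01 := (@normal_prob R 0 1).

Definition sqnorm m (z : 'cV[R]_m) : R := \sum_i z i 0 ^+ 2.

Lemma measurable_sqnorm m : measurable_fun [set: 'cV[R]_m] (@sqnorm m).
Proof.
by apply: measurable_sumr => i; apply: measurable_funX; exact: measurable_coord.
Qed.

(** This is |det B| phi(B z) / phi(z) for the standard normal density phi, the normalizing constants
    cancelling. For invertible B it is the density of the law of B^(-1) Z with respect to that of
    Z. *)
Definition gauss_jac m (B : 'M[R]_m) (z : 'cV[R]_m) : R :=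
  `|\det B| * expR (- (sqnorm (B *m z) - sqnorm z) / 2).

Lemma gauss_jac_ge0 m (B : 'M[R]_m) z : 0 <= gauss_jac B z.
Proof. by rewrite mulr_ge0 ?expR_ge0. Qed.

Lemma measurable_gauss_jac m (B : 'M[R]_m) : measurable_fun setT (gauss_jac B).
Proof.
apply: measurable_funM => //; apply: measurableT_comp => //=.
apply: measurable_funM => //; apply: measurable_funN; apply: measurable_funB.
  exact: (measurableT_comp (@measurable_sqnorm m) (measurable_mulmx B)).
exact: measurable_sqnorm.
Qed.

Section fixed_gaussian.
Variables (m : nat) (nu : probability 'cV[R]_m R).
Hypothesis hnu : std_gaussian nu.

(** Isolated as a property of B because it is stable under products: it can be proved for
    permutations and one-row modifications of the identity, then assembled by an LUP
    factorization. *)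
Definition change_of_variables_at (B : 'M[R]_m) := forall f : 'cV[R]_m -> \bar R,
  measurable_fun setT f -> (forall z, 0 <= f z)%E ->
  (\int[nu]_z f z = \int[nu]_z (f (B *m z) * (gauss_jac B z)%:E))%E.

Lemma change_of_variables_mul B C : change_of_variables_at B ->
  change_of_variables_at C -> change_of_variables_at (B *m C).
Proof.
move=> hB hC f mf f0; rewrite (hB f mf f0).
have mB := measurable_mulmx B.
rewrite (hC (fun z => f (B *m z) * (gauss_jac B z)%:E)%E).
- apply: eq_integral => z _; rewrite -muleA -EFinM mulmxA; congr (_ * _%:E)%E.
  rewrite /gauss_jac det_mulmx normrM mulrACA -expRD mulmxA; congr (_ * expR _).
  by field.
- apply: emeasurable_funM; first exact: (measurableT_comp mf mB).
  by apply/measurable_EFinP; exact: measurable_gauss_jac.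
- by move=> z; rewrite mule_ge0// lee_fin gauss_jac_ge0.
Qed.

(** Such a B moves coordinate i only, by an affine map whose shift depends on the other coordinates.
    After coordinate i is resampled, the one-dimensional substitution applies with these coordinates
    frozen. *)
Lemma change_of_variables_row (i : 'I_m) (B : 'M[R]_m) : B i i != 0 -> \det B = B i i ->
  (forall j k, j != i -> B j k = (j == k)%:R) -> change_of_variables_at B.
Proof.
move=> Bii dB hB f mf f0.
rewrite [LHS](integral_upd i hnu mf f0) [RHS](@integral_upd _ _ nu i)//; last 2 first.
- apply: emeasurable_funM; first exact: (measurableT_comp mf (measurable_mulmx B)).
  by apply/measurable_EFinP; exact: measurable_gauss_jac.
- by move=> z; rewrite mule_ge0// lee_fin gauss_jac_ge0.
apply: eq_integral => z _.
pose a := \sum_(j | j != i) B i j * z j 0.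
have BE x : B *m upd i (x, z) = upd i (B i i * x + a, z).
  apply/colP => j; rewrite /upd !mxE.
  have [->|ji] := eqVneq j i.
    rewrite (bigD1 i)//= !mxE eqxx; congr (_ + _); apply: eq_bigr => k ki.
    by rewrite !mxE (negbTE ki).
  rewrite (bigD1 j)//= !mxE (negbTE ji) hB// eqxx mul1r big1 ?addr0// => k kj.
  by rewrite hB// eq_sym (negbTE kj) mul0r.
have sE x : sqnorm (upd i (x, z)) = x ^+ 2 + \sum_(j | j != i) z j 0 ^+ 2.
  rewrite /sqnorm (bigD1 i)//= !mxE eqxx; congr (_ + _); apply: eq_bigr => k ki.
  by rewrite !mxE (negbTE ki).
etransitivity.
  apply: (@normal01_affine _ (B i i) a (fun x => f (upd i (x, z)))).
  - exact: Bii.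
  - apply: (measurableT_comp mf).
    apply: (measurableT_comp (measurable_upd i)).
    exact: measurable_fun_pair.
  - by move=> x; exact: f0.
apply: eq_integral => x _; rewrite BE /gauss_jac BE !sE dB.
set S := \sum_(_ | _) _.
by rewrite (_ : (B i i * x + a) ^+ 2 + S - (x ^+ 2 + S) =
  (B i i * x + a) ^+ 2 - x ^+ 2)//; ring.
Qed.

Lemma change_of_variables_perm (s : {perm 'I_m}) : change_of_variables_at (perm_mx s).
Proof.
move=> f mf f0.
have ms := measurable_mulmx (perm_mx s : 'M[R]_m).
have sE (z : 'cV[R]_m) i : (perm_mx s *m z) i 0 = z (s i) 0.
  by rewrite -row_permE mxE.
have -> : (\int[nu]_z f z = \int[image_prob nu ms]_z f z)%E.
  apply: eq_prob_integral; apply: prob_cV_unique => E mE.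
  rewrite [RHS]image_probE.
  rewrite (_ : _ @^-1` box E = box (fun i => E (s^-1 i)%g)).
    rewrite [LHS]hnu// [RHS]hnu//; apply: (reindex_inj (@perm_inj _ (s^-1)%g)).
  apply/seteqP; split => z /= h i.
    by have := h (s^-1 i)%g; rewrite sE permKV.
  by rewrite sE; have := h (s i); rewrite permK.
rewrite ge0_integral_image_prob//; apply: eq_integral => z _.
rewrite /gauss_jac det_perm normr_sign mul1r.
rewrite (_ : sqnorm (perm_mx s *m z) = sqnorm z).
  by rewrite subrr oppr0 mul0r expR0 mule1.
rewrite /sqnorm [RHS](reindex_inj (@perm_inj _ s)) /=; apply: eq_bigr => i _.
by rewrite sE.
Qed.

Lemma change_of_variables1 : change_of_variables_at 1%:M.
Proof. by have := change_of_variables_perm 1%g; rewrite perm_mx1. Qed.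

Lemma change_of_variables_trig (L : 'M[R]_m) : is_trig_mx L ->
  (forall i, L i i != 0) -> change_of_variables_at L.
Proof.
move=> /is_trig_mxP tL dL.
(* [Lk k] keeps the rows of L from index k on, so that [Lk 0] is L and [Lk m] the identity. Passing
   from i + 1 to i multiplies on the left by a one-row modification of the identity; since L is
   lower triangular, its row i only meets rows of [Lk i.+1] that are still those of the identity. *)
pose Lk (k : nat) := \matrix_(i, j) if (k <= i)%N then L i j else (i == j)%:R.
have LkE (i : 'I_m) : Lk i =
    (\matrix_(a, b) if a == i then L a b else (a == b)%:R) *m Lk i.+1.
  apply/matrixP => a b; rewrite !mxE.
  have [->|ai] := eqVneq a i.
    rewrite leqnn (bigD1 b)//= !mxE eqxx big1 ?addr0 => [|j jb].
      case: ltnP => bi; first by rewrite tL ?mul0r.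
      by rewrite eqxx mulr1.
    rewrite !mxE eqxx; case: ltnP => ji; first by rewrite tL ?mul0r.
    by rewrite (negbTE jb) mulr0.
  rewrite (bigD1 a)//= !mxE (negbTE ai) eqxx mul1r big1 ?addr0 => [|j ja].
    by rewrite leq_eqVlt eq_sym (negbTE (_ : a != i :> nat)).
  by rewrite !mxE (negbTE ai) eq_sym (negbTE ja) mul0r.
have h k : (k <= m)%N -> change_of_variables_at (Lk (m - k)%N).
  elim: k => [_|k IH km].
    rewrite subn0 (_ : Lk m = 1%:M); first exact: change_of_variables1.
    by apply/matrixP => a b; rewrite !mxE leqNgt ltn_ord.
  have mk : (m - k.+1 < m)%N by rewrite ltn_subrL (leq_ltn_trans _ km).
  pose i := Ordinal mk.
  have iE : i.+1 = (m - k)%N by rewrite /= subnSK.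
  change (change_of_variables_at (Lk i)); rewrite LkE iE.
  apply: change_of_variables_mul; last exact: IH (ltnW km).
  apply: (change_of_variables_row (i := i)).
  - by rewrite !mxE eqxx.
  - rewrite det_trig.
      rewrite (bigD1 i)//= big1 ?mulr1// => j ji.
      by rewrite !mxE (negbTE ji) eqxx.
    apply/is_trig_mxP => a b ab; rewrite !mxE; case: ifP => _; first exact: tL.
    by rewrite -val_eqE /= ltn_eqF.
  - by move=> a b ai; rewrite !mxE (negbTE ai).
have := h m (leqnn m); rewrite subnn (_ : Lk 0%N = L)//.
by apply/matrixP => a b; rewrite !mxE.
Qed.

Lemma change_of_variables_upper (U : 'M[R]_m) : (forall i j : 'I_m, (j < i)%N -> U i j = 0) ->
  (forall i, U i i != 0) -> change_of_variables_at U.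
Proof.
move=> tU dU.
have inj : injective (@rev_ord m) by exact: rev_ord_inj.
(* Reversing the order of the coordinates conjugates an upper triangular matrix into a lower
   triangular one. *)
pose s := perm inj.
pose L := row_perm s (col_perm s U).
have LE i j : L i j = U (rev_ord i) (rev_ord j) by rewrite !mxE !permE.
have -> : U = perm_mx s *m (L *m perm_mx s).
  rewrite mulmxA; apply/matrixP => i j.
  rewrite -row_permE -{2}(invgK s) -col_permE !mxE.
  have -> : (s^-1 j)%g = rev_ord j.
    by apply: (@perm_inj _ s); rewrite permKV permE rev_ordK.
  by rewrite !permE !rev_ordK.
apply: change_of_variables_mul; first exact: change_of_variables_perm.
apply: change_of_variables_mul; last exact: change_of_variables_perm.
apply: change_of_variables_trig; last by move=> i; rewrite LE.
apply/is_trig_mxP => i j ij; rewrite LE tU//=.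
by rewrite ltn_sub2l// (leq_ltn_trans _ (ltn_ord j)).
Qed.

End fixed_gaussian.

Theorem std_gaussian_change_of_variables m (nu : probability 'cV[R]_m R)
    (B : 'M[R]_m) : std_gaussian nu -> B \in unitmx -> change_of_variables_at nu B.
Proof.
case: m nu B => [|m] nu B hnu uB.
  have -> : B = 1%:M by apply/matrixP => -[].
  by apply: change_of_variables1.
(* B is a permutation times a unit lower triangular matrix times an upper triangular one, whose
   diagonal is nonzero because det B is. *)
have := cormen_lup_correct B; have := cormen_lup_perm B.
have := cormen_lup_detL B; have := cormen_lup_lower B; have := cormen_lup_upper B.
case: (cormen_lup B) => [[Pm L] U] /= hU hL dL /is_perm_mxP[s ->] E.
have BE : B = perm_mx s^-1 *m (L *m U).
  rewrite -[L *m U]E -[_ * B]/(perm_mx s *m B) mulmxA -perm_mxM mulVg.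
  by rewrite perm_mx1 mul1mx.
have tU : is_trig_mx U^T.
  by apply/is_trig_mxP => i j ij; rewrite mxE hU.
have dU i : U i i != 0.
  have : \det U != 0.
    move: uB; rewrite unitmxE BE !det_mulmx dL mul1r unitrM => /andP[_].
    by rewrite unitfE.
  rewrite -det_tr det_trig// => /prodf_neq0 /(_ i isT).
  by rewrite mxE.
rewrite BE.
apply: change_of_variables_mul; first exact: change_of_variables_perm.
apply: change_of_variables_mul.
  apply: (change_of_variables_trig hnu).
    by apply/is_trig_mxP => i j ij; rewrite hL ?(ltnW ij)// -val_eqE /= ltn_eqF.
  by move=> i; rewrite hL// eqxx oner_eq0.
exact: change_of_variables_upper.
Qed.

End change_of_variables.

(** * Orthogonal invariance and uniqueness of Gaussian laws *)

Section orthogonal_invariance.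
Context {R : realType}.

Lemma sqnormE m (z : 'cV[R]_m) : sqnorm z = (z^T *m z) 0 0.
Proof. by rewrite mxE; apply: eq_bigr => i _; rewrite mxE expr2. Qed.

Lemma gauss_jac_orthogonal m (B : 'M[R]_m) z : B *m B^T = 1%:M -> gauss_jac B z = 1.
Proof.
move=> BB; have BB' : B^T *m B = 1%:M by exact: mulmx1C.
have dB : `|\det B| = 1.
  apply/eqP; rewrite -(@eqrXn2 _ 2)// expr1n -normrX expr2 -{2}det_tr -det_mulmx BB.
  by rewrite det1 normr1.
rewrite /gauss_jac dB mul1r !sqnormE trmx_mul -mulmxA (mulmxA B^T) BB' mul1mx.
by rewrite subrr oppr0 mul0r expR0.
Qed.

Lemma ge0_integral_indic_preimage d d' (T : measurableType d) (T' : measurableType d')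
    (Pr : probability T R) (f : T -> T') E :
  measurable_fun setT f -> measurable E ->
  (\int[Pr]_x (\1_E (f x))%:E = Pr (f @^-1` E))%E.
Proof.
move=> mf mE; rewrite -(setIT (f @^-1` E)) -integral_indic//.
by rewrite -[X in measurable X]setTI; exact: mf.
Qed.

Lemma std_gaussian_orthogonal m (nu : probability 'cV[R]_m R) (B : 'M[R]_m) E :
  std_gaussian nu -> B *m B^T = 1%:M -> measurable E ->
  nu [set z | E (B *m z)] = nu E.
Proof.
move=> hnu BB mE.
have uB : B \in unitmx by case: (mulmx1_unit BB).
rewrite -[RHS](ge0_integral_indic_preimage nu (@measurable_id _ _ setT) mE).
rewrite [RHS](std_gaussian_change_of_variables hnu uB).
- rewrite -[LHS](ge0_integral_indic_preimage nu (measurable_mulmx B) mE).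
  by apply: eq_integral => z _; rewrite gauss_jac_orthogonal// mule1.
- by apply/measurable_EFinP; exact: measurable_indic.
- by move=> z; rewrite lee_fin.
Qed.

Definition dotr m (v w : 'rV[R]_m) : R := (v *m w^T) 0 0.

Lemma dotrE m (v w : 'rV[R]_m) : v *m w^T = (dotr v w)%:M.
Proof. by rewrite [LHS]mx11_scalar. Qed.

Lemma dotr_row m k (B C : 'M[R]_(k, m)) i j :
  dotr (row i B) (row j C) = (B *m C^T) i j.
Proof. by rewrite /dotr !mxE; apply: eq_bigr => l _; rewrite !mxE. Qed.

Lemma dotrC m (v w : 'rV[R]_m) : dotr v w = dotr w v.
Proof. by rewrite /dotr !mxE; apply: eq_bigr => l _; rewrite !mxE mulrC. Qed.

Lemma dotrBr m (v w w' : 'rV[R]_m) : dotr v (w - w') = dotr v w - dotr v w'.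
Proof. by rewrite /dotr linearB /= mulmxBr !mxE. Qed.

Lemma dotr_eq0 m (v : 'rV[R]_m) : (dotr v v == 0) = (v == 0).
Proof.
apply/eqP/eqP => [|->]; last by rewrite /dotr mul0mx mxE.
rewrite /dotr mxE => /eqP; rewrite psumr_eq0 => [/allP h|i _]; last first.
  by rewrite mxE -expr2 sqr_ge0.
apply/rowP => i; have := h i (mem_index_enum i).
by rewrite !mxE -expr2 sqrf_eq0 => /eqP.
Qed.

Definition householder m (v : 'rV[R]_m) : 'M[R]_m :=
  1%:M - (2 / dotr v v) *: (v^T *m v).

Lemma householder_orthogonal m (v : 'rV[R]_m) : v != 0 ->
  householder v *m (householder v)^T = 1%:M.
Proof.
move=> v0; have d0 : dotr v v != 0 by rewrite dotr_eq0.
have -> : (householder v)^T = householder v.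
  by rewrite /householder linearB /= trmx1 linearZ /= trmx_mul trmxK.
have MM : (v^T *m v) *m (v^T *m v) = dotr v v *: (v^T *m v).
  by rewrite -mulmxA (mulmxA v) dotrE mul_scalar_mx -scalemxAr.
rewrite /householder mulmxBr mulmx1 -scalemxAr mulmxBl mul1mx -scalemxAl MM.
rewrite !scalerA scalerBr scalerA; apply/matrixP => i j; rewrite !mxE.
by field.
Qed.

Lemma mul_householder m (w v : 'rV[R]_m) :
  w *m householder v = w - (2 * dotr w v / dotr v v) *: v.
Proof.
rewrite /householder mulmxBr mulmx1 -scalemxAr mulmxA dotrE mul_scalar_mx scalerA.
by congr (_ - _ *: _); rewrite mulrAC.
Qed.

(* The rows of B are moved onto those of C one after the other: the reflection
   exchanging the j-th rows fixes the earlier ones by equality of the Gram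
   matrices. *)
Lemma gram_eq_orthogonal k m (B C : 'M[R]_(k, m)) : B *m B^T = C *m C^T ->
  exists2 U : 'M[R]_m, U *m U^T = 1%:M & B *m U = C.
Proof.
move=> BC.
have h j : (j <= k)%N -> exists2 U : 'M[R]_m, U *m U^T = 1%:M &
    forall i : 'I_k, (i < j)%N -> row i (B *m U) = row i C.
  elim: j => [_|j IH jk]; first by exists 1%:M => //; rewrite trmx1 mulmx1.
  have [U OO OC] := IH (ltnW jk).
  have BO : (B *m U) *m (B *m U)^T = C *m C^T.
    by rewrite trmx_mul mulmxA -(mulmxA B) OO mulmx1.
  pose jo := Ordinal jk.
  pose v := row jo (B *m U) - row jo C.
  have [v0|v0] := eqVneq v 0.
    exists U => // i; rewrite ltnS leq_eqVlt => /orP[/eqP ij|]; last exact: OC.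
    rewrite (_ : i = jo); last exact: val_inj.
    by apply/eqP; rewrite -subr_eq0 -/v v0.
  exists (U *m householder v).
    by rewrite trmx_mul mulmxA -(mulmxA U) householder_orthogonal// mulmx1.
  move=> i ij; rewrite mulmxA row_mul mul_householder.
  have bb : dotr (row jo (B *m U)) (row jo (B *m U)) = dotr (row jo C) (row jo C).
    by rewrite !dotr_row BO.
  move: ij; rewrite ltnS leq_eqVlt => /orP[/eqP ij|ij].
    rewrite (_ : i = jo); last exact: val_inj.
    (* The two rows have equal norms, so the mirror orthogonal to their difference v exchanges them;
       the coefficient in [mul_householder] is then exactly 1. *)
    have vv : dotr v v = 2 * dotr (row jo (B *m U)) v.
      rewrite {1}/v dotrBr dotrC (dotrC v) /v !dotrBr bb.
      by rewrite (dotrC (row jo C)); ring.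
    rewrite -vv divff ?dotr_eq0// scale1r /v.
    by rewrite opprB addrC subrK.
  rewrite OC// (_ : dotr _ v = 0); first by rewrite mulr0 mul0r scale0r subr0.
  by rewrite /v dotrBr -{1}OC// !dotr_row BO subrr.
have [U OO OC] := h k (leqnn k).
by exists U => //; apply/row_matrixP => i; exact: OC.
Qed.

(** Both laws are realized on R^(r+s), as images of one standard Gaussian vector by [B 0] and [0 C].
    These matrices have the same Gram matrix S, hence differ by an orthogonal factor, which
    preserves the standard Gaussian law. No characteristic function is involved. *)
Theorem centered_gaussian_unique k (S : 'M[R]_k) (m1 m2 : set 'cV[R]_k -> \bar R) :
  centered_gaussian S m1 -> centered_gaussian S m2 ->
  forall E, measurable E -> m1 E = m2 E.
Proof.
move=> [r [B [n1 [h1 BS m1E]]]] [s [C [n2 [h2 CS m2E]]]] E mE.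
rewrite m1E// m2E//.
pose nu := image_prob (n1 \x n2)%E (@measurable_col_mx R r s).
have hnu : std_gaussian nu by exact: std_gaussian_col_mx.
have mEB : measurable [set z : 'cV[R]_r | E (B *m z)].
  by rewrite -[X in measurable X]setTI; exact: measurable_mulmx.
have mEC : measurable [set z : 'cV[R]_s | E (C *m z)].
  by rewrite -[X in measurable X]setTI; exact: measurable_mulmx.
pose B' : 'M[R]_(k, r + s) := row_mx B 0.
pose C' : 'M[R]_(k, r + s) := row_mx 0 C.
have -> : n1 [set z | E (B *m z)] = nu [set z | E (B' *m z)].
  rewrite [RHS](@image_prob_prodE _ _ _ _ _ _ _ _ _ _ _ _
    [set z | E (B *m z)] setT)//.
    by rewrite (_ : n2 setT = 1%E) ?mule1//; exact: probability_setT.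
  by apply/seteqP; split => [[z w]|[z w]] /=;
    rewrite /B' mul_row_col mul0mx addr0// => -[].
have -> : n2 [set z | E (C *m z)] = nu [set z | E (C' *m z)].
  rewrite [RHS](@image_prob_prodE _ _ _ _ _ _ _ _ _ _ _ _
    setT [set z | E (C *m z)])//.
    by rewrite (_ : n1 setT = 1%E) ?mul1e//; exact: probability_setT.
  by apply/seteqP; split => [[z w]|[z w]] /=;
    rewrite /C' mul_row_col mul0mx add0r// => -[].
have [U OO BO] : exists2 U, U *m U^T = 1%:M & B' *m U = C'.
  apply: gram_eq_orthogonal.
  by rewrite !tr_row_mx !mul_row_col !trmx0 !mulmx0 addr0 add0r BS CS.
rewrite -BO -[LHS](std_gaussian_orthogonal hnu OO).
  by congr (nu _); apply/seteqP; split => z /=; rewrite mulmxA.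
by rewrite -[X in measurable X]setTI; exact: measurable_mulmx.
Qed.

End orthogonal_invariance.

(** * Probabilities as real numbers and entrywise matrix limits *)

Section real_probability.
Context d (T : measurableType d) (R : realType) (P : probability T R).

Definition pr (A : set T) : R := fine (P A).

Lemma prE A : measurable A -> (pr A)%:E = P A.
Proof. by move=> mA; rewrite fineK// fin_num_measure. Qed.

Lemma le_pr A B : measurable A -> measurable B -> A `<=` B -> pr A <= pr B.
Proof. by move=> mA mB AB; rewrite -lee_fin !prE// le_measure// inE. Qed.

Lemma prT : pr setT = 1.
Proof. by rewrite /pr probability_setT. Qed.

Lemma pr_set0 : pr set0 = 0.
Proof. by rewrite /pr measure0. Qed.

Lemma pr_setC A : measurable A -> pr (~` A) = 1 - pr A.
Proof.
move=> mA; apply: EFin_inj; rewrite prE; last exact: measurableC.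
by rewrite probability_setC// EFinB prE.
Qed.

Lemma le_prU A B : measurable A -> measurable B -> pr (A `|` B) <= pr A + pr B.
Proof.
move=> mA mB; rewrite -lee_fin EFinD !prE//; first exact: measureU2.
exact: measurableU.
Qed.

Lemma pr_bigsetU (I : finType) (A : I -> set T) :
  (forall i, measurable (A i)) -> trivIset setT A ->
  pr [set x | exists i, A i x] = \sum_i pr (A i).
Proof.
move=> mA tA.
have -> : [set x | exists i, A i x] = \bigcup_(i in [set` index_enum I]) A i.
  apply/seteqP; split=> x /= [i]; last by move=> _ Ax; exists i.
  by move=> Ax; exists i => //=; rewrite mem_index_enum.
rewrite bigcup_seq.
elim: (index_enum I) (index_enum_uniq I) => [_|i s IH /andP[iN us]].
  by rewrite !big_nil pr_set0.
have mU : measurable (\big[setU/set0]_(j <- s) A j) by exact: bigsetU_measurable.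
rewrite !big_cons -IH//; apply: EFin_inj; rewrite EFinD !prE//.
  rewrite measureU// -bigcup_seq; apply/seteqP; split => // x [Aix [j /= js Ajx]].
  have ij : i = j by apply: tA => //; exists x.
  by move: iN; rewrite ij js.
exact: measurableU.
Qed.

Lemma le_pr_bigsetU (I : finType) (A : I -> set T) :
  (forall i, measurable (A i)) ->
  pr [set x | exists i, A i x] <= \sum_i pr (A i).
Proof.
move=> mA.
have -> : [set x | exists i, A i x] = \big[setU/set0]_(i <- index_enum I) A i.
  rewrite -bigcup_seq; apply/seteqP; split=> x /= [i]; last by move=> _ Ax; exists i.
  by move=> Ax; exists i => //=; rewrite mem_index_enum.
elim: (index_enum I) => [|i s IH]; first by rewrite !big_nil pr_set0.
rewrite !big_cons (le_trans (le_prU _ _))//; last by rewrite lerD2l.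
exact: bigsetU_measurable.
Qed.

(** The coupling inequality, with C an exceptional event outside which A and B coincide. *)
Lemma pr_dist A B C : measurable A -> measurable B -> measurable C ->
  (forall x, ~ C x -> (A x <-> B x)) -> `|pr A - pr B| <= pr C.
Proof.
move=> mA mB mC h.
have key A' B' : measurable A' -> measurable B' ->
    (forall x, ~ C x -> (A' x -> B' x)) -> pr A' <= pr B' + pr C.
  move=> mA' mB' h'; apply: le_trans (le_prU mB' mC).
  apply: le_pr => //; first exact: measurableU.
  by move=> x Ax; have [Cx|nCx] := pselect (C x); [right|left; exact: h'].
have := key A B mA mB (fun x nC => proj1 (h x nC)).
have := key B A mB mA (fun x nC => proj2 (h x nC)).
by rewrite ler_norml => ? ?; apply/andP; split; lra.
Qed.

End real_probability.

Section matrix_convergence.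
Context {R : realType}.

Definition mx_cvg m n (M : nat -> 'M[R]_(m, n)) (L : 'M[R]_(m, n)) :=
  forall i j, M k i j @[k --> \oo] --> L i j.

Lemma mx_cvg_of_cvg m n (M : nat -> 'M[R]_(m, n)) L :
  M k @[k --> \oo] --> L -> mx_cvg M L.
Proof.
move=> h i j.
exact: (cvg_comp M (fun A : 'M[R]_(m, n) => A i j) h (@coord_continuous R m n i j L)).
Qed.

Lemma mx_cvg_cst m n (M : 'M[R]_(m, n)) : mx_cvg (fun=> M) M.
Proof. by move=> i j; exact: cvg_cst. Qed.

Lemma cvg_bigsum (I : Type) (s : seq I) (p : pred I) (f : I -> nat -> R) (l : I -> R) :
  (forall i, p i -> f i k @[k --> \oo] --> l i) ->
  \sum_(i <- s | p i) f i k @[k --> \oo] --> \sum_(i <- s | p i) l i.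
Proof. by move=> h; apply: cvg_big => //; exact: add_continuous. Qed.

Lemma cvg_bigprod (I : Type) (s : seq I) (p : pred I) (f : I -> nat -> R) (l : I -> R) :
  (forall i, p i -> f i k @[k --> \oo] --> l i) ->
  \prod_(i <- s | p i) f i k @[k --> \oo] --> \prod_(i <- s | p i) l i.
Proof. by move=> h; apply: cvg_big => //; exact: mul_continuous. Qed.

Lemma mx_cvg_mul m n p (M : nat -> 'M[R]_(m, n)) (N : nat -> 'M[R]_(n, p)) L K :
  mx_cvg M L -> mx_cvg N K -> mx_cvg (fun k => M k *m N k) (L *m K).
Proof.
move=> hM hN i j; rewrite mxE; under eq_cvg do rewrite mxE.
by apply: cvg_bigsum => l _; apply: cvgM; [exact: hM|exact: hN].
Qed.

Lemma mx_cvg_add m n (M N : nat -> 'M[R]_(m, n)) L K :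
  mx_cvg M L -> mx_cvg N K -> mx_cvg (fun k => M k + N k) (L + K).
Proof.
move=> hM hN i j; rewrite mxE; under eq_cvg do rewrite mxE.
by apply: cvgD; [exact: hM|exact: hN].
Qed.

Lemma mx_cvg_scale m n (M : nat -> 'M[R]_(m, n)) (a : nat -> R) L (b : R) :
  a k @[k --> \oo] --> b -> mx_cvg M L -> mx_cvg (fun k => a k *: M k) (b *: L).
Proof.
move=> ha hM i j; rewrite mxE; under eq_cvg do rewrite mxE.
by apply: cvgM; [exact: ha|exact: hM].
Qed.

Lemma mx_cvg_tr m n (M : nat -> 'M[R]_(m, n)) L :
  mx_cvg M L -> mx_cvg (fun k => (M k)^T) L^T.
Proof. by move=> hM i j; rewrite mxE; under eq_cvg do rewrite mxE; exact: hM. Qed.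

Lemma mx_cvg_det m (M : nat -> 'M[R]_m) L :
  mx_cvg M L -> \det (M k) @[k --> \oo] --> \det L.
Proof.
move=> hM; apply: cvg_bigsum => s _; apply: cvgM; first exact: cvg_cst.
by apply: cvg_bigprod => i _; exact: hM.
Qed.

(** Cramer's formula is continuous where the determinant is nonzero; it gives [invmx (M k)] only
    once det (M k) is nonzero, which holds eventually. *)
Lemma mx_cvg_inv m (M : nat -> 'M[R]_m) L : L \in unitmx ->
  mx_cvg M L -> mx_cvg (fun k => invmx (M k)) (invmx L).
Proof.
move=> uL hM i j.
have dL : \det L != 0 by rewrite -unitfE -unitmxE.
have hd := mx_cvg_det hM.
have : ((\det (M k))^-1 * \adj (M k) i j) @[k --> \oo] --> invmx L i j.
  rewrite /invmx uL mxE; apply: cvgM; first exact: cvgV.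
  rewrite mxE; under eq_cvg do rewrite mxE.
  apply: cvgM; first exact: cvg_cst.
  by apply: mx_cvg_det => a b; rewrite !mxE; under eq_cvg do rewrite !mxE; exact: hM.
move=> h; apply: cvg_trans h; apply: near_eq_cvg.
have : \forall k \near \oo, \det (M k) != 0 by exact: cvgr_neq0 hd dL.
apply: filterS => k dk.
by rewrite /invmx unitmxE unitfE dk !mxE.
Qed.

End matrix_convergence.

(** * Total variation between linear images of a Gaussian vector *)

Section total_variation.
Context {R : realType}.
Variables (m : nat) (nu : probability 'cV[R]_m R).
Hypothesis hnu : std_gaussian nu.

Lemma measurable_mulmx_preimage k (B : 'M[R]_(k, m)) E : measurable E ->
  measurable [set z : 'cV[R]_m | E (B *m z)].
Proof.
by move=> mE; rewrite -[X in measurable X]setTI; exact: measurable_mulmx.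
Qed.

(** The integrand of Scheffe's lemma. The positive part of 1 - J is bounded by 1, so dominated
    convergence applies to it directly; it bounds the excess of the law of B Z over nu on every E,
    and applying this to the complement of E bounds the opposite difference. *)
Let deficit (B : 'M[R]_m) z : R := Num.max 0 (1 - gauss_jac B z).

Let deficit_ge0 B z : 0 <= deficit B z.
Proof. by rewrite le_max lexx. Qed.

Let measurable_deficit B : measurable_fun setT (deficit B).
Proof.
apply: measurable_maxr => //; apply: measurable_funB => //.
exact: measurable_gauss_jac.
Qed.

Let deficit_bound1 B E : B \in unitmx -> measurable E ->
  (nu [set z | E (B *m z)] <= nu E + \int[nu]_z (deficit B z)%:E)%E.
Proof.
move=> uB mE.
have mI (D : set 'cV[R]_m) : measurable D -> measurable_fun setT (fun z => (\1_D z : R)%:E).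
  by move=> mD; apply/measurable_EFinP; exact: measurable_indic.
have mB := measurable_mulmx B.
rewrite -[leLHS](ge0_integral_indic_preimage nu mB mE).
rewrite -[X in (_ <= X + _)%E](ge0_integral_indic_preimage nu (@measurable_id _ _ setT) mE).
rewrite [X in (_ <= X + _)%E](std_gaussian_change_of_variables hnu uB (mI _ mE)); last first.
  by move=> z; rewrite lee_fin.
have mJ : measurable_fun setT (fun z => (\1_E (B *m z))%:E * (gauss_jac B z)%:E)%E.
  apply: emeasurable_funM; first exact: (measurableT_comp (mI _ mE) mB).
  by apply/measurable_EFinP; exact: measurable_gauss_jac.
have md : measurable_fun setT (fun z => (deficit B z)%:E).
  by apply/measurable_EFinP; exact: measurable_deficit.
rewrite -ge0_integralD//; last 2 first.
- by move=> z _; rewrite mule_ge0// lee_fin ?gauss_jac_ge0.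
- by move=> z _; rewrite lee_fin.
apply: ge0_le_integral => //.
- exact: (measurableT_comp (mI _ mE) mB).
- exact: emeasurable_funD.
move=> z _; rewrite -EFinM -EFinD lee_fin indicE.
case: (_ \in _); rewrite ?mul1r ?mul0r ?add0r ?deficit_ge0//.
by rewrite addrC -lerBlDr le_max lexx orbT.
Qed.

Let deficit_bound B E : B \in unitmx -> measurable E ->
  `|pr nu [set z | E (B *m z)] - pr nu E| <= fine (\int[nu]_z (deficit B z)%:E).
Proof.
move=> uB mE.
have mEB := measurable_mulmx_preimage B mE.
have ifin : (\int[nu]_z (deficit B z)%:E)%E \is a fin_num.
  rewrite ge0_fin_numE; last by apply: integral_ge0 => z _; rewrite lee_fin.
  apply: (@le_lt_trans _ _ (\int[nu]_z (cst 1 z)))%E; last first.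
    by rewrite integral_cst// mul1e (le_lt_trans (probability_le1 _ _)) ?ltry.
  apply: ge0_le_integral => //.
  - by move=> z _; rewrite lee_fin.
  - by apply/measurable_EFinP; exact: measurable_deficit.
  - move=> z _; rewrite lee_fin ge_max ler01 /= gerBl; exact: gauss_jac_ge0.
have b1 D : measurable D ->
    pr nu [set z | D (B *m z)] <= pr nu D + fine (\int[nu]_z (deficit B z)%:E).
  move=> mD; rewrite -lee_fin EFinD prE ?prE ?fineK//.
    exact: deficit_bound1.
  exact: measurable_mulmx_preimage.
rewrite ler_norml lerBlDl b1// andbT.
have := b1 _ (measurableC mE).
have -> : [set z | (~` E) (B *m z)] = ~` [set z | E (B *m z)] by [].
by rewrite (pr_setC nu mE) (pr_setC nu mEB); lra.
Qed.

Let deficit_cvg (B : nat -> 'M[R]_m) : mx_cvg B 1%:M ->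
  fine (\int[nu]_z (deficit (B k) z)%:E) @[k --> \oo] --> 0.
Proof.
move=> hB.
have hJ z : gauss_jac (B k) z @[k --> \oo] --> (1 : R).
  have -> : (1 : R) = `|\det (1%:M : 'M[R]_m)| *
      expR (- (sqnorm (1%:M *m z) - sqnorm z) / 2).
    by rewrite det1 normr1 mul1r mul1mx subrr oppr0 mul0r expR0.
  apply: cvgM; first by apply: cvg_norm; exact: mx_cvg_det.
  apply: continuous_cvg; first exact: continuous_expR.
  apply: cvgM; last exact: cvg_cst.
  apply: cvgN; apply: cvgB; last exact: cvg_cst.
  apply: cvg_bigsum => i _.
  rewrite expr2; under eq_cvg do rewrite expr2.
  have hz := mx_cvg_mul hB (@mx_cvg_cst _ _ _ z).
  by apply: cvgM; exact: (hz i 0).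
pose f k z := (deficit (B k) z)%:E.
have mf k : measurable_fun setT (f k).
  by apply/measurable_EFinP; exact: measurable_deficit.
have cf : {ae nu, forall z, setT z -> f ^~ z @ \oo --> (cst 0%E : _ -> \bar R) z}.
  apply: aeW => z _ /=; apply: cvg_EFin; first exact: nearW.
  apply: (@squeeze_cvgr _ _ _ _ (cst 0) (fun k => `|1 - gauss_jac (B k) z|)).
  - by apply: nearW => k; rewrite deficit_ge0 /= ge_max normr_ge0 ler_norm.
  - exact: cvg_cst.
  have -> : (0 : R) = `|1 - 1| by rewrite subrr normr0.
  by apply: cvg_norm; apply: cvgB; [exact: cvg_cst|exact: hJ].
have i1 : nu.-integrable setT (cst 1%E : _ -> \bar R).
  exact: finite_measure_integrable_cst.
have bf : {ae nu, forall z k, setT z -> (`|f k z| <= (cst 1%E : _ -> \bar R) z)%E}.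
  apply: aeW => z k _; rewrite /f /= lee_fin ger0_norm// ge_max ler01 /= gerBl.
  exact: gauss_jac_ge0.
have [_ _] := dominated_convergence measurableT mf (measurable_cst _) cf i1 bf.
by rewrite integral0 => /fine_cvg.
Qed.

Theorem std_gaussian_linear_tv (M : nat -> 'M[R]_m) (L : 'M[R]_m) :
  L \in unitmx -> mx_cvg M L -> forall e : R, 0 < e ->
  \forall k \near \oo, forall E, measurable E ->
  `|pr nu [set z | E (M k *m z)] - pr nu [set z | E (L *m z)]| <= e.
Proof.
move=> uL hM e e0.
(* Reduction to matrices tending to the identity: the event E (M k z) is the event E (L y) at y = B
   k z. *)
pose B k := invmx L *m M k.
have hB : mx_cvg B 1%:M.
  by rewrite -(mulVmx uL); apply: mx_cvg_mul => //; exact: mx_cvg_cst.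
have h1 : \forall k \near \oo, \det (B k) != 0.
  by apply: cvgr_neq0 (mx_cvg_det hB) _; rewrite det1 oner_eq0.
have /cvgrPdist_le /(_ e e0) h2 := deficit_cvg hB.
near=> k => E mE.
have uB : B k \in unitmx.
  by rewrite unitmxE unitfE; near: k.
have /= := deficit_bound uB (measurable_mulmx_preimage L mE).
rewrite (_ : [set z | _] = [set z | E (M k *m z)]); last first.
  by apply/seteqP; split => z /=; rewrite /B -mulmxA mulKVmx.
move=> /le_trans; apply; apply: le_trans (ler_norm _) _.
rewrite -normrN -sub0r; near: k; exact: h2.
Unshelve. all: by end_near. Qed.

End total_variation.

Section measurable_comparisons.
Context d (T : measurableType d) (R : realType).

Lemma measurable_set_ltr (f g : T -> R) :
  measurable_fun setT f -> measurable_fun setT g ->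
  measurable [set x | f x < g x].
Proof.
move=> mf mg; have := measurable_fun_ltr mf mg => /(_ measurableT [set true]).
by rewrite setTI; apply.
Qed.

Lemma measurable_set_ler (f g : T -> R) :
  measurable_fun setT f -> measurable_fun setT g ->
  measurable [set x | f x <= g x].
Proof.
move=> mf mg; have := measurable_fun_ler mf mg => /(_ measurableT [set true]).
by rewrite setTI; apply.
Qed.

Lemma pr_tail (P : probability T R) (f : T -> R) : measurable_fun setT f ->
  forall e : R, 0 < e -> exists K : nat, pr P [set x | K%:R < f x] <= e.
Proof.
move=> mf e e0.
pose F (K : nat) := [set x | (K%:R : R) < f x].
have mF K : measurable (F K) by exact: measurable_set_ltr.
have F0 : \bigcap_K F K = set0.
  apply/seteqP; split => // x /(_ (Num.trunc (f x)).+1 I) /=.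
  by move/(lt_trans (truncnS_gt (f x))); rewrite ltxx.
have FB : {homo F : n m / (n <= m)%N >-> (m <= n)%O}.
  move=> n m nm; apply/subsetPset => x /=; apply: le_lt_trans.
  by rewrite ler_nat.
have h := @nonincreasing_cvg_mu _ _ _ P F
  (le_lt_trans (probability_le1 _ (mF 0%N)) (ltry 1)) mF
  (bigcap_measurableType (fun k _ => mF k)) FB.
move: h; rewrite F0 measure0 => /fine_cvg /cvgrPdist_le /(_ e e0) [K _ hK].
exists K; have := hK K (leqnn K); rewrite /= sub0r normrN; apply: le_trans.
exact: ler_norm.
Qed.

End measurable_comparisons.

Section normal_boundary.
Context {R : realType}.
Local Notation N01 := (@normal_prob R 0 1).

Lemma pr_coord m (nu : probability 'cV[R]_m R) i (D : set (measurableTypeR R)) :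
  std_gaussian nu -> measurable D -> nu [set z | D (z i 0)] = N01 D.
Proof.
move=> hnu mD; pose E j := if j == i then D else setT.
have mE j : measurable (E j) by rewrite /E; case: ifP.
transitivity (nu (box E)).
  congr (nu _); apply/seteqP; split => z /=; last by move/(_ i); rewrite /E eqxx.
  by move=> Dz j; rewrite /E; case: eqP => [->|].
rewrite [LHS](hnu E mE) (bigD1 i)//= {1}/E eqxx big1 ?mule1// => j ji.
by rewrite /E (negbTE ji); exact: probability_setT.
Qed.

Lemma pr_normal_itv (a b : R) : a <= b ->
  pr N01 `[a, b] <= (b - a) * normal_peak 1.
Proof.
move=> ab; rewrite -lee_fin prE//.
apply: (@le_trans _ _ (\int[lebesgue_measure]_(x in `[a, b]) (normal_peak 1)%:E)%E).
  apply: ge0_le_integral => //.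
  - by move=> x _; rewrite lee_fin normal_pdf_ge0.
  - apply/measurable_EFinP/measurable_funTS; exact: measurable_normal_pdf.
  - by move=> x _; rewrite lee_fin normal_pdf_ub.
by rewrite integral_cst//= lebesgue_measure_itv/= lte_fin muleC;
  case: ltP => // _; rewrite mul0e lee_fin mulr_ge0 ?subr_ge0// normal_peak_ge0.
Qed.

(** The normal density is bounded by its peak, so r can be chosen before c, uniformly over all
    thresholds. *)
Lemma pr_normal_boundary (e : R) : 0 < e -> exists2 r : R, 0 < r &
  forall c, pr N01 [set x | `| `|x| - c| <= r] <= e.
Proof.
move=> e0; have p0 : 0 < normal_peak (1 : R) by exact: normal_peak_gt0.
(* The event is covered by two intervals of length 2 r, around c and - c, of total mass at most 4 r
   times the peak. *)
pose r := e / (4 * normal_peak 1); have r0 : 0 < r by rewrite divr_gt0// mulr_gt0.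
exists r => // c.
have mI : measurable [set x : measurableTypeR R | `| `|x| - c| <= r].
  apply: measurable_set_ler => //; apply: measurableT_comp => //.
  by apply: measurable_funB => //; exact: measurableT_comp.
have sub : [set x | `| `|x| - c| <= r] `<=` `[c - r, c + r] `|` `[- c - r, - c + r].
  move=> x /=; rewrite ler_norml => /andP[h1 h2].
  have [x0|x0] := leP 0 x; [left|right]; rewrite in_itv /=; apply/andP; split;
    move: h1 h2; rewrite ?(ger0_norm x0) ?(ltr0_norm x0); lra.
have m1 : measurable (`[c - r, c + r]%classic : set (measurableTypeR R)) by [].
have m2 : measurable (`[- c - r, - c + r]%classic : set (measurableTypeR R)) by [].
apply: le_trans (le_pr N01 mI (measurableU _ _ m1 m2) sub) _.
apply: le_trans (le_prU N01 m1 m2) _.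
apply: le_trans (lerD (pr_normal_itv _) (pr_normal_itv _)) _; [lra..|].
rewrite (_ : _ + _ = r * (4 * normal_peak 1)); last by ring.
by rewrite /r divfK// gt_eqF// mulr_gt0.
Qed.

End normal_boundary.

(** * Concentration of the chi-square law *)

Section chi_square.
Context {R : realType}.

Section fixed_dimension.
Variables (m : nat) (nu : probability 'cV[R]_m R).
Hypothesis hnu : std_gaussian nu.

Lemma gauss_jac_total (B : 'M[R]_m) : B \in unitmx ->
  (\int[nu]_z (gauss_jac B z)%:E = 1)%E.
Proof.
move=> uB; have := std_gaussian_change_of_variables hnu uB.
move=> /(_ (cst 1%E) (measurable_cst _) (fun=> lee01)) h.
transitivity (\int[nu]_z (cst 1%E z * (gauss_jac B z)%:E))%E.
  by apply: eq_integral => z _; rewrite mul1e.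
rewrite -h integral_cst// mul1e; exact: probability_setT.
Qed.

(** Markov's inequality for the Jacobian density, whose total mass is 1. *)
Lemma pr_gauss_jac_ge (B : 'M[R]_m) (E : set 'cV[R]_m) (a : R) : B \in unitmx ->
  measurable E -> 0 <= a -> (forall z, E z -> a <= gauss_jac B z) ->
  a * pr nu E <= 1.
Proof.
move=> uB mE a0 h; rewrite -lee_fin EFinM prE// -(gauss_jac_total uB).
have mJ : measurable_fun setT (fun z => (gauss_jac B z)%:E).
  by apply/measurable_EFinP; exact: measurable_gauss_jac.
rewrite -integral_cst//; apply: (@le_trans _ _ (\int[nu]_(z in E) (gauss_jac B z)%:E)%E).
  apply: ge0_le_integral => //; first exact: measurable_funTS.
apply: ge0_subset_integral => // z _.
by rewrite lee_fin gauss_jac_ge0.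
Qed.

(* Chernoff's bound, the Laplace transform of the chi-square law being the
   total mass of the Jacobian density of a homothety of ratio s. *)
Lemma pr_sqnorm_chernoff (s a : R) : 0 < s ->
  (s * expR (- a / 2)) ^+ m *
    pr nu [set z | (s ^+ 2 - 1) * sqnorm z <= a * m%:R] <= 1.
Proof.
move=> s0.
have uB : (s%:M : 'M[R]_m) \in unitmx.
  by rewrite unitmxE det_scalar unitrX// unitfE gt_eqF.
apply: (pr_gauss_jac_ge uB).
- apply: measurable_set_ler => //; apply: measurable_funM => //.
  exact: measurable_sqnorm.
- by rewrite exprn_ge0// mulr_ge0 ?expR_ge0// ltW.
move=> z /= hz; rewrite /gauss_jac det_scalar mul_scalar_mx.
have -> : sqnorm (s *: z) = s ^+ 2 * sqnorm z.
  by rewrite /sqnorm mulr_sumr; apply: eq_bigr => i _; rewrite mxE exprMn.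
rewrite exprMn -expRM_natr ger0_norm ?exprn_ge0 ?(ltW s0)//.
apply: ler_wpM2l; first by rewrite exprn_ge0// ltW.
rewrite ler_expR; lra.
Qed.

End fixed_dimension.

(** The sign of t selects the tail: a lower tail for t > 0, an upper one for t < 0. With s^2 = 1 +
    t, Chernoff's bound is q^(-m) where q^2 = (1 + t) exp(- a) >= (1 + t) (1 - a) > 1, so it decays
    geometrically. The rank N does not depend on the Gaussian measure, as the dimension will be the
    sample size. *)
Lemma sqnorm_half_tail (t a e : R) : 0 < e -> 0 < 1 + t -> 1 < (1 + t) * (1 - a) ->
  exists N : nat, forall m (nu : probability 'cV[R]_m R), (N <= m)%N ->
  std_gaussian nu -> pr nu [set z | t * sqnorm z <= a * m%:R] <= e.
Proof.
move=> e0 t0 ta.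
pose s := Num.sqrt (1 + t); have s0 : 0 < s by rewrite sqrtr_gt0.
have s2 : s ^+ 2 = 1 + t by rewrite sqr_sqrtr// ltW.
pose q := s * expR (- a / 2).
have q0 : 0 < q by rewrite mulr_gt0// expR_gt0.
have q1 : 1 < q.
  rewrite -(@ltr_pXn2r _ 2)// ?nnegrE ?ltW// expr1n /q exprMn s2.
  rewrite -expRM_natr divfK ?pnatr_eq0//.
  apply: lt_le_trans ta _; rewrite ler_pM2l//.
  exact: expR_ge1Dx.
have : (q^-1) ^+ k @[k --> \oo] --> (0 : R).
  by apply: cvg_expr; rewrite gtr0_norm ?invr_gt0// invf_lt1.
move=> /cvgrPdist_le /(_ e e0) [N _ hN]; exists N => m nu Nm hnu.
have := hN m Nm; rewrite /= sub0r normrN ger0_norm ?exprn_ge0 ?invr_ge0 ?(ltW q0)//.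
apply: le_trans; rewrite exprVn -[leRHS]mul1r ler_pdivlMr ?exprn_gt0// mulrC.
have := pr_sqnorm_chernoff hnu a s0.
by rewrite s2 addrAC subrr add0r.
Qed.

Lemma sqnorm_lln (r e : R) : 0 < r -> 0 < e ->
  exists N : nat, forall m (nu : probability 'cV[R]_m R), (N <= m)%N ->
  std_gaussian nu -> pr nu [set z | r * m%:R <= `|sqnorm z - m%:R| ] <= e.
Proof.
move=> r0 e0; have e20 : 0 < e / 2 by rewrite divr_gt0.
(* For the upper tail, t = - x and a = - x (1 + r) = - r / 2; this x makes (1 + t) (1 - a) equal to
   1 + x r / 2. For the lower tail, t = r and a = r (1 - r) give 1 + r^3. *)
pose x := r / (2 * (1 + r)).
have x0 : 0 < x by rewrite divr_gt0// mulr_gt0// addr_gt0.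
have xr : x * (1 + r) = r / 2.
  by rewrite /x; field; rewrite gt_eqF// addr_gt0.
have x1 : x < 1.
  by rewrite /x ltr_pdivrMr ?mulr_gt0 ?addr_gt0// mul1r; lra.
have c1 : 1 < (1 + r) * (1 - r * (1 - r)).
  rewrite (_ : _ * _ = 1 + r ^+ 3); last by ring.
  by rewrite ltrDl exprn_gt0.
have c2 : 1 < (1 + - x) * (1 - - x * (1 + r)).
  rewrite mulNr opprK xr; have : 0 < x * r by exact: mulr_gt0.
  by move: xr; nra.
have [N1 h1] := sqnorm_half_tail e20 (addr_gt0 ltr01 r0) c1.
have x1' : 0 < 1 + - x by rewrite subr_gt0.
have [N2 h2] := sqnorm_half_tail e20 x1' c2.
exists (maxn N1 N2) => m nu; rewrite geq_max => /andP[Nm1 Nm2] hnu.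
have ms := @measurable_sqnorm R m.
have mE1 : measurable [set z : 'cV[R]_m | r * sqnorm z <= r * (1 - r) * m%:R].
  by apply: measurable_set_ler => //; exact: measurable_funM.
have mE2 : measurable [set z : 'cV[R]_m | - x * sqnorm z <= - x * (1 + r) * m%:R].
  by apply: measurable_set_ler => //; exact: measurable_funM.
rewrite (_ : e = e / 2 + e / 2); last by field.
apply: le_trans (lerD (h1 _ _ Nm1 hnu) (h2 _ _ Nm2 hnu)).
apply: le_trans (le_prU _ mE1 mE2); apply: le_pr => //.
- apply: measurable_set_ler => //; apply: measurableT_comp => //.
  exact: measurable_funB.
- exact: measurableU.
move=> z /=; rewrite ler_normr => /orP[h|h]; [right|left].
  by rewrite -mulrA ler_nM2l ?oppr_lt0//; lra.
by rewrite -mulrA ler_pM2l//; lra.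
Qed.

End chi_square.

(** * Gram-Schmidt factorization *)

Section gram_schmidt.
Context {R : realType} {P : nat}.

Definition pos_def n (M : 'M[R]_n) :=
  M^T = M /\ forall x : 'cV[R]_n, x != 0 -> 0 < (x^T *m M *m x) 0 0.

Lemma pos_def_unit n (M : 'M[R]_n) : pos_def M -> M \in unitmx.
Proof.
move=> [_ hM]; rewrite -row_free_unit -kermx_eq0; apply/eqP/row_matrixP => i.
rewrite row0; apply/eqP/negPn/negP => ki.
have k0 : (row i (kermx M))^T != 0.
  by apply: contra ki => /eqP h; rewrite -[row _ _]trmxK h trmx0.
by have := hM _ k0; rewrite trmxK -row_mul mulmx_ker row0 mul0mx mxE ltxx.
Qed.

Lemma pos_def_inv n (M : 'M[R]_n) : pos_def M -> pos_def (invmx M).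
Proof.
move=> hM; have uM := pos_def_unit hM; case: hM => sM hM.
split=> [|x x0]; first by rewrite trmx_inv sM.
have y0 : invmx M *m x != 0.
  by apply: contra x0 => /eqP h; rewrite -(mulKVmx uM x) h mulmx0.
have := hM _ y0; rewrite trmx_mul trmx_inv sM.
by rewrite -!mulmxA (mulmxA M) mulmxV// mul1mx !mulmxA.
Qed.

(** Multiplying by [pad p] on the right extracts the first p columns, on the left it pads with
    zeros; all sub-blocks thus become matrix products. *)
Definition pad (p : 'I_P.+1) : 'M[R]_(P, p) := first_cols 1%:M p.

Lemma padE (p : 'I_P.+1) i j : pad p i j = ((i : nat) == j)%:R.
Proof. by rewrite !mxE. Qed.

Lemma first_colsE m (D : 'M[R]_(m, P)) p : first_cols D p = D *m pad p.
Proof. by rewrite /pad /first_cols mulmx_colsub mulmx1. Qed.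

Lemma tr_padE (p : 'I_P.+1) : (pad p)^T = rowsub (widen_ord (leq_ord p)) 1%:M.
Proof. by apply/matrixP => i j; rewrite !mxE eq_sym. Qed.

Lemma pad_row m (p : 'I_P.+1) (M : 'M[R]_(P, m)) i j :
  ((pad p)^T *m M) i j = M (widen_ord (leq_ord p) i) j.
Proof. by rewrite tr_padE mul_rowsub_mx mul1mx mxE. Qed.

Lemma upper_leftE (Q : 'M[R]_P) p : upper_left Q p = (pad p)^T *m Q *m pad p.
Proof.
apply/matrixP => i j.
by rewrite -mulmxA pad_row -first_colsE !mxE.
Qed.

Lemma pad_orthonormal (p : 'I_P.+1) : (pad p)^T *m pad p = 1%:M.
Proof. by apply/matrixP => i j; rewrite pad_row padE mxE. Qed.

Lemma pad_proj (p : 'I_P.+1) m (x : 'M[R]_(P, m)) i k :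
  (pad p *m ((pad p)^T *m x)) i k = if (i < p)%N then x i k else 0.
Proof.
rewrite mxE; case: ltnP => ip.
  rewrite (bigD1 (Ordinal ip))//= big1 ?addr0.
    rewrite padE eqxx mul1r pad_row; congr (x _ _); exact: val_inj.
  by move=> j ji; rewrite padE eq_sym (_ : _ == _ = false) ?mul0r//; apply: negbTE.
rewrite big1// => j _; rewrite padE gtn_eqF ?mul0r//.
exact: leq_trans ip.
Qed.

Lemma pad_fixed (p : 'I_P.+1) m (x : 'M[R]_(P, m)) :
  (forall (i : 'I_P) k, (p <= i)%N -> x i k = 0) -> pad p *m ((pad p)^T *m x) = x.
Proof.
move=> h; apply/matrixP => i k; rewrite pad_proj; case: ltnP => // pi.
by rewrite h.
Qed.

(** The order [lift ord0 j] is j + 1, and its last component has the 0-based index j. Positive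
    orders are written in this form throughout. *)
Lemma pad_last_unit (j : 'I_P) :
  pad (lift ord0 j) *m last_unit (lift ord0 j) = delta_mx j 0 :> 'cV[R]_P.
Proof.
have : lift ord0 j = j.+1 :> nat by rewrite lift0.
move: (lift ord0 j) => p pj; apply/colP => i; rewrite !mxE eqxx andbT.
have jl : (j < p)%N by rewrite pj.
rewrite (bigD1 (Ordinal jl))//= big1 ?addr0.
  by rewrite padE mxE /= pj eqxx mulr1 -val_eqE.
move=> k kj; rewrite [X in _ * X]mxE.
rewrite (_ : k.+1 == p = false) ?mulr0//; apply: negbTE.
by apply: contra kj; rewrite [X in _ == X]pj eqSS => /eqP h; apply/eqP/val_inj.
Qed.

Lemma last_entryE p (M : 'M[R]_p) :
  last_entry M = ((last_unit p)^T *m M *m last_unit p) 0 0.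
Proof. by rewrite /last_entry /last_comp mulmxA. Qed.

Section fixed_matrix.
Variable Q : 'M[R]_P.
Hypothesis hQ : pos_def Q.

Lemma pos_def_upper_left p : pos_def (upper_left Q p).
Proof.
case: hQ => sQ pQ; rewrite upper_leftE; split.
  by rewrite !trmx_mul trmxK sQ mulmxA.
move=> x x0; have y0 : pad p *m x != 0.
  apply: contra x0 => /eqP h.
  by rewrite -[x]mul1mx -(pad_orthonormal p) -mulmxA h mulmx0.
by have := pQ _ y0; rewrite trmx_mul !mulmxA.
Qed.

Lemma Qinv_tr p : (Qinv Q p)^T = Qinv Q p.
Proof. by have [] := pos_def_inv (pos_def_upper_left p). Qed.

Lemma Qinv_mul p : Qinv Q p *m ((pad p)^T *m Q *m pad p) = 1%:M.
Proof. by rewrite -upper_leftE mulVmx// pos_def_unit//; exact: pos_def_upper_left. Qed.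

Lemma last_unit_neq0 p : (0 < p)%N -> last_unit p != 0 :> 'cV[R]_p.
Proof.
case: p => // p _; apply/eqP => /colP /(_ ord_max); rewrite !mxE eqxx => /eqP.
by rewrite oner_eq0.
Qed.

Lemma last_entry_Qinv_gt0 (p : 'I_P.+1) : (0 < p)%N -> 0 < last_entry (Qinv Q p).
Proof.
move=> p0; rewrite last_entryE.
have [_] := pos_def_inv (pos_def_upper_left p); apply.
exact: last_unit_neq0.
Qed.

Lemma xi_inf_gt0 (p : 'I_P.+1) : (0 < p)%N -> 0 < xi_inf Q p.
Proof. by move=> p0; rewrite sqrtr_gt0 last_entry_Qinv_gt0. Qed.

Lemma xi_inf_sqr (p : 'I_P.+1) : xi_inf Q p ^+ 2 = last_entry (Qinv Q p).
Proof.
case: (posnP p) => p0; last by rewrite sqr_sqrtr// ltW// last_entry_Qinv_gt0.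
rewrite /xi_inf sqr_sqrtr// last_entryE mxE big1// => i _.
by have := ltn_ord i; rewrite {2}p0 ltn0.
Qed.

(** With Q = X'X / n, this row applied to n^(-1/2) X'Y is sqrt(n) times the last restricted
    least-squares coefficient, divided by xi: the t-statistic of order p up to the scale of the
    noise. *)
Definition gs_row (p : 'I_P.+1) : 'rV[R]_P :=
  (xi_inf Q p)^-1 *: ((last_unit p)^T *m Qinv Q p *m (pad p)^T).

(* Row j normalises the last row of the regression on the first j + 1
   regressors, so that gs_mx W whitens a vector W with covariance Q. *)
Definition gs_mx : 'M[R]_P := \matrix_j gs_row (lift ord0 j).

Lemma row_gs_mx j : row j gs_mx = gs_row (lift ord0 j).
Proof. by rewrite rowK. Qed.

Lemma gs_row_tr p :
  (gs_row p)^T = (xi_inf Q p)^-1 *: (pad p *m (Qinv Q p *m last_unit p)).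
Proof. by rewrite /gs_row linearZ /= !trmx_mul Qinv_tr !trmxK. Qed.

Let gs_row_QE (p : 'I_P.+1) m (Z : 'M[R]_(p, m)) :
  (last_unit p)^T *m Qinv Q p *m (pad p)^T *m Q *m (pad p *m Z) =
  (last_unit p)^T *m Z.
Proof.
have := congr1 (fun M => (last_unit p)^T *m (M *m Z)) (Qinv_mul p).
by rewrite mul1mx !mulmxA.
Qed.

Lemma gs_row_Q_pad_last (p : 'I_P.+1) m (Z : 'M[R]_(p, m)) :
  gs_row p *m Q *m (pad p *m Z) = (xi_inf Q p)^-1 *: ((last_unit p)^T *m Z).
Proof. by rewrite /gs_row -!scalemxAl gs_row_QE. Qed.

(** The Gram-Schmidt property, orthogonality for Q to the earlier basis vectors: [Qinv Q p] cancels
    [upper_left Q p] and leaves the last unit vector, which vanishes on the first j coordinates. *)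
Lemma gs_row_Q_pad (j : 'I_P) (q : 'I_P.+1) : (q <= j)%N ->
  gs_row (lift ord0 j) *m Q *m pad q = 0.
Proof.
move=> qj; set p := lift ord0 j.
have pq : pad q = pad p *m ((pad p)^T *m pad q).
  rewrite pad_fixed// => a b pa.
  rewrite padE gtn_eqF// (leq_trans (ltn_ord b))// (leq_trans qj)//.
  by rewrite ltnW//; move: pa; rewrite /p lift0.
rewrite pq gs_row_Q_pad_last mulmxA -trmx_mul pad_last_unit.
rewrite trmx_delta -rowE (_ : row j (pad q) = 0) ?scaler0//.
by apply/rowP => b; rewrite mxE padE mxE gtn_eqF// (leq_trans (ltn_ord b)).
Qed.

Lemma gs_mx_Q_gs_mx : gs_mx *m Q *m gs_mx^T = 1%:M.
Proof.
have [sQ _] := hQ.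
pose g i := gs_row (lift ord0 i).
have E i j : (gs_mx *m Q *m gs_mx^T) i j = (g i *m Q *m (g j)^T) 0 0.
  by rewrite -dotr_row /dotr row_mul !row_gs_mx.
have upper (i j : 'I_P) : (j < i)%N -> g i *m Q *m (g j)^T = 0.
  move=> ji; rewrite /g [X in _ *m X]gs_row_tr -scalemxAr [X in _ *: X]mulmxA gs_row_Q_pad//.
  by rewrite mul0mx scaler0.
apply/matrixP => i j; rewrite E [RHS]mxE; case: (ltngtP i j) => ij.
- have -> : g i *m Q *m (g j)^T = (g j *m Q *m (g i)^T)^T.
    by rewrite !trmx_mul trmxK sQ mulmxA.
  by rewrite upper// trmx0 mxE -val_eqE ltn_eqF.
- by rewrite upper// mxE -val_eqE gtn_eqF.
have -> : j = i by exact: val_inj.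
have x0 : xi_inf Q (lift ord0 i) != 0 by rewrite gt_eqF// xi_inf_gt0.
rewrite eqxx /g [X in _ *m X]gs_row_tr -scalemxAr gs_row_Q_pad_last scalerA mxE mulmxA.
by rewrite -last_entryE -xi_inf_sqr -expr2 exprVn mulVf// sqrf_eq0.
Qed.

Lemma Q_gs_mx_gs_mx : Q *m gs_mx^T *m gs_mx = 1%:M.
Proof. by apply: mulmx1C; rewrite mulmxA gs_mx_Q_gs_mx. Qed.

(* The regression on the first p regressors, as a function of the whitened
   vector Z = gs_mx W. *)
Definition coef_mx (p : 'I_P.+1) : 'M[R]_(p, P) :=
  Qinv Q p *m (pad p)^T *m Q *m gs_mx^T.

Lemma coef_mx_gs_mx p : coef_mx p *m gs_mx = Qinv Q p *m (pad p)^T.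
Proof. by rewrite /coef_mx -2!mulmxA (mulmxA Q) Q_gs_mx_gs_mx mulmx1. Qed.

Lemma coef_mx_tr p : coef_mx p *m (coef_mx p)^T = Qinv Q p.
Proof.
have [sQ _] := hQ.
rewrite {2}/coef_mx !trmx_mul !trmxK sQ Qinv_tr !mulmxA coef_mx_gs_mx.
have := congr1 (fun M => M *m Qinv Q p) (Qinv_mul p).
by rewrite mul1mx !mulmxA.
Qed.

(** Row j of [gs_mx] is orthogonal for Q to the first p basis vectors. This is the source of the
    independence between the estimator of order p and the later tests. *)
Lemma coef_mx_eq0 (p : 'I_P.+1) i (j : 'I_P) : (p <= j)%N -> coef_mx p i j = 0.
Proof.
move=> pj; have [sQ _] := hQ.
rewrite /coef_mx -!mulmxA (_ : (pad p)^T *m _ = (gs_mx *m Q *m pad p)^T); last first.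
  by rewrite !trmx_mul sQ mulmxA.
rewrite mxE big1// => k _; rewrite [X in _ * X]mxE.
have := congr1 (fun v : 'rV[R]_p => v 0 k) (gs_row_Q_pad pj).
rewrite -row_gs_mx -!row_mul !mxE => ->.
by rewrite mulr0.
Qed.

Lemma last_unit_coef_mx (j : 'I_P) :
  (last_unit (lift ord0 j))^T *m coef_mx (lift ord0 j) =
  xi_inf Q (lift ord0 j) *: delta_mx 0 j.
Proof.
have x0 : xi_inf Q (lift ord0 j) != 0 by rewrite gt_eqF// xi_inf_gt0// lift0.
rewrite /coef_mx !mulmxA.
have -> : (last_unit (lift ord0 j))^T *m Qinv Q (lift ord0 j) *m (pad (lift ord0 j))^T
    = xi_inf Q (lift ord0 j) *: row j gs_mx.
  by rewrite row_gs_mx /gs_row scalerA divff// scale1r.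
by rewrite -!scalemxAl -!row_mul gs_mx_Q_gs_mx row1.
Qed.

(* coef_mx p completed by the coordinates of the whitened vector of index at
   least p, which makes it invertible. *)
Definition full_coef_mx (p : 'I_P.+1) : 'M[R]_P :=
  pad p *m coef_mx p + (1%:M - pad p *m (pad p)^T).

Let pad_compl p : (pad p)^T *m (1%:M - pad p *m (pad p)^T) = 0 :> 'M[R]_(_, P).
Proof. by rewrite mulmxBr mulmx1 mulmxA pad_orthonormal mul1mx subrr. Qed.

Lemma pad_full_coef_mx p : (pad p)^T *m full_coef_mx p = coef_mx p.
Proof. by rewrite /full_coef_mx mulmxDr mulmxA pad_orthonormal mul1mx pad_compl addr0. Qed.

Lemma full_coef_mx_above (p : 'I_P.+1) (z : 'cV[R]_P) (j : 'I_P) : (p <= j)%N ->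
  (full_coef_mx p *m z) j 0 = z j 0.
Proof.
move=> pj; rewrite /full_coef_mx mulmxDl mulmxBl mul1mx -!mulmxA.
have h m (x : 'M[R]_(p, m)) k : (pad p *m x) j k = 0.
  rewrite mxE big1// => i _; rewrite padE gtn_eqF ?mul0r//.
  exact: leq_trans pj.
by rewrite [LHS]mxE [X in _ + X]mxE [X in _ + (_ + X)]mxE !h add0r subr0.
Qed.

(** The product of this matrix by its transpose is block diagonal, with blocks [Qinv Q p] and an
    identity; replacing the first block by [upper_left Q p] gives its inverse. *)
Lemma full_coef_mx_unit p : full_coef_mx p \in unitmx.
Proof.
pose C : 'M[R]_P := 1%:M - pad p *m (pad p)^T.
have CM : coef_mx p *m C = 0.
  rewrite /C mulmxBr mulmx1 -{1}[coef_mx p]trmxK -[X in X^T - _](@pad_fixed p).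
    by rewrite !trmx_mul !trmxK mulmxA subrr.
  by move=> i k pi; rewrite mxE coef_mx_eq0.
have CC : C *m C = C.
  by rewrite {1}/C mulmxBl mul1mx -mulmxA pad_compl mulmx0 subr0.
have CT : C^T = C by rewrite /C linearB /= trmx1 trmx_mul trmxK.
have MC : C *m (coef_mx p)^T = 0 by rewrite -[LHS]trmxK trmx_mul CT trmxK CM trmx0.
have CS : C *m pad p = 0.
  by rewrite -[LHS]trmxK trmx_mul CT pad_compl trmx0.
have SC : (pad p)^T *m C = 0 by exact: pad_compl.
have fE : full_coef_mx p = pad p *m coef_mx p + C by [].
have CE : pad p *m (pad p)^T + C = 1%:M by rewrite /C addrC subrK.
(* The body of C is forgotten: from here on only the relations of the projector on the last P - p
   coordinates are used. *)
move: C CM CC CT MC CS SC fE CE => C CM CC CT MC CS SC fE CE.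
have RR : full_coef_mx p *m (full_coef_mx p)^T =
    pad p *m Qinv Q p *m (pad p)^T + C.
  rewrite fE linearD /= CT mulmxDr !mulmxDl CC trmx_mul.
  rewrite -(mulmxA (pad p) _ C) CM mulmx0 add0r (mulmxA C) MC mul0mx addr0.
  by congr (_ + _); rewrite -coef_mx_tr !mulmxA.
have : full_coef_mx p *m (full_coef_mx p)^T *m
    (pad p *m upper_left Q p *m (pad p)^T + C) = 1%:M.
  rewrite RR mulmxDr !mulmxDl CC -!mulmxA SC !mulmx0 add0r.
  rewrite (mulmxA C) CS mul0mx addr0 (mulmxA (pad p)^T) pad_orthonormal mul1mx.
  by rewrite (mulmxA (Qinv Q p)) upper_leftE Qinv_mul mul1mx.
by move=> /mulmx1_unit[]; rewrite unitmx_mul => /andP[].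
Qed.

End fixed_matrix.
End gram_schmidt.

(** * Continuity of the factorization in the Gram matrix *)

Section limits_of_pos_def.
Context {R : realType}.

Lemma gram_pos_def n m (X : 'M[R]_(n, m)) (a : R) : 0 < a -> \rank X = m ->
  pos_def (a *: (X^T *m X)).
Proof.
move=> a0 rX; split=> [|x x0]; first by rewrite linearZ /= trmx_mul trmxK.
rewrite -scalemxAr -scalemxAl mxE pmulr_rgt0//.
have -> : (x^T *m (X^T *m X) *m x) 0 0 = sqnorm (X *m x).
  by rewrite sqnormE trmx_mul !mulmxA.
rewrite lt_def sumr_ge0 ?andbT => [|i _]; last exact: sqr_ge0.
apply: contra x0 => /eqP s0.
have Xx : X *m x = 0.
  apply/colP => i; move/eqP: s0; rewrite psumr_eq0 => [/allP/(_ i (mem_index_enum i))|j _].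
    by rewrite sqrf_eq0 [RHS]mxE => /eqP.
  exact: sqr_ge0.
have fX : row_free X^T by rewrite /row_free mxrank_tr rX.
apply/eqP; rewrite -[x]trmxK -[0]trmxK; congr (_^T).
by apply: (row_free_inj fX); rewrite trmx0 mul0mx -trmx_mul Xx trmx0.
Qed.

(** The limit is positive semidefinite. If the form vanished at some nonzero x, moving x along y = L
    x, nonzero by invertibility, would give the values 2 t a + t^2 b with a > 0, negative for small
    negative t. *)
Lemma pos_def_cvg m (M : nat -> 'M[R]_m) (L : 'M[R]_m) : mx_cvg M L ->
  (\forall k \near \oo, pos_def (M k)) -> L \in unitmx -> pos_def L.
Proof.
move=> hM hpd uL.
have sL : L^T = L.
  apply/matrixP => i j; rewrite mxE.
  have h1 : M k i j @[k --> \oo] --> L j i.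
    apply: cvg_trans (hM j i); apply: near_eq_cvg.
    by apply: filterS hpd => k [sM _]; rewrite -{2}sM mxE.
  exact: (cvg_unique _ h1 (hM i j)).
have psd (x : 'cV[R]_m) : 0 <= (x^T *m L *m x) 0 0.
  have h : mx_cvg (fun k => x^T *m M k *m x) (x^T *m L *m x).
    apply: mx_cvg_mul; last exact: mx_cvg_cst.
    by apply: mx_cvg_mul => //; exact: mx_cvg_cst.
  have [->|x0] := eqVneq x 0; first by rewrite mulmx0 mxE.
  apply: (cvgr_to_ge (h 0 0)).
  by apply: filterS hpd => k [_ /(_ x x0)/ltW].
split=> // x x0; rewrite lt_def psd andbT; apply/eqP => xLx.
pose y := L *m x.
have y0 : y != 0 by apply: contra x0 => /eqP h; rewrite -(mulKmx uL x) -/y h mulmx0.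
have a0 : 0 < sqnorm y.
  rewrite lt_def sumr_ge0 ?andbT => [|i _]; last exact: sqr_ge0.
  apply: contra y0; rewrite psumr_eq0 => [/allP h|i _]; last exact: sqr_ge0.
  apply/eqP/colP => i; have := h i (mem_index_enum i).
  by rewrite sqrf_eq0 [RHS]mxE => /eqP.
set a := sqnorm y in a0; pose b := (y^T *m L *m y) 0 0.
have b0 : 0 <= b by exact: psd.
have q t : ((x + t *: y)^T *m L *m (x + t *: y)) 0 0 = 2 * t * a + t ^+ 2 * b.
  have e1 : (x^T *m L *m y) 0 0 = a.
    by rewrite /a sqnormE {2}/y trmx_mul sL.
  have e2 : (y^T *m L *m x) 0 0 = a by rewrite /a sqnormE -mulmxA.
  have -> : (x + t *: y)^T = x^T + t *: y^T by apply/matrixP => i j; rewrite !mxE.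
  rewrite mulmxDr !mulmxDl -!scalemxAr -!scalemxAl.
  have eD (N N' : 'M[R]_1) : (N + N') 0 0 = N 0 0 + N' 0 0 by rewrite mxE.
  have eZ u (N : 'M[R]_1) : (u *: N) 0 0 = u * N 0 0 by rewrite mxE.
  by rewrite !(eD, eZ) xLx e1 e2 -/b; ring.
have b1 : 0 < b + 1 by lra.
(* Close to the minimizer - a / b, with b + 1 in place of b since b is only known to be
   nonnegative. *)
have := psd (x + (- a / (b + 1)) *: y); rewrite q leNgt => /negP; apply.
rewrite (_ : _ + _ = - (a ^+ 2 * (b + 2) / (b + 1) ^+ 2)); last by field; rewrite gt_eqF.
by rewrite oppr_lt0 divr_gt0 ?exprn_gt0// mulr_gt0 ?exprn_gt0//; lra.
Qed.

Variables (P : nat) (M : nat -> 'M[R]_P) (Q : 'M[R]_P).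
Hypothesis hM : mx_cvg M Q.
Hypothesis hQ : pos_def Q.

Lemma mx_cvg_Qinv p : mx_cvg (fun k => Qinv (M k) p) (Qinv Q p).
Proof.
apply: mx_cvg_inv; first exact/pos_def_unit/pos_def_upper_left.
by move=> i j; rewrite mxE; under eq_cvg do rewrite mxE; exact: hM.
Qed.

Lemma xi_inf_cvg p : xi_inf (M k) p @[k --> \oo] --> xi_inf Q p.
Proof.
apply: continuous_cvg; first exact: sqrt_continuous.
rewrite last_entryE; under eq_cvg do rewrite last_entryE.
have h : mx_cvg (fun k => (last_unit p)^T *m Qinv (M k) p *m last_unit p)
  ((last_unit p)^T *m Qinv Q p *m last_unit p).
  apply: mx_cvg_mul; last exact: mx_cvg_cst.
  by apply: mx_cvg_mul; [exact: mx_cvg_cst|exact: mx_cvg_Qinv].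
exact: h.
Qed.

Lemma mx_cvg_gs_mx : mx_cvg (fun k => gs_mx (M k)) (gs_mx Q).
Proof.
move=> i j; rewrite mxE; under eq_cvg do rewrite mxE.
have h : mx_cvg (fun k => gs_row (M k) (lift ord0 i)) (gs_row Q (lift ord0 i)).
  apply: mx_cvg_scale.
    apply: cvgV; last exact: xi_inf_cvg.
    by rewrite gt_eqF// xi_inf_gt0// lift0.
  apply: mx_cvg_mul; last exact: mx_cvg_cst.
  by apply: mx_cvg_mul; [exact: mx_cvg_cst|exact: mx_cvg_Qinv].
exact: h.
Qed.

Lemma mx_cvg_coef_mx p : mx_cvg (fun k => coef_mx (M k) p) (coef_mx Q p).
Proof.
apply: mx_cvg_mul; last exact/mx_cvg_tr/mx_cvg_gs_mx.
apply: mx_cvg_mul => //; apply: mx_cvg_mul; last exact: mx_cvg_cst.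
exact: mx_cvg_Qinv.
Qed.

Lemma mx_cvg_full_coef_mx p :
  mx_cvg (fun k => full_coef_mx (M k) p) (full_coef_mx Q p).
Proof.
apply: mx_cvg_add; last exact: mx_cvg_cst.
by apply: mx_cvg_mul; [exact: mx_cvg_cst|exact: mx_cvg_coef_mx].
Qed.

End limits_of_pos_def.

(** * Least squares *)

Section order_of_theory.
Context {R : realType} {P : nat}.

Let order_ofP (theta : 'cV[R]_P) :
  (forall i : 'I_P, (order_of theta <= i)%N -> theta i 0 = 0) /\
  (forall p : 'I_P.+1, (forall i : 'I_P, (p <= i)%N -> theta i 0 = 0) ->
     (order_of theta <= p)%N).
Proof.
rewrite /order_of; case: arg_minnP => [|p /forallP hp pmin].
  by apply/forallP => i; apply/implyP; rewrite leqNgt ltn_ord.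
split=> [i pi|q hq]; first by have /implyP/(_ pi)/eqP := hp i.
by apply: pmin; apply/forallP => i; apply/implyP => /hq ->.
Qed.

Lemma order_of_above (theta : 'cV[R]_P) (i : 'I_P) :
  (order_of theta <= i)%N -> theta i 0 = 0.
Proof. by have [h _] := order_ofP theta; exact: h. Qed.

Lemma order_of_last (theta : 'cV[R]_P) (j : 'I_P) :
  order_of theta = lift ord0 j -> theta j 0 != 0.
Proof.
have [h1 h2] := order_ofP theta => oj; apply/eqP => tj.
have jP : (j < P.+1)%N by rewrite ltnW// ltnS.
have : (order_of theta <= Ordinal jP)%N.
  apply: h2 => i /=; rewrite leq_eqVlt => /orP[/eqP ji|ji].
    by rewrite -(_ : j = i)//; exact: val_inj.
  by apply: h1; rewrite oj lift0.
by rewrite oj lift0 /= ltnn.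
Qed.

End order_of_theory.

Section sample_algebra.
Context {R : realType} {P n : nat}.
Variables (X : 'M[R]_(n, P)).
Hypothesis n0 : (0 < n)%N.
Let Qn : 'M[R]_P := n%:R^-1 *: (X^T *m X).
Hypothesis hQn : pos_def Qn.

Let nR0 : n%:R != 0 :> R. Proof. by rewrite pnatr_eq0 -lt0n. Qed.
Let sn0 : Num.sqrt n%:R != 0 :> R. Proof. by rewrite sqrtr_eq0 -ltNge ltr0n. Qed.
Let snn : Num.sqrt n%:R * Num.sqrt n%:R = n%:R :> R.
Proof. by rewrite -expr2 sqr_sqrtr. Qed.

Let snV : (Num.sqrt n%:R)^-1 * (Num.sqrt n%:R)^-1 = n%:R^-1 :> R.
Proof. by rewrite -invfM snn. Qed.
Let snVn : (Num.sqrt n%:R)^-1 * n%:R = Num.sqrt n%:R :> R.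
Proof. by rewrite -[X in _ * X]snn mulrA mulVf// mul1r. Qed.
Let snnV : Num.sqrt n%:R * n%:R^-1 = (Num.sqrt n%:R)^-1 :> R.
Proof. by rewrite -snV mulrA mulfV// mul1r. Qed.

Let XX : X^T *m X = n%:R *: Qn.
Proof. by rewrite /Qn scalerA divff// scale1r. Qed.

Lemma gramE p : gram X p = n%:R *: upper_left Qn p.
Proof.
rewrite /gram !first_colsE upper_leftE trmx_mul -!mulmxA (mulmxA X^T) XX.
by rewrite -scalemxAl -scalemxAr.
Qed.

Lemma xi_nE p : xi_n X p = xi_inf Qn p.
Proof. by rewrite /xi_n gramE scalerA mulVf// scale1r. Qed.

Lemma ls_coefE (Y : 'cV[R]_n) p :
  ls_coef X Y p = n%:R^-1 *: (Qinv Qn p *m (pad p)^T *m (X^T *m Y)).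
Proof.
have uQ := pos_def_unit (pos_def_upper_left hQn p).
rewrite /ls_coef gramE invmxZ ?unitmxZ ?unitfE// first_colsE trmx_mul.
by rewrite -!scalemxAl !mulmxA.
Qed.

(** It has orthonormal rows, so that the noise is turned into a vector with law N(0, sigma^2 I_P)
    exactly, for every n. *)
Definition whiten_mx : 'M[R]_(P, n) := (Num.sqrt n%:R)^-1 *: (gs_mx Qn *m X^T).

Lemma whiten_mx_tr : whiten_mx *m whiten_mx^T = 1%:M.
Proof.
rewrite /whiten_mx linearZ /= -scalemxAr -scalemxAl scalerA trmx_mul trmxK.
rewrite mulmxA -(mulmxA _ X^T) XX -scalemxAr -scalemxAl scalerA.
by rewrite gs_mx_Q_gs_mx// snV mulVf ?scale1r.
Qed.

Lemma whiten_mx_X : whiten_mx *m X = Num.sqrt n%:R *: (gs_mx Qn *m Qn).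
Proof.
rewrite /whiten_mx -scalemxAl -mulmxA XX -scalemxAr scalerA; congr (_ *: _).
exact: snVn.
Qed.

Lemma coef_mx_whiten p : coef_mx Qn p *m whiten_mx =
  (Num.sqrt n%:R)^-1 *: (Qinv Qn p *m (pad p)^T *m X^T).
Proof. by rewrite /whiten_mx -scalemxAr mulmxA coef_mx_gs_mx. Qed.

Lemma whiten_mx_row (Y : 'cV[R]_n) (j : 'I_P) : (whiten_mx *m Y) j 0 =
  (Num.sqrt n%:R)^-1 * (xi_inf Qn (lift ord0 j))^-1 *
  last_comp (Qinv Qn (lift ord0 j) *m (pad (lift ord0 j))^T *m (X^T *m Y)).
Proof.
have eZ a (N : 'M[R]_1) : (a *: N) 0 0 = a * N 0 0 by rewrite mxE.
have -> : (whiten_mx *m Y) j 0 = (row j (whiten_mx *m Y)) 0 0 by rewrite [RHS]mxE.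
rewrite row_mul /whiten_mx linearZ /= row_mul row_gs_mx /gs_row.
by rewrite -!scalemxAl !eZ /last_comp !mulmxA mulrA.
Qed.

Lemma tstatE (Y : 'cV[R]_n) s (j : 'I_P) :
  tstat X Y s (lift ord0 j) = (whiten_mx *m Y) j 0 / s.
Proof.
rewrite whiten_mx_row /tstat (_ : lift ord0 j == ord0 = false)// ls_coefE xi_nE.
have -> : last_comp (n%:R^-1 *: (Qinv Qn (lift ord0 j) *m (pad (lift ord0 j))^T *m (X^T *m Y)))
  = n%:R^-1 * last_comp (Qinv Qn (lift ord0 j) *m (pad (lift ord0 j))^T *m (X^T *m Y)).
  by rewrite /last_comp -scalemxAr mxE.
by rewrite mulrA snnV invfM; ring.
Qed.

Variables (theta : 'cV[R]_P) (v : 'cV[R]_n).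
Let Y := X *m theta + v.

Lemma whiten_signal : whiten_mx *m Y =
  Num.sqrt n%:R *: (gs_mx Qn *m Qn *m theta) + whiten_mx *m v.
Proof. by rewrite /Y mulmxDr mulmxA whiten_mx_X -scalemxAl. Qed.

Let signal_row (j : 'I_P) : (gs_mx Qn *m Qn *m theta) j 0 =
  (gs_row Qn (lift ord0 j) *m Qn *m theta) 0 0.
Proof.
have -> : (gs_mx Qn *m Qn *m theta) j 0 = (row j (gs_mx Qn *m Qn *m theta)) 0 0.
  by rewrite [RHS]mxE.
by rewrite !row_mul row_gs_mx.
Qed.

Let theta_pad (p : 'I_P.+1) : (order_of theta <= p)%N ->
  pad p *m ((pad p)^T *m theta) = theta.
Proof.
move=> op; apply: pad_fixed => i k pi; rewrite (ord1 k).
by apply: order_of_above; exact: leq_trans pi.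
Qed.

(** Here theta is supported on its first [order_of theta] coordinates, to which row j of [gs_mx] is
    orthogonal for the Gram matrix: the tests above the order of theta see pure noise. *)
Lemma whiten_signal_above (j : 'I_P) : (order_of theta <= j)%N ->
  (whiten_mx *m Y) j 0 = (whiten_mx *m v) j 0.
Proof.
move=> oj; rewrite whiten_signal mxE [X in X + _]mxE signal_row.
rewrite -(theta_pad (leqnn _)) mulmxA gs_row_Q_pad// mul0mx mxE mulr0 add0r//.
Qed.

Lemma whiten_signal_last (j : 'I_P) : order_of theta = lift ord0 j ->
  (whiten_mx *m Y) j 0 = Num.sqrt n%:R * ((xi_inf Qn (lift ord0 j))^-1 * theta j 0)
    + (whiten_mx *m v) j 0.
Proof.
move=> oj; rewrite whiten_signal mxE [X in X + _]mxE signal_row.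
rewrite -{1}(@theta_pad (lift ord0 j)) ?oj// gs_row_Q_pad_last// mxE.
congr (_ * (_ * _) + _); rewrite mulmxA -trmx_mul pad_last_unit trmx_delta.
by rewrite -rowE mxE.
Qed.

Lemma ls_signal (p : 'I_P.+1) : (order_of theta <= p)%N ->
  Num.sqrt n%:R *: (ls X Y p - theta) = pad p *m (coef_mx Qn p *m (whiten_mx *m v)).
Proof.
move=> op; rewrite (mulmxA (coef_mx Qn p)) coef_mx_whiten.
have -> : ls X Y p = theta + n%:R^-1 *: (pad p *m (Qinv Qn p *m (pad p)^T *m (X^T *m v))).
  rewrite /ls -/(pad p) ls_coefE /Y mulmxDr (mulmxA X^T) XX mulmxDr scalerDr mulmxDr.
  rewrite -!scalemxAr -scalemxAl -!scalemxAr scalerA mulVf// scale1r; congr (_ + _).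
  rewrite -{1}(theta_pad op).
  have -> : Qinv Qn p *m (pad p)^T *m (Qn *m (pad p *m ((pad p)^T *m theta))) = (pad p)^T *m theta.
    have := congr1 (fun M => M *m ((pad p)^T *m theta)) (Qinv_mul hQn p).
    by rewrite mul1mx !mulmxA.
  exact: theta_pad.
rewrite addrAC subrr add0r scalerA snnV -scalemxAl -scalemxAr.
by rewrite !mulmxA.
Qed.

(* Pythagoras: the fitted noise has the same norm as its whitened coordinates. *)
Lemma sqnorm_residual :
  ((residual X Y)^T *m residual X Y) 0 0 = sqnorm v - sqnorm (whiten_mx *m v).
Proof.
have pp : pad ord_max *m (pad ord_max)^T = 1%:M :> 'M[R]_P.
  by apply: (@mulmx1C _ P); exact (@pad_orthonormal R P ord_max).
pose B : 'M[R]_P := pad ord_max *m Qinv Qn ord_max *m (pad ord_max)^T.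
have BQ : B *m Qn = 1%:M.
  have := congr1 (fun M => pad ord_max *m M *m (pad ord_max)^T) (Qinv_mul hQn ord_max).
  by rewrite mulmx1 pp !mulmxA -(mulmxA _ (pad ord_max)) pp mulmx1.
have BE : B = (gs_mx Qn)^T *m gs_mx Qn.
  by rewrite -[LHS]mulmx1 -(Q_gs_mx_gs_mx hQn) !mulmxA BQ mul1mx.
(* The hat matrix, that is, the orthogonal projector on the column space of X. *)
have WW : whiten_mx^T *m whiten_mx = n%:R^-1 *: (X *m B *m X^T).
  have -> : whiten_mx^T = (Num.sqrt n%:R)^-1 *: (X *m (gs_mx Qn)^T).
    by rewrite /whiten_mx linearZ /= trmx_mul trmxK.
  rewrite BE /whiten_mx -scalemxAl -scalemxAr scalerA snV.
  by rewrite !mulmxA.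
have WX : whiten_mx^T *m whiten_mx *m X = X.
  rewrite WW -scalemxAl -(mulmxA (X *m B)) XX -scalemxAr scalerA mulVf// scale1r.
  by rewrite -mulmxA BQ mulmx1.
have rE : residual X Y = v - whiten_mx^T *m (whiten_mx *m v).
  rewrite /residual /ls -/(pad _) ls_coefE -scalemxAr -scalemxAr.
  have -> : n%:R^-1 *: (X *m (pad ord_max *m (Qinv Qn ord_max *m (pad ord_max)^T *m (X^T *m Y)))) =
      whiten_mx^T *m whiten_mx *m Y.
    by rewrite WW -scalemxAl /B !mulmxA.
  by rewrite /Y mulmxDr mulmxA WX opprD addrACA subrr add0r mulmxA.
have eB (N N' : 'M[R]_1) : (N - N') 0 0 = N 0 0 - N' 0 0 by rewrite !mxE.
have -> : (residual X Y)^T = v^T - (whiten_mx *m v)^T *m whiten_mx.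
  by rewrite rE [LHS]linearB /= [X in _ - X]trmx_mul trmxK.
rewrite rE mulmxBl !mulmxBr !sqnormE !eB.
have -> : (whiten_mx *m v)^T *m whiten_mx *m (whiten_mx^T *m (whiten_mx *m v)) =
    (whiten_mx *m v)^T *m (whiten_mx *m v).
  by rewrite -mulmxA (mulmxA whiten_mx whiten_mx^T) whiten_mx_tr mul1mx.
rewrite trmx_mul !mulmxA subrr subr0.
by [].
Qed.

End sample_algebra.

(** * The limit experiment *)

Section product_sections.
Context d1 d2 (T1 : measurableType d1) (T2 : measurableType d2) (R : realType).
Variables (P1 : probability T1 R) (P2 : probability T2 R).

Lemma prod_prob_section1 (G : set (T1 * T2)) :
  ((P1 \x P2) G = \int[P1]_x P2 [set y | G (x, y)])%E.
Proof.
apply: eq_integral => x _ /=; congr (P2 _).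
by apply/seteqP; split => y /=; rewrite /xsection /= inE.
Qed.

Lemma prod_prob_section2 (G : set (T1 * T2)) : measurable G ->
  ((P1 \x P2) G = \int[P2]_y P1 [set x | G (x, y)])%E.
Proof.
move=> mG.
rewrite (@product_measure_unique _ _ _ _ _ P1 P2 (P1 \x^ P2)%E)//; last first.
  by move=> A B mA mB; exact: product_measure2E.
apply: eq_integral => y _ /=; congr (P1 _).
by apply/seteqP; split => x /=; rewrite /ysection /= inE.
Qed.

End product_sections.

Section finite_intersections.
Context d (T : measurableType d).

Lemma measurable_forall (I : finType) (F : I -> set T) :
  (forall i, measurable (F i)) -> measurable [set x | forall i, F i x].
Proof.
move=> mF; rewrite (_ : [set x | _] = ~` [set x | exists i, (~` F i) x]).
  apply: measurableC.
  have -> : [set x | exists i, (~` F i) x] = \big[setU/set0]_(i <- index_enum I) ~` F i.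
    rewrite -bigcup_seq; apply/seteqP; split=> x /= [i]; last by move=> _ Ax; exists i.
    by move=> Ax; exists i => //=; rewrite mem_index_enum.
  by apply: bigsetU_measurable => i _; exact: measurableC.
apply/seteqP; split=> x /= h; first by move=> [i]; apply; exact: h.
by move=> i; apply: contrapT => nF; apply: h; exists i.
Qed.

Lemma measurable_imply_cst (Q : Prop) (F : set T) :
  measurable F -> measurable [set x | Q -> F x].
Proof.
move=> mF; have [q|nq] := pselect Q.
  rewrite (_ : [set x | _] = F)//; apply/seteqP; split=> x //=; exact.
by rewrite (_ : [set x | _] = setT)//; apply/seteqP; split=> // x _ /= /nq.
Qed.

Lemma measurable_cst_prop (Q : Prop) : measurable [set _ : T | Q].
Proof.
have [q|nq] := pselect Q.
  by rewrite (_ : [set x | _] = setT)//; apply/seteqP; split.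
by rewrite (_ : [set x | _] = set0)//; apply/seteqP; split=> // x /= /nq.
Qed.

End finite_intersections.

(** * Independence of the coordinates *)

Section independence.
Context {R : realType} {m : nat}.
Variable nu : probability 'cV[R]_m R.
Hypothesis hnu : std_gaussian nu.
Local Notation N01 := (@normal_prob R 0 1).

Definition free_of (i : 'I_m) (F : set 'cV[R]_m) :=
  forall z z' : 'cV[R]_m, (forall j, j != i -> z j 0 = z' j 0) -> F z -> F z'.

(** Once coordinate i is resampled, F is decided by the old vector and D by the new coordinate, so
    the event is a rectangle. *)
Lemma pr_indep_coord (i : 'I_m) (F : set 'cV[R]_m) (D : set (measurableTypeR R)) :
  free_of i F -> measurable F -> measurable D ->
  nu (F `&` [set z | D (z i 0)]) = (nu F * N01 D)%E.
Proof.
move=> Fi mF mD.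
have mDi : measurable [set z : 'cV[R]_m | D (z i 0)].
  by rewrite -[X in measurable X]setTI; exact: measurable_coord.
rewrite (std_gaussian_upd i hnu); last exact: measurableI.
rewrite muleC; apply: image_prob_prodE => //.
apply/seteqP; split=> [[x z] /= [Fu Dx]|[x z] /= [Dx Fz]]; split.
- by move: Dx; rewrite /upd mxE eqxx.
- by apply: Fi Fu => j ji; rewrite /upd mxE (negbTE ji).
- by apply: Fi Fz => j ji; rewrite /upd mxE (negbTE ji).
- by rewrite /upd mxE eqxx.
Qed.

Lemma pr_indep_coords (s : seq 'I_m) (F : set 'cV[R]_m)
    (D : 'I_m -> set (measurableTypeR R)) : uniq s ->
  (forall i, i \in s -> free_of i F) -> measurable F -> (forall i, measurable (D i)) ->
  pr nu (F `&` [set z | forall i, i \in s -> D i (z i 0)]) =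
  pr nu F * \prod_(i <- s) pr N01 (D i).
Proof.
move=> us Fs mF mD.
have mS (s' : seq 'I_m) : measurable [set z : 'cV[R]_m | forall i, i \in s' -> D i (z i 0)].
  apply: measurable_forall => i; apply: measurable_imply_cst.
  by rewrite -[X in measurable X]setTI; exact: measurable_coord.
elim: s us Fs => [_ _|i s IH /= /andP[iN us] Fs].
  rewrite big_nil mulr1; congr (pr nu _).
  by apply/seteqP; split=> z //= [].
rewrite big_cons mulrCA -IH//; last first.
  by move=> j js; apply: Fs; rewrite inE js orbT.
pose F' := F `&` [set z | forall j, j \in s -> D j (z j 0)].
have mF' : measurable F' by apply: measurableI => //; exact: mS.
have mDi : measurable [set z : 'cV[R]_m | D i (z i 0)].
  by rewrite -[X in measurable X]setTI; exact: measurable_coord.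
have -> : F `&` [set z | forall j, j \in i :: s -> D j (z j 0)] =
    F' `&` [set z | D i (z i 0)].
  apply/seteqP; split=> z /= => [[Fz h]|[[Fz h] Di]].
    by split; [split=> // j js; apply: h; rewrite inE js orbT|apply: h; rewrite inE eqxx].
  by split=> // j; rewrite inE => /orP[/eqP ->//|]; exact: h.
have F'i : free_of i F'.
  move=> z z' zz' [Fz h]; split.
    by apply: (Fs i) Fz => //; rewrite inE eqxx.
  move=> j js /=; have ji : j != i by apply: contra iN => /eqP <-.
  by have := h j js; rewrite (zz' j ji).
apply: EFin_inj; rewrite prE; last exact: measurableI.
by rewrite pr_indep_coord// EFinM !prE// muleC.
Qed.

End independence.

Section Delta_normal.
Context {R : realType}.
Local Notation N01 := (@normal_prob R 0 1).

Lemma measurable_affine_interval (s a b : R) :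
  measurable [set x : measurableTypeR R | `|s * x - a| < b].
Proof.
apply: measurable_set_ltr => //; apply: measurableT_comp => //.
by apply: measurable_funB => //; exact: measurable_funM.
Qed.

(** Writing N(0, s^2) as s times a standard normal absorbs the degenerate case, so that zeta = 0
    needs no separate treatment later. *)
Lemma DeltaE (s a b : R) : 0 <= s -> Delta s a b = pr N01 [set x | `|s * x - a| < b].
Proof.
rewrite le_eqVlt /Delta => /orP[/eqP <-|s0].
  rewrite eqxx; case: ifP => ab.
    rewrite (_ : [set x | _] = setT) ?prT//; apply/seteqP; split => // x _ /=.
    by rewrite mul0r sub0r normrN.
  rewrite (_ : [set x | _] = set0) ?pr_set0//; apply/seteqP; split => // x /=.
  by rewrite mul0r sub0r normrN ab.
rewrite gt_eqF//; congr fine.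
have mV : measurable [set x : measurableTypeR R | `|x - a| < b].
  by have := measurable_affine_interval 1 a b; under eq_set do rewrite mul1r.
rewrite /normal_prob [LHS]integral_mkcond [RHS]integral_mkcond.
rewrite (@ge0_integral_affine _ s 0) ?gt_eqF//; last 2 first.
- apply/measurable_restrict => //; apply/measurable_EFinP/measurable_funTS.
  exact: measurable_normal_pdf.
- by move=> x; rewrite patchE; case: ifP => // _; rewrite lee_fin normal_pdf_ge0.
apply: eq_integral => x _; rewrite addr0 !patchE.
have -> : (s * x \in [set x | `|x - a| < b]) = (x \in [set x | `|s * x - a| < b]).
  by apply/idP/idP; rewrite !inE.
case: ifP => _; last by rewrite mul0e.
rewrite -EFinM; congr EFin; rewrite !normal_pdfE ?gt_eqF// /normal_fun !subr0.
have -> : - (s * x) ^+ 2 / (s ^+ 2 *+ 2) = - x ^+ 2 / (1 ^+ 2 *+ 2).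
  by rewrite expr1n exprMn; field; rewrite gt_eqF.
rewrite mulrAC; congr (_ * _); rewrite /normal_peak expr1n mul1r -mulrnAr.
by rewrite sqrtrM ?sqr_ge0// sqrtr_sqr invfM mulrAC mulVf ?mul1r// normr_eq0 gt_eqF.
Qed.

End Delta_normal.

Section gaussian_snoc.
Context {R : realType}.
Local Notation N01 := (@normal_prob R 0 1).

Lemma measurable_snoc m : measurable_fun [set: 'cV[R]_m * measurableTypeR R]
  (fun x => col_mx x.1 (const_mx x.2 : 'cV[R]_1) : 'cV[R]_(m + 1)).
Proof.
apply/measurable_cVP => i; case: (split_ordP i) => j ->.
  rewrite (_ : (fun _ => _) = fun x : 'cV[R]_m * measurableTypeR R =>
    x.1 j 0 : measurableTypeR R).
    exact: (measurableT_comp (measurable_coord j) measurable_fst).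
  by apply/funext => x; rewrite col_mxEu.
rewrite (_ : (fun _ => _) = snd)//.
by apply/funext => x; rewrite col_mxEd mxE.
Qed.

Lemma std_gaussian_snoc m (nu : probability 'cV[R]_m R) : std_gaussian nu ->
  std_gaussian (image_prob (nu \x N01)%E (@measurable_snoc m)).
Proof.
move=> hnu E mE.
rewrite [LHS](@image_prob_prodE _ _ _ _ _ _ _ _ _ _ _ _
  (box (fun i => E (lshift 1 i))) (E (rshift m ord0))).
- by rewrite big_split_ord /= big_ord1; congr (_ * _)%E; exact: hnu.
- exact: measurable_box.
- by [].
apply/seteqP; split=> [[z x] /= h|[z x] /= [h1 h2] i].
  split=> [i /=|]; first by have := h (lshift 1 i); rewrite col_mxEu.
  by have := h (rshift m ord0); rewrite col_mxEd mxE.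
by case: (split_ordP i) => j ->; rewrite ?col_mxEu ?col_mxEd ?mxE ?(ord1 j).
Qed.

End gaussian_snoc.

Section gram_range.
Context {R : realType}.

Lemma gram_eq0 m n (B : 'M[R]_(m, n)) : B^T *m B = 0 -> B = 0.
Proof.
move=> B0; apply/matrixP => i j; rewrite [RHS]mxE.
have := congr1 (fun M : 'M[R]_n => M j j) B0; rewrite !mxE => /eqP.
rewrite psumr_eq0 => [/allP/(_ i (mem_index_enum i))|l _].
  by rewrite mxE -expr2 sqrf_eq0 => /eqP.
by rewrite mxE -expr2 sqr_ge0.
Qed.

(** N and N N' have the same column space. It places [C_inf] in the column space of [AQA], where any
    generalized inverse acts as an inverse. *)
Lemma gram_range m n (N : 'M[R]_(m, n)) (y : 'cV[R]_n) :
  exists h : 'cV[R]_m, N *m N^T *m h = N *m y.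
Proof.
have /submxP[D hD] : (y^T *m N^T <= N *m N^T)%MS.
  rewrite submxE -mulmxA (_ : N^T *m _ = 0) ?mulmx0//.
  apply: gram_eq0; rewrite trmx_mul trmxK -mulmxA (mulmxA N).
  by rewrite mulmx_coker mulmx0.
exists D^T; apply: trmx_inj; by rewrite !trmx_mul !trmxK hD.
Qed.

End gram_range.

(** * Gaussian conditioning at the selected order *)

Section conditional_law.
Context {R : realType} {P k : nat}.
Variables (A : 'M[R]_(k, P)) (Q : 'M[R]_P) (sigma : R) (j : 'I_P).
Let p : 'I_P.+1 := lift ord0 j.
Variables (ginv : 'I_P.+1 -> 'M[R]_k) (Phi : 'I_P.+1 -> probability 'cV[R]_k R).
Hypothesis hQ : pos_def Q.
Hypothesis sigma0 : 0 < sigma.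
Hypothesis hPhi : centered_gaussian (sigma ^+ 2 *: AQA A Q p) (Phi p).
Hypothesis hginv : is_ginv (AQA A Q p) (ginv p).
Local Notation N01 := (@normal_prob R 0 1).

Let N := first_cols A p *m coef_mx Q p.
Let b := b_inf A Q ginv p.
Let xi := xi_inf Q p.
Let zeta := zeta_inf A Q ginv p.

Lemma AQA_gram : AQA A Q p = N *m N^T.
Proof. by rewrite /N /AQA trmx_mul -(coef_mx_tr hQ) !mulmxA. Qed.

Let xi0 : 0 < xi. Proof. by rewrite xi_inf_gt0// /p lift0. Qed.

Let C_infE : C_inf A Q p = xi *: (N *m delta_mx j 0).
Proof.
rewrite scalemxAr (_ : xi *: _ = (coef_mx Q p)^T *m last_unit p).
  by rewrite /C_inf /N -(coef_mx_tr hQ) !mulmxA.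
rewrite -[RHS]trmxK trmx_mul trmxK last_unit_coef_mx// linearZ /= trmx_delta.
by [].
Qed.

(** The normal equations: b is the vector of regression coefficients of the last coefficient on the
    error. The third fact says that the residual variance is nonnegative, so that the square root in
    [zeta_inf] loses nothing. *)
Let b_facts : [/\ AQA A Q p *m b^T = C_inf A Q p,
  b *m AQA A Q p *m b^T = b *m C_inf A Q p & (b *m C_inf A Q p) 0 0 <= xi ^+ 2].
Proof.
have [h hC] := gram_range N (xi *: delta_mx j 0).
have Ch : C_inf A Q p = AQA A Q p *m h by rewrite AQA_gram hC C_infE scalemxAr.
have sA : (AQA A Q p)^T = AQA A Q p by rewrite AQA_gram trmx_mul trmxK.
have bh : AQA A Q p *m b^T = C_inf A Q p.
  rewrite /b /b_inf trmx_mul trmxK Ch -{1 2}sA mulmxA -trmx_mul.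
  by rewrite mulmxA -trmx_mul mulmxA hginv sA.
split=> //; first by rewrite -mulmxA bh.
have -> : b *m C_inf A Q p = h^T *m C_inf A Q p.
  by rewrite Ch mulmxA -[b in LHS]trmxK -{1}sA -trmx_mul bh Ch trmx_mul sA mulmxA.
(* q is the orthogonal projection of y on the row space of N, and the squared distance from y to q
   is xi^2 - b C. *)
pose y : 'cV[R]_P := xi *: delta_mx j 0; pose q := N^T *m h.
have eB (M M' : 'M[R]_1) : (M - M') 0 0 = M 0 0 - M' 0 0 by rewrite !mxE.
have qy : q^T *m y = h^T *m C_inf A Q p.
  by rewrite /q /y trmx_mul trmxK -mulmxA -scalemxAr -C_infE.
have qq : q^T *m q = h^T *m C_inf A Q p.
  by rewrite /q trmx_mul trmxK Ch AQA_gram !mulmxA.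
have yq : (y^T *m q) 0 0 = (h^T *m C_inf A Q p) 0 0.
  by rewrite -qy -[y^T *m q]trmxK trmx_mul trmxK mxE.
have yy : (y^T *m y) 0 0 = xi ^+ 2.
  rewrite /y [(xi *: _)^T]linearZ /= trmx_delta -scalemxAl -scalemxAr scalerA.
  by rewrite mul_delta_mx mxE mxE !eqxx mulr1 expr2.
have : 0 <= sqnorm (y - q) by apply: sumr_ge0 => i _; exact: sqr_ge0.
rewrite sqnormE [(y - q)^T]linearB /= mulmxBl !mulmxBr !eB yy yq qy qq.
by lra.
Qed.

Let zeta_sqr : zeta ^+ 2 = xi ^+ 2 - (b *m C_inf A Q p) 0 0.
Proof. by rewrite sqr_sqrtr// subr_ge0; have [_ _] := b_facts. Qed.

Let B1 : 'M[R]_(k + 1, P) := col_mx (sigma *: N) ((sigma * xi) *: delta_mx 0 j).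

(* The pair (A U, U_p) has the same covariance as (y, b y - sigma zeta x) with y
   of law Phi p and an independent x of law N(0, 1). *)
Let joint_covariance r (B : 'M[R]_(k, r)) : B *m B^T = sigma ^+ 2 *: AQA A Q p ->
  let B2 : 'M[R]_(k + 1, r + 1) := block_mx B 0 (b *m B) (- (sigma * zeta))%:M in
  B2 *m B2^T = B1 *m B1^T.
Proof.
move=> BB B2; have [b1 b2 _] := b_facts.
rewrite /B2 tr_block_mx mulmx_block trmx0 !mulmx0 !mul0mx !addr0.
rewrite /B1 tr_col_mx mul_col_row.
have bB : b *m B *m B^T = sigma ^+ 2 *: (C_inf A Q p)^T.
  rewrite -mulmxA BB -scalemxAr -b1 trmx_mul trmxK AQA_gram.
  by rewrite [(N *m N^T)^T]trmx_mul trmxK.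
have NE : N *m (delta_mx 0 j : 'rV[R]_P)^T = xi^-1 *: C_inf A Q p.
  by rewrite trmx_delta C_infE scalerA mulVf ?gt_eqF// scale1r.
have NE' : (delta_mx 0 j : 'rV[R]_P) *m N^T = xi^-1 *: (C_inf A Q p)^T.
  have := congr1 trmx NE; rewrite [LHS]trmx_mul trmxK => ->.
  by rewrite [LHS]linearZ.
have tN : (sigma *: N)^T = sigma *: N^T by rewrite linearZ.
have td : ((sigma * xi) *: delta_mx 0 j : 'rV[R]_P)^T =
    (sigma * xi) *: (delta_mx 0 j : 'rV[R]_P)^T by rewrite linearZ.
congr block_mx.
- by rewrite BB AQA_gram tN -scalemxAl -scalemxAr scalerA expr2.
- rewrite trmx_mul mulmxA BB -scalemxAl b1 td -scalemxAl -scalemxAr NE !scalerA.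
  by congr (_ *: _); field; rewrite gt_eqF.
- rewrite bB tN -scalemxAl -scalemxAr NE' !scalerA.
  by congr (_ *: _); field; rewrite gt_eqF.
rewrite td -scalemxAl -scalemxAr trmx_delta mul_delta_mx scalerA.
rewrite trmx_mul mulmxA bB -scalemxAl tr_scalar_mx -scalar_mxM mulrNN.
apply/matrixP => i l; rewrite (ord1 i) (ord1 l).
have -> : (C_inf A Q p)^T *m b^T = (b *m C_inf A Q p)^T by rewrite [RHS]trmx_mul.
have eD (M M' : 'M[R]_1) : (M + M') 0 0 = M 0 0 + M' 0 0 by rewrite mxE.
have eZ a (M : 'M[R]_1) : (a *: M) 0 0 = a * M 0 0 by rewrite mxE.
rewrite eD !eZ [_^T 0 0]mxE [_%:M 0 0]mxE eqxx mulr1n [delta_mx 0 0 0 0]mxE !eqxx mulr1.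
rewrite mulrACA -!expr2 zeta_sqr.
by ring.
Qed.

(** By equality of covariances, the pair formed by the error and sigma xi Z_p has the law of (y, b y
    - sigma zeta x) with y and x independent. Integrating over x for fixed y produces 1 - Delta. *)
Theorem pr_selected_law (E : set 'cV[R]_k) (c : R) (nu : probability 'cV[R]_P R) :
  std_gaussian nu -> measurable E ->
  pr nu [set z | E (sigma *: (N *m z)) /\ c <= `|z j 0| ] =
  \int[Phi p]_(y in E)
    (1 - Delta (sigma * zeta) ((b *m y) 0 0) (c * sigma * xi)).
Proof.
move=> hnu mE; case: hPhi => r [B [nur [hnur BB PhiE]]].
pose B2 : 'M[R]_(k + 1, r + 1) := block_mx B 0 (b *m B) (- (sigma * zeta))%:M.
have BBE : B2 *m B2^T = B1 *m B1^T by exact: joint_covariance.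
have sz0 : 0 <= sigma * zeta by rewrite mulr_ge0 ?sqrtr_ge0// ltW.
have sx0 : 0 < sigma * xi by rewrite mulr_gt0.
pose nu2 := image_prob (nur \x N01)%E (@measurable_snoc R r).
have hnu2 : std_gaussian nu2 by exact: std_gaussian_snoc.
pose D := c * sigma * xi.
pose T := [set v : 'cV[R]_(k + 1) | E (usubmx v) /\ D <= `|v (rshift k ord0) 0| ].
have mT : measurable T.
  apply: measurableI; last first.
    by apply: measurable_set_ler => //; apply: measurableT_comp => //; exact: measurable_coord.
  rewrite -[X in measurable X]setTI.
  suff : measurable_fun [set: 'cV[R]_(k + 1)] (@usubmx R k 1 1) by apply.
  apply/measurable_cVP => i.
  rewrite (_ : (fun _ => _) = (fun v : 'cV[R]_(k + 1) => v (lshift 1 i) 0 : measurableTypeR R)).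
    exact: measurable_coord.
  by apply/funext => v; rewrite mxE.
pose G := [set yx : 'cV[R]_k * measurableTypeR R |
  E yx.1 /\ D <= `|(b *m yx.1) 0 0 - sigma * zeta * yx.2| ].
have mby : measurable_fun [set: 'cV[R]_k] (fun y => (b *m y) 0 0 : measurableTypeR R).
  exact: (measurableT_comp (measurable_coord ord0) (measurable_mulmx b)).
have mG : measurable G.
  apply: measurableI.
    have := @measurable_fst _ _ 'cV[R]_k (measurableTypeR R) measurableT E mE.
    by rewrite setTI.
  apply: measurable_set_ler => //; apply: measurableT_comp => //.
  apply: measurable_funB; last exact: measurable_funM.
  exact: (measurableT_comp mby measurable_fst).
have -> : pr nu [set z | E (sigma *: (N *m z)) /\ c <= `|z j 0| ] =
    fine ((Phi p \x N01)%E G).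
  congr fine; transitivity (nu [set z | T (B1 *m z)]).
    congr (nu _); apply/seteqP; split=> z; rewrite /T /B1 /= mul_col_mx col_mxKu col_mxEd;
      rewrite -!scalemxAl -rowE !mxE normrM (gtr0_norm sx0) /D -mulrA (mulrC c);
      by rewrite ler_pM2l.
  rewrite (@centered_gaussian_unique _ _ (B1 *m B1^T) (fun E => nu [set z | E (B1 *m z)])
     (fun E => nu2 [set z | E (B2 *m z)]))//; last 2 first.
  - by exists P, B1, nu.
  - by exists (r + 1)%N, B2, nu2.
  have mGB : measurable [set zx : 'cV[R]_r * measurableTypeR R | G (B *m zx.1, zx.2)].
    have mf : measurable_fun [set: 'cV[R]_r * measurableTypeR R]
        (fun zx => (B *m zx.1, zx.2) : 'cV[R]_k * measurableTypeR R).
      apply: measurable_fun_pair => //.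
      exact: (measurableT_comp (measurable_mulmx B) measurable_fst).
    by rewrite -[X in measurable X]setTI; exact: (mf measurableT G mG).
  transitivity ((nur \x N01)%E [set zx | G (B *m zx.1, zx.2)]).
    congr (product_measure1 _ _ _); apply/funext => -[z x].
    have BE : B2 *m col_mx z (const_mx x) =
        col_mx (B *m z) (b *m (B *m z) - (sigma * zeta * x)%:M).
      rewrite /B2 mul_block_col mul0mx addr0 mul_scalar_mx scaleNr mulmxA.
      by congr (col_mx _ (_ - _)); apply/matrixP => i l; rewrite !mxE (ord1 i) (ord1 l) mulr1n.
    rewrite /T /G /preimage /= BE col_mxKu col_mxEd mxE [X in _ + X]mxE.
    by rewrite [_%:M 0 0]mxE mulr1n.
  (* Sections at fixed x are taken first, so that the law of B z can be replaced by [Phi p]; the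
     integral is then sliced at fixed y. *)
  rewrite (prod_prob_section2 _ _ mGB) (prod_prob_section2 _ _ mG).
  apply: eq_integral => x _; rewrite PhiE//.
  have mx : measurable_fun [set: 'cV[R]_k] (fun y => (y, x) : 'cV[R]_k * measurableTypeR R).
    exact: measurable_fun_pair.
  by rewrite -[X in measurable X]setTI; exact: (mx measurableT G mG).
rewrite prod_prob_section1 /Rintegral [X in _ = fine X]integral_mkcond.
congr fine; apply: eq_integral => y _; rewrite patchE; case: ifPn => [|nE].
  rewrite inE => Ey.
  have mI := measurable_affine_interval (sigma * zeta) ((b *m y) 0 0) D.
  rewrite DeltaE// -pr_setC// prE; last exact: measurableC.
  congr (N01 _); apply/seteqP; split=> x /=.
    by move=> [_]; rewrite distrC => h; apply/negP; rewrite -leNgt.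
  by move=> /negP; rewrite -leNgt distrC.
rewrite (_ : [set x | _] = set0) ?measure0//.
by apply/seteqP; split=> // x /= [Ey _]; move: nE; rewrite notin_setE.
Qed.

End conditional_law.

(** The existence assumption rules out the default value 0 of an empty maximum, which would be
    mistaken for the order 0. *)
Lemma bigmax_ord_eqP m (a : pred 'I_m.+1) (p : 'I_m.+1) : (exists q, a q) ->
  (\max_(q < m.+1 | a q) q)%N = p <-> a p /\ forall q : 'I_m.+1, (p < q)%N -> ~~ a q.
Proof.
move=> [q0 aq0]; split=> [E|[ap h]].
  have [q aq Eq] : exists2 q, a q & (\max_(q < m.+1 | a q) q)%N = q.
    have := @eq_bigmax_cond _ (mem a) (fun q : 'I_m.+1 => q : nat).
    by case=> [|q aq ->]; [apply/card_gt0P; exists q0|exists q].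
  have qp : q = p by apply: val_inj; rewrite /= -E.
  split=> [|r pr]; first by rewrite -qp.
  apply/negP => ar; have := @leq_bigmax_cond _ a (fun q : 'I_m.+1 => q : nat) r ar.
  by rewrite E leqNgt pr.
apply/eqP; rewrite eqn_leq; apply/andP; split; last exact: leq_bigmax_cond.
apply/bigmax_leqP => q aq; rewrite leqNgt; apply/negP => pq.
by have := h q pq; rewrite aq.
Qed.

(** * The limit selector and error as functions of Z *)

Section limit_experiment.
Context {R : realType} {P k : nat}.
Variables (A : 'M[R]_(k, P)) (sigma : R) (c : 'I_P.+1 -> R) (ps : 'I_P.+1).
Hypothesis sigma0 : 0 < sigma.
Local Notation N01 := (@normal_prob R 0 1).

(* The coordinate attached to the order p, with junk value 0 at p = 0. *)
Definition tcoord (z : 'cV[R]_P) (p : 'I_P.+1) : R :=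
  if unlift ord0 p is Some j then z j 0 else 0.

Lemma tcoord_lift z j : tcoord z (lift ord0 j) = z j 0.
Proof. by rewrite /tcoord liftK. Qed.

Lemma measurable_tcoord p : measurable_fun [set: 'cV[R]_P] (tcoord ^~ p).
Proof. by rewrite /tcoord; case: (unlift ord0 p) => [j|]; [exact: measurable_coord|]. Qed.

Lemma gt_lift (p q : 'I_P.+1) : (p < q)%N -> exists2 j : 'I_P, q = lift ord0 j & (p <= j)%N.
Proof.
move=> pq; case: (unliftP ord0 q) pq => [j ->|->]; last by rewrite ltn0.
by rewrite lift0 ltnS => pj; exists j.
Qed.

(** The order ps always qualifies: either ps = O, where the critical value is 0, or the statistic of
    order ps diverges. *)
Definition limit_selector (z : 'cV[R]_P) : nat :=
  \max_(p < P.+1 | (ps <= p)%N && ((p == ps) || (c p <= `|tcoord z p|))) p.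

Lemma limit_selectorP z (p : 'I_P.+1) : limit_selector z = p <->
  [/\ (ps <= p)%N, (p == ps) || (c p <= `|tcoord z p|) &
      forall q : 'I_P.+1, (p < q)%N -> `|tcoord z q| < c q].
Proof.
rewrite /limit_selector bigmax_ord_eqP; last by exists ps; rewrite leqnn eqxx.
split=> [[/andP[pp hp] h]|[pp hp h]]; split=> //.
- move=> q pq; have := h q pq; rewrite negb_and negb_or -ltNge.
  have psq := leq_ltn_trans pp pq; rewrite (ltnW psq) /= => /andP[//].
- by rewrite pp.
move=> q pq; have psq := leq_ltn_trans pp pq.
by rewrite negb_and negb_or -ltNge h// andbT -val_eqE /= gtn_eqF ?orbT.
Qed.

Lemma limit_selector_ge z : (ps <= limit_selector z)%N.
Proof.
rewrite /limit_selector; apply: (@leq_bigmax_cond _ _ (fun p : 'I_P.+1 => p : nat)).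
by rewrite leqnn eqxx.
Qed.

Lemma limit_selector_ord z : exists p : 'I_P.+1, limit_selector z = p.
Proof.
have h : (limit_selector z < P.+1)%N.
  by rewrite ltnS; apply/bigmax_leqP => p _; rewrite -ltnS.
by exists (Ordinal h).
Qed.

Lemma measurable_limit_selector (p : 'I_P.+1) :
  measurable [set z | limit_selector z = p].
Proof.
rewrite (_ : [set z | _] = [set z | (ps <= p)%N] `&`
   ([set z | p == ps] `|` [set z | c p <= `|tcoord z p| ]) `&`
   [set z | forall q : 'I_P.+1, (p < q)%N -> `|tcoord z q| < c q]); last first.
  apply/seteqP; split => z /=.
    by move=> /limit_selectorP[? /orP ? ?]; split.
  by move=> [[? ?] ?]; apply/limit_selectorP; split=> //; apply/orP.
have mt q : measurable_fun setT (fun z => `|tcoord z q|).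
  by apply: measurableT_comp => //; exact: measurable_tcoord.
apply: measurableI.
  apply: measurableI; first exact: measurable_cst_prop.
  apply: measurableU; first exact: measurable_cst_prop.
  exact: measurable_set_ler.
apply: measurable_forall => q; apply: measurable_imply_cst.
exact: measurable_set_ltr.
Qed.

Definition limit_error (M : 'M[R]_P) (p : 'I_P.+1) (z : 'cV[R]_P) : 'cV[R]_k :=
  sigma *: (first_cols A p *m coef_mx M p *m z).

Lemma measurable_limit_error M p : measurable_fun setT (limit_error M p).
Proof.
rewrite (_ : limit_error M p = mulmx (sigma *: (first_cols A p *m coef_mx M p))).
  exact: measurable_mulmx.
by apply/funext => z; rewrite /limit_error scalemxAl.
Qed.

(** M is a free Gram matrix: at X'X / n this is the sample error whenever the selectors agree, at Q
    it has the limit law. The selector does not involve M. *)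
Definition limit_pms (M : 'M[R]_P) (z : 'cV[R]_P) : 'cV[R]_k :=
  \sum_(p < P.+1 | (ps <= p)%N) (limit_selector z == p)%:R *: limit_error M p z.

Lemma limit_pmsE M z (p : 'I_P.+1) : limit_selector z = p ->
  limit_pms M z = limit_error M p z.
Proof.
move=> sp; have pp : (ps <= p)%N by rewrite -sp limit_selector_ge.
rewrite /limit_pms (bigD1 p)//= sp eqxx scale1r big1 ?addr0// => q /andP[_ qp].
by rewrite val_eqE eq_sym (negbTE qp) scale0r.
Qed.

Definition piece M (p : 'I_P.+1) (E : set 'cV[R]_k) : set 'cV[R]_P :=
  [set z | limit_selector z = p /\ E (limit_error M p z)].

Lemma measurable_piece M (p : 'I_P.+1) E : measurable E -> measurable (piece M p E).
Proof.
move=> mE; apply: measurableI; first exact: measurable_limit_selector.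
by rewrite -[X in measurable X]setTI; exact: measurable_limit_error.
Qed.

Lemma limit_pms_pieces M E : [set z | E (limit_pms M z)] =
  [set z | exists p : 'I_P.+1, piece M p E z].
Proof.
apply/seteqP; split=> z /=.
  by have [p sp] := limit_selector_ord z; rewrite (limit_pmsE M sp) => Ez; exists p.
by move=> [p [sp Ez]]; rewrite (limit_pmsE M sp).
Qed.

Lemma measurable_limit_pms M : measurable_fun setT (limit_pms M).
Proof.
move=> _ E mE; rewrite setTI -[_ @^-1` _]/[set z | E (limit_pms M z)] limit_pms_pieces.
have -> : [set z | exists p : 'I_P.+1, piece M p E z] =
    ~` [set z | forall p : 'I_P.+1, (~` piece M p E) z].
  apply/seteqP; split=> z /=; first by move=> [p pz] h; exact: (h p pz).
  by move=> h; apply: contrapT => n; apply: h => p pz; apply: n; exists p.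
apply: measurableC; apply: measurable_forall => p; apply: measurableC.
exact: measurable_piece.
Qed.

Variable nu : probability 'cV[R]_P R.
Hypothesis hnu : std_gaussian nu.

Lemma pr_limit_pms M E : measurable E ->
  pr nu [set z | E (limit_pms M z)] = \sum_(p < P.+1) pr nu (piece M p E).
Proof.
move=> mE; rewrite limit_pms_pieces pr_bigsetU//.
  by move=> p; exact: measurable_piece.
apply/trivIsetP => p q _ _ pq; apply/seteqP; split=> // z [[sp _] [sq _]].
by move/eqP: pq; apply; apply: val_inj; rewrite /= -sp -sq.
Qed.

Definition accept (q : 'I_P.+1) : set (measurableTypeR R) := [set x | `|x| < c q].

Lemma measurable_accept q : measurable (accept q).
Proof. by apply: measurable_set_ltr. Qed.

(** The scale sigma xi cancels between the Gaussian and its threshold. *)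
Lemma Delta0E Q (q : 'I_P.+1) : pos_def Q -> (0 < q)%N -> Delta0 Q sigma c q = pr N01 (accept q).
Proof.
move=> hQ q0; have x0 := xi_inf_gt0 hQ q0.
rewrite /Delta0 DeltaE; last by rewrite mulr_ge0// ltW.
congr (pr _ _); apply/seteqP; split=> x; rewrite /accept /= subr0 normrM gtr0_norm ?mulr_gt0//;
  by rewrite -mulrA (mulrC (c q)) ltr_pM2l// mulr_gt0.
Qed.

Lemma tail_prodE Q (p : 'I_P.+1) : pos_def Q -> tail_prod Q sigma c p =
  \prod_(j <- [seq j : 'I_P <- index_enum 'I_P | (p <= j)%N]) pr N01 (accept (lift ord0 j)).
Proof.
move=> hQ; rewrite /tail_prod big_filter big_mkcond big_ord_recl /= mul1r.
rewrite [RHS]big_mkcond; apply: eq_bigr => j _.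
rewrite /bump /= add1n ltnS; case: ifP => // _.
by rewrite Delta0E.
Qed.

(** The error and the test of order p depend on the first p coordinates only, whereas the acceptance
    of each later order depends on one further coordinate. *)
Lemma pr_piece Q M (p : 'I_P.+1) E : pos_def Q -> pos_def M -> measurable E -> (ps <= p)%N ->
  pr nu (piece M p E) =
  pr nu [set z | E (limit_error M p z) /\ ((p == ps) || (c p <= `|tcoord z p|))]
    * tail_prod Q sigma c p.
Proof.
move=> hQ hM mE pp.
set F := [set z | _].
have mK : measurable [set z : 'cV[R]_P | (p == ps) || (c p <= `|tcoord z p|)].
  rewrite (_ : [set z | _] = [set z | p == ps] `|` [set z | c p <= `|tcoord z p| ]).
    apply: measurableU; first exact: measurable_cst_prop.
    apply: measurable_set_ler => //; apply: measurableT_comp => //.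
    exact: measurable_tcoord.
  by apply/seteqP; split=> z /= /orP.
have mF : measurable F.
  apply: measurableI mK.
  by rewrite -[X in measurable X]setTI; exact: measurable_limit_error.
rewrite tail_prodE// -pr_indep_coords//; last first.
- by move=> j; exact: measurable_accept.
- move=> j; rewrite mem_filter => /andP[pj _] z z' zz' [Ez hz].
  have eL : limit_error M p z' = limit_error M p z.
    rewrite /limit_error -!(mulmxA _ (coef_mx M p)); congr (_ *: (_ *m _)); apply/colP => i.
    rewrite !mxE; apply: eq_bigr => l _; have [->|lj] := eqVneq l j.
      by rewrite coef_mx_eq0// !mul0r.
    by rewrite zz'.
  suff eT : tcoord z' p = tcoord z p by rewrite /F /= eL eT; split.
  rewrite /tcoord; case: (unliftP ord0 p) => [l pl|//].
  by rewrite zz'//; apply: contraTneq pj => <-; rewrite pl lift0 ltnn.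
- exact/filter_uniq/index_enum_uniq.
congr (pr nu _); apply/seteqP; split=> z /=.
  move=> [/limit_selectorP[_ hp h] Ez]; split; first by split.
  move=> j; rewrite mem_filter => /andP[pj _]; rewrite /accept /= -tcoord_lift.
  by apply: h; rewrite lift0 ltnS.
move=> [[Ez hp] h]; split=> //; apply/limit_selectorP; split=> // q /gt_lift[j -> pj].
by rewrite tcoord_lift; apply: (h j); rewrite mem_filter pj mem_index_enum.
Qed.

Lemma pr_piece_lt M (p : 'I_P.+1) E : (p < ps)%N -> pr nu (piece M p E) = 0.
Proof.
move=> pp; rewrite (_ : piece M p E = set0) ?pr_set0//.
apply/seteqP; split=> // z [sp _].
by have := limit_selector_ge z; rewrite sp leqNgt pp.
Qed.

Lemma pr_limit_selector Q (p : 'I_P.+1) : pos_def Q ->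
  pr nu [set z | limit_selector z = p] = limit_sel_prob Q sigma c ps p.
Proof.
move=> hQ; have -> : [set z | limit_selector z = p] = piece Q p setT.
  by apply/seteqP; split=> z //= [].
rewrite /limit_sel_prob; case: (ltngtP ps p) => pp.
- have [j pj _] := gt_lift pp.
  have mA := measurableC (measurable_accept p).
  rewrite (pr_piece hQ hQ measurableT (ltnW pp)).
  suff -> : pr nu [set z | setT (limit_error Q p z) /\
      ((p == ps) || (c p <= `|tcoord z p|))] = 1 - Delta0 Q sigma c p by [].
  rewrite (Delta0E hQ); last by rewrite pj lift0.
  rewrite -(pr_setC _ (measurable_accept p)).
  transitivity (fine (nu [set z | (~` accept p) (z j 0)])); last first.
    by congr fine; exact: pr_coord.
  have pps : (p == ps) = false by rewrite -val_eqE /= gtn_eqF.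
  have tz z : tcoord z p = z j 0 by rewrite pj tcoord_lift.
  congr fine; congr (nu _); apply/seteqP; split=> z; rewrite /accept /= pps /= tz.
    by move=> [_ h]; apply/negP; rewrite -leNgt.
  by move=> /negP; rewrite -leNgt => h; split.
- by rewrite pr_piece_lt// -val_eqE /= ltn_eqF.
have pps : p = ps by exact: val_inj.
rewrite pps (pr_piece hQ hQ measurableT (leqnn ps)) eqxx.
rewrite (_ : [set z | _] = setT) ?prT ?mul1r//.
by apply/seteqP; split=> z.
Qed.

End limit_experiment.

Section full_coef_last.
Context {R : realType} {P : nat}.

Lemma full_coef_mx_last (Q : 'M[R]_P) (z : 'cV[R]_P) (j : 'I_P) : pos_def Q ->
  (full_coef_mx Q (lift ord0 j) *m z) j 0 = xi_inf Q (lift ord0 j) * z j 0.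
Proof.
move=> hQ.
have -> : (full_coef_mx Q (lift ord0 j) *m z) j 0 =
    (row j (full_coef_mx Q (lift ord0 j) *m z)) 0 0 by rewrite [RHS]mxE.
rewrite rowE -trmx_delta -pad_last_unit trmx_mul -mulmxA (mulmxA (pad _)^T).
rewrite pad_full_coef_mx// mulmxA last_unit_coef_mx// -scalemxAl -rowE mxE.
by rewrite [row j z 0 0]mxE.
Qed.

Lemma tcoord_full_above (Q : 'M[R]_P) (p q : 'I_P.+1) (z : 'cV[R]_P) : (p < q)%N ->
  tcoord (full_coef_mx Q p *m z) q = tcoord z q.
Proof. by move=> /gt_lift[j -> pj]; rewrite !tcoord_lift full_coef_mx_above. Qed.

Lemma tcoord_full_last (Q : 'M[R]_P) (p : 'I_P.+1) (z : 'cV[R]_P) : pos_def Q -> (0 < p)%N ->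
  tcoord (full_coef_mx Q p *m z) p = xi_inf Q p * tcoord z p.
Proof.
by move=> hQ /(@gt_lift _ ord0)[j -> _]; rewrite !tcoord_lift full_coef_mx_last.
Qed.

End full_coef_last.

(** * Continuity of the limit experiment in the Gram matrix *)

Section limit_experiment_continuity.
Context {R : realType} {P k : nat}.
Variables (A : 'M[R]_(k, P)) (sigma : R) (c : 'I_P.+1 -> R) (ps : 'I_P.+1).
Hypothesis sigma0 : 0 < sigma.
Variable nu : probability 'cV[R]_P R.
Hypothesis hnu : std_gaussian nu.
Local Notation N01 := (@normal_prob R 0 1).
Local Notation limit_selector := (limit_selector c ps).
Local Notation piece := (piece A sigma c ps).

Variables (Q : 'M[R]_P) (M : nat -> 'M[R]_P).
Hypothesis hQ : pos_def Q.
Hypothesis hM : mx_cvg M Q.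
Hypothesis hMpd : \forall n \near \oo, pos_def (M n).

(* The event that p is selected, read on full_coef_mx Q p z. *)
Let region (p : 'I_P.+1) : set 'cV[R]_P :=
  [set y | [/\ (ps <= p)%N, (p == ps) || (xi_inf Q p * c p <= `|tcoord y p|) &
     forall q : 'I_P.+1, (p < q)%N -> `|tcoord y q| < c q]].

Let measurable_region p : measurable (region p).
Proof.
rewrite (_ : region p = [set _ | (ps <= p)%N] `&`
    ([set _ | p == ps] `|` [set y | xi_inf Q p * c p <= `|tcoord y p| ]) `&`
    [set y | forall q : 'I_P.+1, (p < q)%N -> [set y | `|tcoord y q| < c q] y]).
  have mt q : measurable_fun setT (fun y : 'cV[R]_P => `|tcoord y q|).
    by apply: measurableT_comp => //; exact: measurable_tcoord.
  apply: measurableI.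
    apply: measurableI; first exact: measurable_cst_prop.
    by apply: measurableU; [exact: measurable_cst_prop|exact: measurable_set_ler].
  apply: measurable_forall => q; apply: measurable_imply_cst.
  exact: measurable_set_ltr.
apply/seteqP; split=> y /=; first by move=> [h1 /orP h2 h3].
by move=> [[h1 /orP h2] h3]; split.
Qed.

Let target (p : 'I_P.+1) (E : set 'cV[R]_k) : set 'cV[R]_P :=
  region p `&` [set y | E (sigma *: (A *m pad p *m (pad p)^T) *m y)].

Let measurable_target p E : measurable E -> measurable (target p E).
Proof. move=> mE; apply: measurableI; first exact: measurable_region.
exact: measurable_mulmx_preimage. Qed.

Let limit_error_full L p z : pos_def L ->
  limit_error A sigma L p z =
  sigma *: (A *m pad p *m (pad p)^T) *m (full_coef_mx L p *m z).
Proof.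
move=> hL; rewrite /limit_error first_colsE -scalemxAl; congr (_ *: _).
by rewrite -[RHS]mulmxA [X in _ = _ *m X]mulmxA pad_full_coef_mx// [RHS]mulmxA.
Qed.

(** [full_coef_mx L p] fixes the coordinates above p and multiplies coordinate p - 1 by
    [xi_inf L p]. The only discrepancy is thus the threshold of the test of order p, scaled with Q
    in [target]; the hypothesis says that it is harmless at z. *)
Let piece_target L (p : 'I_P.+1) E z : pos_def L ->
  (p != ps -> (ps <= p)%N ->
     (c p <= `|tcoord z p|) = (xi_inf Q p * c p <= xi_inf L p * `|tcoord z p|)) ->
  piece L p E z <-> target p E (full_coef_mx L p *m z).
Proof.
move=> hL h; rewrite /piece /target /= limit_error_full//.
suff : limit_selector z = p <-> region p (full_coef_mx L p *m z) by move=> ->.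
rewrite limit_selectorP /region /=.
have ha (q : 'I_P.+1) : (p < q)%N -> tcoord (full_coef_mx L p *m z) q = tcoord z q.
  exact: tcoord_full_above.
have hl : p != ps -> (ps <= p)%N -> (c p <= `|tcoord z p|) =
    (xi_inf Q p * c p <= `|tcoord (full_coef_mx L p *m z) p|).
  move=> pp pp'; have p0 : (0 < p)%N.
    by apply: leq_ltn_trans (leq0n ps) _; rewrite ltn_neqAle pp' andbT eq_sym.
  by rewrite tcoord_full_last// normrM (gtr0_norm (xi_inf_gt0 hL p0)) h.
split=> -[pp hp hq]; split=> //.
- by case: eqVneq hp => //= pps; rewrite hl.
- by move=> q pq; rewrite ha// hq.
- by case: eqVneq hp => //= pps; rewrite hl.
- by move=> q pq; rewrite -ha// hq.
Qed.

(** Half of e pays for replacing the matrix at [M n] by the one at Q on the fixed set [target p E],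
    the other half for the threshold mismatch, which needs |z_j| within r of c_p. Both bounds are
    uniform in E. *)
Lemma piece_tv (p : 'I_P.+1) (e : R) : 0 < e -> \forall n \near \oo, forall E, measurable E ->
  `|pr nu (piece (M n) p E) - pr nu (piece Q p E)| <= e.
Proof.
move=> e0; have e20 : 0 < e / 2 by rewrite divr_gt0.
have [pps|pps] := ltnP p ps.
  by apply: nearW => n E mE; rewrite !pr_piece_lt// subrr normr0 ltW.
have h1 := std_gaussian_linear_tv hnu (full_coef_mx_unit hQ p)
  (@mx_cvg_full_coef_mx _ _ _ _ hM hQ p) e20.
have [r r0 hr] := pr_normal_boundary e20.
have h2 : \forall n \near \oo, p != ps ->
    0 < xi_inf (M n) p /\ `|c p - xi_inf Q p * c p / xi_inf (M n) p| <= r.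
  have [->|pp] := eqVneq p ps; first exact: nearW.
  have p0 : (0 < p)%N.
    by apply: leq_ltn_trans (leq0n ps) _; rewrite ltn_neqAle pps andbT eq_sym.
  have hx := @xi_inf_cvg _ _ _ _ hM hQ p; have x0 := xi_inf_gt0 hQ p0.
  have : xi_inf Q p * c p / xi_inf (M n) p @[n --> \oo] --> c p.
    rewrite [X in _ --> X](_ : c p = xi_inf Q p * c p / xi_inf Q p); last first.
      by field; rewrite gt_eqF.
    apply: cvgM; first exact: cvg_cst.
    by apply: cvgV => //; rewrite gt_eqF.
  move=> /cvgrPdist_le /(_ r r0) h; near=> n => _; split.
    by apply: xi_inf_gt0 => //; near: n.
  by near: n.
near=> n.
have h1n : forall F, measurable F ->
    `|pr nu [set z | F (full_coef_mx (M n) p *m z)] -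
      pr nu [set z | F (full_coef_mx Q p *m z)]| <= e / 2 by near: n.
have h2n : p != ps -> 0 < xi_inf (M n) p /\
    `|c p - xi_inf Q p * c p / xi_inf (M n) p| <= r by near: n.
move=> E mE.
have hMn : pos_def (M n) by near: n.
have mT := measurable_target p mE.
have mTn := measurable_mulmx_preimage (full_coef_mx (M n) p) mT.
have e1 : pr nu (piece Q p E) = pr nu [set z | target p E (full_coef_mx Q p *m z)].
  congr (pr nu _); apply/seteqP; split=> z; apply piece_target => // pp pp';
    have p0 : (0 < p)%N by [apply: leq_ltn_trans (leq0n ps) _;
      rewrite ltn_neqAle pp' andbT eq_sym];
    by rewrite ler_pM2l// xi_inf_gt0.
have hTV : `|pr nu [set z | target p E (full_coef_mx (M n) p *m z)] -
    pr nu [set z | target p E (full_coef_mx Q p *m z)]| <= e / 2.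
  exact: h1n.
suff hB : `|pr nu (piece (M n) p E) -
    pr nu [set z | target p E (full_coef_mx (M n) p *m z)]| <= e / 2.
  rewrite e1 (splitr e); apply: le_trans (lerD hB hTV).
  exact: ler_distD.
have mP : measurable (piece (M n) p E) by exact: measurable_piece.
have [pp|pp] := eqVneq p ps.
  rewrite (_ : piece (M n) p E = [set z | target p E (full_coef_mx (M n) p *m z)]).
    by rewrite subrr normr0 ltW.
  by apply/seteqP; split=> z; apply piece_target => //; rewrite pp eqxx.
have [x0 hx] := h2n pp.
have p0 : (0 < p)%N.
  by apply: leq_ltn_trans (leq0n ps) _; rewrite ltn_neqAle pps andbT eq_sym.
have [j pj _] := @gt_lift _ ord0 p p0.
pose C := [set z : 'cV[R]_P | `| `|z j 0| - c p| <= r].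
have mC1 : measurable [set x : measurableTypeR R | `| `|x| - c p| <= r].
  apply: measurable_set_ler => //; apply: measurableT_comp => //.
  by apply: measurable_funB => //; exact: measurableT_comp.
have mC : measurable C.
  rewrite -[X in measurable X]setTI.
  exact: (measurable_coord j measurableT mC1).
apply: le_trans (pr_dist nu mP mTn mC _) _.
  move=> z nC; apply piece_target => // _ _.
  have tz : tcoord z p = z j 0 by rewrite pj tcoord_lift.
  rewrite tz [X in _ = (_ <= X)]mulrC -ler_pdivrMr//.
  move: nC hx; rewrite /C /= => /negP; rewrite -ltNge.
  set cc := _ / _; set t := `|z j 0|.
  rewrite ltr_normr ler_norml => /orP[h|h] /andP[h' h''].
    by apply/idP/idP => _; lra.
  by apply/idP/idP => h3; exfalso; lra.
apply: le_trans (hr (c p)); rewrite le_eqVlt; apply/orP; left; apply/eqP.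
by congr fine; exact: pr_coord.
Unshelve. all: by end_near. Qed.

Lemma limit_pms_tv (e : R) : 0 < e -> \forall n \near \oo, forall E, measurable E ->
  `|pr nu [set z | E (limit_pms A sigma c ps (M n) z)] -
    pr nu [set z | E (limit_pms A sigma c ps Q z)]| <= e.
Proof.
move=> e0; pose e' := e / P.+1%:R.
have e'0 : 0 < e' by rewrite divr_gt0.
have h : \forall n \near \oo, forall p : 'I_P.+1, forall E, measurable E ->
    `|pr nu (piece (M n) p E) - pr nu (piece Q p E)| <= e'.
  by apply: filter_forall => p; exact: piece_tv.
apply: filterS h => n h E mE.
rewrite !pr_limit_pms// -sumrB; apply: le_trans (ler_norm_sum _ _ _) _.
apply: le_trans (ler_sum _ (fun p _ => h p E mE)) _.
by rewrite sumr_const card_ord -[leLHS]mulr_natr /e' divfK.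
Qed.

End limit_experiment_continuity.

(** * Evaluation of the limit law *)

Section limit_law.
Context {R : realType} {P k : nat}.
Variables (A : 'M[R]_(k, P)) (sigma : R) (c : 'I_P.+1 -> R) (ps : 'I_P.+1).
Hypothesis sigma0 : 0 < sigma.
Variable nu : probability 'cV[R]_P R.
Hypothesis hnu : std_gaussian nu.
Variables (Q : 'M[R]_P) (ginv : 'I_P.+1 -> 'M[R]_k).
Variable Phi : 'I_P.+1 -> probability 'cV[R]_k R.
Hypothesis hQ : pos_def Q.
Hypothesis hPhi0 : forall E : set 'cV[R]_k, measurable E ->
  Phi ord0 E = \d_(0 : 'cV[R]_k) E.
Hypothesis hPhi : forall p : 'I_P.+1, (0 < p)%N ->
  centered_gaussian (sigma ^+ 2 *: AQA A Q p) (Phi p).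
Hypothesis hginv : forall p : 'I_P.+1, (0 < p)%N -> is_ginv (AQA A Q p) (ginv p).

Lemma limit_error_law (p : 'I_P.+1) E : measurable E ->
  nu [set z | E (limit_error A sigma Q p z)] = Phi p E.
Proof.
move=> mE; have [p0|p0] := posnP p.
  have -> : p = ord0 by exact: val_inj.
  rewrite hPhi0// diracE.
  have A0 : first_cols A ord0 = 0 by apply/matrixP => i [l hl]; exfalso; move: hl.
  have -> : [set z | E (limit_error A sigma Q ord0 z)] = [set _ | E 0].
    apply/funext => z; congr (E _); rewrite /limit_error A0 !mul0mx; exact: scaler0.
  have [E0|nE0] := pselect (E 0).
    rewrite mem_set// (_ : [set _ | E 0] = setT) ?probability_setT//.
    by apply/seteqP; split.
  rewrite memNset// (_ : [set _ | E 0] = set0) ?measure0//.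
  by apply/seteqP; split.
apply: (@centered_gaussian_unique _ _ (sigma ^+ 2 *: AQA A Q p)
  (fun F => nu [set z | F (limit_error A sigma Q p z)]) (Phi p)) => //; last exact: hPhi.
exists P, (sigma *: (first_cols A p *m coef_mx Q p)), nu; split=> //.
  rewrite linearZ /= -scalemxAl -scalemxAr scalerA -expr2; congr (_ *: _).
  by rewrite /AQA trmx_mul -(coef_mx_tr hQ) !mulmxA.
move=> F mF; congr (nu _); apply/funext => z.
by rewrite /limit_error /= scalemxAl.
Qed.

Lemma measurable_below (t : 'cV[R]_k) : measurable (below t).
Proof.
by apply: measurable_forall => i; apply: measurable_set_ler => //; exact: measurable_coord.
Qed.

Theorem pr_limit_pms_below (t : 'cV[R]_k) :
  pr nu [set z | below t (limit_pms A sigma c ps Q z)] =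
  limit_cdf A Q ginv sigma c Phi ps t.
Proof.
have mb := measurable_below t.
rewrite pr_limit_pms// /limit_cdf (bigD1 ps)//=; congr (_ + _).
  rewrite (pr_piece A c sigma0 hnu hQ hQ mb (leqnn ps)) eqxx.
  congr (_ * _); rewrite /pr -(limit_error_law ps mb); congr fine; congr (nu _).
  by apply/seteqP; split=> z /=; [move=> []|move=> h; split].
rewrite [LHS]big_mkcond [RHS]big_mkcond; apply: eq_bigr => p _.
case: eqVneq => [->|pps] /=; first by rewrite ltnn.
case: ltnP => pp; last first.
  by rewrite pr_piece_lt// ltn_neqAle pp andbT.
have [j pj _] := gt_lift pp; subst p.
have j0 : (0 < lift ord0 j)%N by rewrite lift0.
rewrite (pr_piece A c sigma0 hnu hQ hQ mb (ltnW pp)); congr (_ * _).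
rewrite -(pr_selected_law hQ sigma0 (hPhi j0) (hginv j0) _ hnu mb).
by congr (pr nu _); apply/funext => z; rewrite /mkset tcoord_lift (negbTE pps).
Qed.

End limit_law.

(** * Asymptotics *)

Lemma tstat_tcoord (R : realType) (P n : nat) (X : 'M[R]_(n, P)) (Y : 'cV[R]_n)
    (s : R) (p : 'I_P.+1) : (0 < n)%N -> pos_def (n%:R^-1 *: (X^T *m X)) ->
  tstat X Y s p = tcoord (whiten_mx X *m Y) p / s.
Proof.
move=> n0 hX; rewrite /tcoord; case: (unliftP ord0 p) => [j ->|->].
  exact: tstatE.
by rewrite /tstat eqxx mul0r.
Qed.

(** The second disjunct accounts for a vanishing variance estimate, where division by 0 makes the
    statistic 0. *)
Lemma ler_abs_div (R : realType) (c a s : R) : 0 <= s ->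
  (c <= `|a / s|) = ((0 < s) && (c * s <= `|a|)) || ((s == 0) && (c <= 0)).
Proof.
rewrite le_eqVlt => /orP[/eqP <-|s0].
  by rewrite invr0 mulr0 normr0 ltxx eqxx.
rewrite s0 gt_eqF//= orbF normrM normfV (gtr0_norm s0).
by rewrite ler_pdivlMr.
Qed.

(** * Whitened noise and the variance estimator *)

Section model.
Context {R : realType} {P : nat}.
Variables (X : forall n : nat, 'M[R]_(n, P)) (sigma : R) (Q : 'M[R]_P).
Variables (d : nat -> measure_display) (Omega : forall n : nat, measurableType (d n)).
Variable Pr : forall n : nat, probability (Omega n) R.
Variable u : forall n : nat, {mfun Omega n >-> 'cV[R]_n}.
Hypothesis sigma0 : 0 < sigma.
Hypothesis hu : forall n : nat, (P < n)%N ->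
  centered_gaussian ((sigma ^+ 2)%:M : 'M[R]_n) (distribution (Pr n) (u n)).
Hypothesis hX : forall n : nat, (P < n)%N -> \rank (X n) = P.

Definition scaled_gram n : 'M[R]_P := n%:R^-1 *: ((X n)^T *m X n).

Lemma scaled_gram_pos_def n : (P < n)%N -> pos_def (scaled_gram n).
Proof.
move=> Pn; apply: gram_pos_def; last exact: hX.
by rewrite invr_gt0 ltr0n (leq_trans _ Pn).
Qed.

Definition noise m n (L : 'M[R]_(m, n)) (w : Omega n) : 'cV[R]_m :=
  sigma^-1 *: (L *m u n w).

Lemma noiseE m n (L : 'M[R]_(m, n)) w : L *m u n w = sigma *: noise L w.
Proof. by rewrite /noise scalerA divff ?scale1r// gt_eqF. Qed.

Lemma measurable_noise m n (L : 'M[R]_(m, n)) : measurable_fun setT (noise L).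
Proof.
rewrite (_ : noise L = (mulmx (sigma^-1 *: L)) \o u n).
  exact: (measurableT_comp (measurable_mulmx _) (measurable_funPT (u n))).
by apply/funext => w; rewrite /noise /= scalemxAl.
Qed.

(** The covariance of the normalized image is L L' = I. It serves for L the whitening matrix and for
    L the identity. *)
Lemma noise_law m n (L : 'M[R]_(m, n)) (nu : probability 'cV[R]_m R) F :
  (P < n)%N -> L *m L^T = 1%:M -> std_gaussian nu -> measurable F ->
  pr (Pr n) [set w | F (noise L w)] = pr nu F.
Proof.
move=> Pn LL hnu mF; congr fine.
have [r [B [nr [hnr BB hE]]]] := hu Pn.
apply: (@centered_gaussian_unique _ _ 1%:M (fun E => Pr n [set w | E (noise L w)]) nu) => //.
  exists r, (sigma^-1 *: (L *m B)), nr; split=> //.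
    rewrite [(sigma^-1 *: _)^T]linearZ /= trmx_mul -scalemxAl -scalemxAr scalerA.
    rewrite mulmxA -(mulmxA L) BB mul_mx_scalar -scalemxAl LL scalerA.
    by rewrite (_ : _ * _ = 1) ?scale1r//; field; rewrite gt_eqF.
  move=> E mE; have mEL : measurable [set v | E (sigma^-1 *: (L *m v))].
    rewrite (_ : [set v | _] = [set v | E ((sigma^-1 *: L) *m v)]).
      exact: measurable_mulmx_preimage.
    by apply/funext => v; rewrite /= scalemxAl.
  have := hE _ mEL; rewrite /distribution /pushforward /= => h.
  transitivity (nr [set z | [set v | E (sigma^-1 *: (L *m v))] (B *m z)]); first exact: h.
  by congr (nr _); apply/funext => z; rewrite /= -scalemxAl mulmxA.
exists m, 1%:M, nu; split=> //; first by rewrite mul1mx trmx1.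
by move=> E mE; congr (nu _); apply/funext => z; rewrite /= mul1mx.
Qed.

Definition whitened n (w : Omega n) : 'cV[R]_P := noise (whiten_mx (X n)) w.

Lemma whitened_law n (nu : probability 'cV[R]_P R) F : (P < n)%N ->
  std_gaussian nu -> measurable F ->
  pr (Pr n) [set w | F (whitened w)] = pr nu F.
Proof.
move=> Pn hnu mF; apply: noise_law => //.
apply: whiten_mx_tr; first exact: leq_trans Pn.
exact: scaled_gram_pos_def.
Qed.

Variable theta : 'cV[R]_P.
Local Notation Y n w := (X n *m theta + u n w).

Lemma sqnorm_residual_noise n (w : Omega n) : (P < n)%N ->
  ((residual (X n) (Y n w))^T *m residual (X n) (Y n w)) 0 0 =
  sigma ^+ 2 * (sqnorm (noise 1%:M w) - sqnorm (whitened w)).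
Proof.
move=> Pn; rewrite sqnorm_residual; last 2 first.
- exact: leq_trans Pn.
- exact: scaled_gram_pos_def.
have sZ m (z : 'cV[R]_m) : sqnorm (sigma *: z) = sigma ^+ 2 * sqnorm z.
  by rewrite /sqnorm mulr_sumr; apply: eq_bigr => i _; rewrite mxE exprMn.
by rewrite mulrBr -!sZ -!noiseE mul1mx.
Qed.

Lemma sigma_hatE n (w : Omega n) : (P < n)%N ->
  sigma_hat (X n) (Y n w) = Num.sqrt ((n%:R - P%:R)^-1 *
    (sigma ^+ 2 * (sqnorm (noise 1%:M w) - sqnorm (whitened w)))).
Proof. by move=> Pn; rewrite /sigma_hat sqnorm_residual_noise. Qed.

Lemma measurable_sigma_hat n : (P < n)%N ->
  measurable_fun setT (fun w : Omega n => sigma_hat (X n) (Y n w)).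
Proof.
move=> Pn; under eq_fun do rewrite sigma_hatE//.
apply: (measurableT_comp (continuous_measurable_fun (@sqrt_continuous R))).
apply: measurable_funM => //; apply: measurable_funM => //; apply: measurable_funB.
  exact: (measurableT_comp (@measurable_sqnorm R n) (measurable_noise _)).
exact: (measurableT_comp (@measurable_sqnorm R P) (measurable_noise _)).
Qed.

Lemma sigma_hat_dist n (w : Omega n) (r K : R) : (P < n)%N ->
  (2 * P <= n)%N -> 0 <= K -> K + P%:R <= r * n%:R ->
  `|sqnorm (noise 1%:M w) - n%:R| <= r * n%:R -> sqnorm (whitened w) <= K ->
  `|sigma_hat (X n) (Y n w) / sigma - 1| <= 4 * r.
Proof.
move=> Pn P2n K0 Kr h1 h2.
have nP : 0 < n%:R - P%:R :> R by rewrite subr_gt0 ltr_nat.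
have n2P : n%:R <= 2 * (n%:R - P%:R) :> R.
  by have : (2 * P)%:R <= n%:R :> R; [rewrite ler_nat|rewrite natrM; lra].
set a := sqnorm _ in h1; set b := sqnorm _ in h2.
have b0 : 0 <= b by apply: sumr_ge0 => i _; exact: sqr_ge0.
pose s := sigma_hat (X n) (Y n w).
have s0 : 0 <= s by exact: sqrtr_ge0.
have s2 : (s / sigma) ^+ 2 = (a - b) / (n%:R - P%:R).
  have ab : 0 <= (n%:R - P%:R)^-1 * (sigma ^+ 2 * (a - b)).
    rewrite mulr_ge0 ?invr_ge0 ?(ltW nP)//.
    rewrite -sqnorm_residual_noise// -sqnormE.
    by apply: sumr_ge0 => i _; exact: sqr_ge0.
  rewrite exprMn /s sigma_hatE// sqr_sqrtr// -/a -/b; field.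
  by rewrite !gt_eqF.
set rho := s / sigma in s2 *.
have rho0 : 0 <= rho by rewrite divr_ge0// ltW.
(* Since rho >= 0, the factor rho + 1 is at least 1; this removes the square root. *)
have hr : `|rho - 1| <= `|rho ^+ 2 - 1|.
  rewrite (_ : rho ^+ 2 - 1 = (rho - 1) * (rho + 1)); last by ring.
  rewrite normrM ler_peMr//.
  by rewrite ger0_norm ?addr_ge0//; lra.
apply: le_trans hr _; rewrite s2.
(* The numerator is at most r n + K + P <= 2 r n in absolute value, and n <= 2 (n - P), whence the
   factor 4. *)
have -> : (a - b) / (n%:R - P%:R) - 1 = (a - n%:R - b + P%:R) / (n%:R - P%:R).
  by field; rewrite gt_eqF.
rewrite normrM normfV (gtr0_norm nP) ler_pdivrMr//.
have P0 : 0 <= P%:R :> R by [].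
have r0 : 0 <= r * n%:R by lra.
move: h1; rewrite ler_norml => /andP[? ?].
have n0 : 0 < n%:R :> R by lra.
have r00 : 0 <= r by rewrite -(pmulr_lge0 _ n0).
have hh : r * n%:R <= r * (2 * (n%:R - P%:R)) by rewrite ler_wpM2l.
by rewrite ler_norml; apply/andP; split; lra.
Qed.

End model.

Lemma tcoordZ (R : realType) (P : nat) (a : R) (z : 'cV[R]_P) q :
  tcoord (a *: z) q = a * tcoord z q.
Proof. by rewrite /tcoord; case: (unlift _ _) => [j|]; rewrite ?mxE ?mulr0. Qed.

Section asymptotics.
Context {R : realType} {P : nat}.
Variables (X : forall n : nat, 'M[R]_(n, P)) (sigma : R) (Q : 'M[R]_P).
Variables (d : nat -> measure_display) (Omega : forall n : nat, measurableType (d n)).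
Variable Pr : forall n : nat, probability (Omega n) R.
Variable u : forall n : nat, {mfun Omega n >-> 'cV[R]_n}.
Hypothesis sigma0 : 0 < sigma.
Hypothesis hu : forall n : nat, (P < n)%N ->
  centered_gaussian ((sigma ^+ 2)%:M : 'M[R]_n) (distribution (Pr n) (u n)).
Hypothesis hX : forall n : nat, (P < n)%N -> \rank (X n) = P.
Hypothesis hQ : mx_cvg (scaled_gram X) Q.
Hypothesis hQu : Q \in unitmx.
Variable theta : 'cV[R]_P.
Local Notation Y n w := (X n *m theta + u n w).
Local Notation Z n := (@whitened R P X sigma d Omega u n).
Variable nu : probability 'cV[R]_P R.
Hypothesis hnu : std_gaussian nu.
Local Notation N01 := (@normal_prob R 0 1).

Lemma near_scaled_gram_pos_def : \forall n \near \oo, pos_def (scaled_gram X n).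
Proof. by exists P.+1 => // n /= Pn; exact: scaled_gram_pos_def. Qed.

Lemma limit_pos_def : pos_def Q.
Proof. exact: pos_def_cvg hQ near_scaled_gram_pos_def hQu. Qed.

(** The residual sum of squares is the squared norm of the noise, handled by the law of large
    numbers in dimension n, minus that of the whitened noise, which is tight because its law does
    not depend on n. *)
Lemma sigma_hat_consistent (r e : R) : 0 < r -> 0 < e -> \forall n \near \oo,
  pr (Pr n) [set w | r < `|sigma_hat (X n) (Y n w) / sigma - 1| ] <= e.
Proof.
move=> r0 e0; have e20 : 0 < e / 2 by rewrite divr_gt0.
have r40 : 0 < r / 4 by rewrite divr_gt0.
have [N hN] := sqnorm_lln r40 e20.
have [K hK] := pr_tail nu (@measurable_sqnorm R P) e20.
near=> n.
have Pn : (P < n)%N by near: n; exact: nbhs_infty_gt.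
have P2n : (2 * P <= n)%N by near: n; exact: nbhs_infty_ge.
have Nn : (N <= n)%N by near: n; exact: nbhs_infty_ge.
have Kn : K%:R + P%:R <= r / 4 * n%:R.
  by rewrite -ler_pdivrMl//; near: n; exact: nbhs_infty_ger.
have [nun hnun] := @exists_std_gaussian R n.
pose E1 : set 'cV[R]_n := [set v | r / 4 * n%:R <= `|sqnorm v - n%:R| ].
pose E2 : set 'cV[R]_P := [set z | K%:R < sqnorm z].
have mE1 : measurable E1.
  apply: measurable_set_ler => //; apply: measurableT_comp => //.
  by apply: measurable_funB => //; exact: measurable_sqnorm.
have mE2 : measurable E2 by apply: measurable_set_ltr => //; exact: measurable_sqnorm.
have mF1 : measurable [set w : Omega n | E1 (noise sigma u 1%:M w)].
  by rewrite -[X in measurable X]setTI; exact: measurable_noise.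
have mF2 : measurable [set w : Omega n | E2 (Z n w)].
  by rewrite -[X in measurable X]setTI; exact: measurable_noise.
have ms := measurable_sigma_hat u sigma0 hX theta Pn.
have mS : measurable [set w | r < `|sigma_hat (X n) (Y n w) / sigma - 1| ].
  apply: measurable_set_ltr => //; apply: measurableT_comp => //.
  by apply: measurable_funB => //; exact: measurable_funM.
rewrite (splitr e).
apply: le_trans (lerD (hN n nun Nn hnun) hK).
have L1 : (1%:M : 'M[R]_n) *m 1%:M^T = 1%:M by rewrite trmx1 mulmx1.
rewrite -(noise_law sigma0 hu Pn L1 hnun mE1).
rewrite -(whitened_law sigma0 hu hX Pn hnu mE2).
apply: le_trans (le_prU _ mF1 mF2); apply: le_pr => //; first exact: measurableU.
move=> w /= hw; apply: contrapT => /not_orP[n1 n2].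
move: hw; apply/negP; rewrite -leNgt (_ : r = 4 * (r / 4)); last by field.
apply: (sigma_hat_dist sigma0 hX theta Pn P2n (ler0n _ K) Kn).
  by rewrite leNgt; apply/negP => /ltW.
by rewrite leNgt; apply/negP.
Unshelve. all: by end_near. Qed.

(** * Agreement of the sample selector with the limit selector *)

Variables (O : 'I_P.+1) (c : 'I_P.+1 -> R) (ps : 'I_P.+1).
Hypothesis hcO : c O = 0.
Hypothesis hc : forall p : 'I_P.+1, (O < p)%N -> 0 < c p.
Hypothesis hOps : (O <= ps)%N.
Hypothesis hord : (order_of theta <= ps)%N.
Hypothesis hps : ps != O -> order_of theta = ps.

Variable s : forall n : nat, Omega n -> R.
Hypothesis s_ge0 : forall n w, 0 <= @s n w.
Hypothesis ms : forall n, (P < n)%N -> measurable_fun setT (@s n).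
Hypothesis s_consistent : forall r e : R, 0 < r -> 0 < e -> \forall n \near \oo,
  pr (Pr n) [set w | r < `|s w / sigma - 1| ] <= e.

Local Notation sel n w := (selector (X n) (Y n w) O c (s w)).
Local Notation lsel := (limit_selector c ps).

Lemma selectorP n (w : Omega n) (p : 'I_P.+1) : sel n w = p <->
  ((O <= p)%N && (c p <= `|tstat (X n) (Y n w) (s w) p|)) /\
  forall q : 'I_P.+1, (p < q)%N ->
    ~~ ((O <= q)%N && (c q <= `|tstat (X n) (Y n w) (s w) q|)).
Proof.
by rewrite /selector bigmax_ord_eqP//; exists O; rewrite leqnn hcO normr_ge0.
Qed.

(** With rho = s / sigma the test reads c_q rho <= |Z_q|, and c_q rho differs from c_q by at most
    c_q r: the answer is unchanged when Z_q is farther than that from the threshold. The bound on r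
    keeps rho positive. *)
Lemma tstat_above n (w : Omega n) (q : 'I_P.+1) (r : R) : (P < n)%N -> (ps < q)%N ->
  r <= 1 / 2 -> `|s w / sigma - 1| <= r -> c q * r < `| `|tcoord (Z n w) q| - c q| ->
  (c q <= `|tstat (X n) (Y n w) (s w) q|) = (c q <= `|tcoord (Z n w) q|).
Proof.
move=> Pn pq r2 hr hz.
have cq : 0 < c q by apply: hc; exact: leq_ltn_trans pq.
have hpd := scaled_gram_pos_def hX Pn.
have n0 : (0 < n)%N by exact: leq_trans Pn.
rewrite tstat_tcoord//.
have -> : tcoord (whiten_mx (X n) *m Y n w) q = sigma * tcoord (Z n w) q.
  have [j -> pj] := gt_lift pq.
  rewrite tcoord_lift whiten_signal_above//; last exact: leq_trans pj.
  by rewrite -tcoord_lift (noiseE u sigma0) tcoordZ.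
move: hr; set rho := s w / sigma; rewrite ler_norml => /andP[h1 h2].
have sE : s w = sigma * rho by rewrite /rho mulrC divfK// gt_eqF.
have rho0 : 0 < rho by lra.
rewrite ler_abs_div// sE mulf_eq0 !gt_eqF//= orbF pmulr_rgt0// rho0 /=.
rewrite normrM (gtr0_norm sigma0) mulrCA ler_pM2l//.
move: hz; set t := `|tcoord _ _|; rewrite ltr_normr => /orP[hz|hz].
  by apply/idP/idP => _; nra.
by apply/idP/idP => h; exfalso; nra.
Qed.

Lemma selector_limit n (w : Omega n) (r : R) : (P < n)%N -> r <= 1 / 2 ->
  `|s w / sigma - 1| <= r ->
  (forall q : 'I_P.+1, (ps < q)%N -> c q * r < `| `|tcoord (Z n w) q| - c q|) ->
  (ps != O -> c ps <= `|tstat (X n) (Y n w) (s w) ps|) ->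
  sel n w = lsel (Z n w).
Proof.
move=> Pn r2 hr hq hp.
have [p lp] := limit_selector_ord c ps (Z n w).
rewrite lp; apply/selectorP; move: lp => /limit_selectorP[pp hcp h].
split; last first.
  move=> q pq; have psq := leq_ltn_trans pp pq.
  by rewrite (tstat_above Pn psq r2 hr (hq q psq)) negb_and -ltNge h// orbT.
rewrite (leq_trans hOps pp) /=; have [pe|pne] := eqVneq p ps.
  rewrite pe; have [->|/hp//] := eqVneq ps O.
  by rewrite hcO normr_ge0.
have psp : (ps < p)%N by rewrite ltn_neqAle pp andbT eq_sym.
rewrite (tstat_above Pn psp r2 hr (hq p psp)).
by move: hcp; rewrite (negbTE pne).
Qed.

(* When p* > O, theta has a nonzero component of index p*, so that the t-statistic
   of order p* diverges. *)
Lemma tstat_diverges (K : R) : ps != O -> \forall n \near \oo, forall w : Omega n,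
  `|s w / sigma - 1| <= 1 / 2 -> `|tcoord (Z n w) ps| <= K ->
  c ps <= `|tstat (X n) (Y n w) (s w) ps|.
Proof.
move=> pO; have po := hps pO.
have psO : (O < ps)%N by rewrite ltn_neqAle hOps andbT eq_sym.
have [j pj _] := gt_lift psO.
have tj : theta j 0 != 0 by apply: order_of_last; rewrite po pj.
have cps := hc psO.
have hxi := @xi_inf_cvg _ _ _ _ hQ limit_pos_def ps.
have ps0 : (0 < ps)%N by exact: leq_ltn_trans psO.
have x0 : 0 < xi_inf Q ps by exact: (xi_inf_gt0 limit_pos_def ps0).
have xb : \forall n \near \oo, xi_inf (scaled_gram X n) ps <= 2 * xi_inf Q ps.
  have /cvgrPdist_le /(_ _ x0) := hxi; apply: filterS => n /=.
  by rewrite ler_norml => /andP[]; lra.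
(* Once sqrt(n) >= B and the sample xi is at most 2 xi, the drift is at least sigma (K + 2 c). The
   noise removes at most sigma K, and 2 sigma c exceeds c s because s <= 3 sigma / 2. *)
pose B := (sigma * (K + 2 * c ps)) * (2 * xi_inf Q ps) / `|theta j 0|.
have nB : \forall n \near \oo, B ^+ 2 <= n%:R by exact: nbhs_infty_ger.
near=> n.
move=> w hr hK.
have Pn : (P < n)%N by near: n; exact: nbhs_infty_gt.
have hpd := scaled_gram_pos_def hX Pn.
have n0 : (0 < n)%N by exact: leq_trans Pn.
have K0 : 0 <= K by exact: le_trans hK.
have xn0 : 0 < xi_inf (scaled_gram X n) ps by exact: (xi_inf_gt0 hpd ps0).
have hB : B <= Num.sqrt n%:R.
  apply: le_trans (ler_norm _) _; rewrite -sqrtr_sqr ler_wsqrtr//; near: n; exact: nB.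
have xn : xi_inf (scaled_gram X n) ps <= 2 * xi_inf Q ps by near: n; exact: xb.
rewrite tstat_tcoord//.
have -> : tcoord (whiten_mx (X n) *m Y n w) ps =
    Num.sqrt n%:R * ((xi_inf (scaled_gram X n) ps)^-1 * theta j 0) + sigma * tcoord (Z n w) ps.
  rewrite -tcoordZ -(noiseE u sigma0) pj !tcoord_lift.
  by rewrite whiten_signal_last// po pj.
set a := _ * (_ * _); set z := tcoord _ _ in hK *.
have ha : sigma * (K + 2 * c ps) <= `|a|.
  rewrite /a !normrM normfV (gtr0_norm xn0) ger0_norm ?sqrtr_ge0// mulrA.
  have t0 : 0 < `|theta j 0| by rewrite normr_gt0.
  have : B * `|theta j 0| <= Num.sqrt n%:R * `|theta j 0| by rewrite ler_pM2r.
  rewrite {1}/B divfK ?gt_eqF// => hh.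
  rewrite mulrAC ler_pdivlMr//; apply: le_trans hh.
  by apply: ler_wpM2l => //; rewrite mulr_ge0 ?(ltW sigma0)//; lra.
move: hr; set rho := s w / sigma; rewrite ler_norml => /andP[h1 h2].
have sE : s w = sigma * rho by rewrite /rho mulrC divfK// gt_eqF.
have rho0 : 0 < rho by lra.
rewrite ler_abs_div// sE mulf_eq0 !gt_eqF//= orbF pmulr_rgt0// rho0 /=.
have h3 : `|a| - sigma * K <= `|a + sigma * z|.
  apply: le_trans (lerB_normD _ _); rewrite lerD2l lerN2 normrM (gtr0_norm sigma0).
  by rewrite ler_pM2l.
apply: le_trans h3.
have c0 : 0 <= c ps * sigma * (2 - rho).
  by apply: mulr_ge0; [rewrite mulr_ge0 ?ltW|lra].
by move: ha c0; rewrite mulrDr mulrBr => ha c0; lra.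
Unshelve. all: by end_near. Qed.

Lemma measurable_response n : measurable_fun setT (fun w : Omega n => Y n w).
Proof.
apply/measurable_cVP => i.
rewrite (_ : (fun _ => _) = (fun w : Omega n => (X n *m theta) i 0 + u n w i 0)).
  apply: measurable_funD => //.
  exact: (measurableT_comp (measurable_coord i) (measurable_funPT (u n))).
by apply/funext => w; rewrite mxE.
Qed.

Lemma measurable_tstat_ge n (q : 'I_P.+1) : (P < n)%N ->
  measurable [set w | c q <= `|tstat (X n) (Y n w) (s w) q| ].
Proof.
move=> Pn; have hpd := scaled_gram_pos_def hX Pn.
have n0 : (0 < n)%N by exact: leq_trans Pn.
pose a w := tcoord (whiten_mx (X n) *m Y n w) q.
have ma : measurable_fun setT a.
  apply: (measurableT_comp (measurable_tcoord q)).
  exact: (measurableT_comp (measurable_mulmx _) (@measurable_response n)).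
rewrite (_ : [set w | _] = ([set w | 0 < s w] `&` [set w | c q * s w <= `|a w| ])
    `|` ([set w | s w <= 0] `&` [set _ | c q <= 0])).
  apply: measurableU; apply: measurableI.
  - by apply: measurable_set_ltr => //; exact: ms.
  - apply: measurable_set_ler; last exact: measurableT_comp.
    by apply: measurable_funM => //; exact: ms.
  - by apply: measurable_set_ler => //; exact: ms.
  - exact: measurable_cst_prop.
apply/seteqP; split=> w /=; rewrite tstat_tcoord// ler_abs_div// -/(a w).
  move=> /orP[/andP[h1 h2]|/andP[/eqP h1 h2]]; [by left|right].
  by rewrite h1.
by move=> [[-> ->]//|[h1 h2]]; apply/orP; right; rewrite h2 andbT eq_le h1 s_ge0.
Qed.

Lemma measurable_selector n (p : 'I_P.+1) : (P < n)%N ->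
  measurable [set w | sel n w = p].
Proof.
move=> Pn; have mt q := measurable_tstat_ge q Pn.
have mt' (q : 'I_P.+1) : measurable [set w |
    (O <= q)%N && (c q <= `|tstat (X n) (Y n w) (s w) q|)].
  rewrite (_ : [set w | _] = [set _ | (O <= q)%N] `&`
     [set w | c q <= `|tstat (X n) (Y n w) (s w) q| ]).
    by apply: measurableI => //; exact: measurable_cst_prop.
  by apply/seteqP; split=> w /= => [/andP[]|[-> ->]].
rewrite (_ : [set w | _] = [set w |
    (O <= p)%N && (c p <= `|tstat (X n) (Y n w) (s w) p|)] `&`
  [set w | forall q : 'I_P.+1, (p < q)%N -> (~` [set w |
    (O <= q)%N && (c q <= `|tstat (X n) (Y n w) (s w) q|)]) w]).
  apply: measurableI => //; apply: measurable_forall => q.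
  by apply: measurable_imply_cst; exact: measurableC.
apply/seteqP; split=> w.
  by move=> /selectorP[h1 h2]; split=> // q pq; apply/negP; exact: h2.
by move=> [h1 h2]; apply/selectorP; split=> // q pq; apply/negP; exact: h2.
Qed.

Let bad n : set (Omega n) := [set w | sel n w <> lsel (Z n w)].

Let measurable_bad n : (P < n)%N -> measurable (bad (n := n)).
Proof.
move=> Pn.
rewrite (_ : @bad n = [set w | forall p : 'I_P.+1,
    (~` ([set w | sel n w = p] `&` [set w | lsel (Z n w) = p])) w]).
  apply: measurable_forall => p; apply: measurableC; apply: measurableI.
    exact: measurable_selector.
  rewrite -[X in measurable X]setTI.
  have mL := measurable_limit_selector c ps p.
  exact: (measurable_noise sigma u (whiten_mx (X n)) measurableT mL).
apply/seteqP; split=> w; rewrite /bad /=.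
  by move=> h p [h1 h2]; apply: h; rewrite h1 h2.
move=> h1 h2; have [p hp] := limit_selector_ord c ps (Z n w).
by apply: (h1 p); split=> //=; rewrite h2.
Qed.

(** The selectors can differ only if s / sigma is far from 1, some |Z_q| above ps is close to c_q,
    or Z at ps is large; each of these three events receives e / 3. *)
Lemma selector_consistent (e : R) : 0 < e -> \forall n \near \oo,
  pr (Pr n) (bad (n := n)) <= e.
Proof.
move=> e0; pose e3 := e / 3; have e30 : 0 < e3 by rewrite divr_gt0.
pose e' := e3 / P.+1%:R; have e'0 : 0 < e' by rewrite divr_gt0.
have [b b0 hb] := pr_normal_boundary e'0.
(* A positive common bound of all critical values, so that one r gives c_q r <= b for every q. *)
pose C := 1 + \sum_q `|c q|.
have C1 : 1 <= C by rewrite lerDl sumr_ge0.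
have C0 : 0 < C by lra.
have cC q : c q <= C.
  rewrite /C (bigD1 q)//=.
  have : 0 <= \sum_(i < P.+1 | i != q) `|c i| by apply: sumr_ge0.
  by have := ler_norm (c q); lra.
pose r := Num.min (1 / 2) (b / C).
have r0 : 0 < r by rewrite lt_min !divr_gt0.
have r2 : r <= 1 / 2 by rewrite ge_min lexx.
have rb q : 0 < c q -> c q * r <= b.
  move=> cq; apply: (@le_trans _ _ (C * (b / C))); last by rewrite mulrCA divff ?mulr1// gt_eqF.
  by apply: ler_pM => //; [exact: ltW|exact: ltW|rewrite ge_min lexx orbT].
have mtc q : measurable_fun setT (fun z : 'cV[R]_P => `|tcoord z q|).
  by apply: measurableT_comp => //; exact: measurable_tcoord.
have [K hK] := pr_tail nu (mtc ps) e30.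
have hdn : \forall n \near \oo, ps != O -> forall w : Omega n,
    `|s w / sigma - 1| <= 1 / 2 ->
    `|tcoord (Z n w) ps| <= K%:R -> c ps <= `|tstat (X n) (Y n w) (s w) ps|.
  have [pO|pO] := eqVneq ps O; last by apply: filterS (tstat_diverges K%:R pO) => n h _; exact: h.
  by near=> n.
near=> n.
have Pn : (P < n)%N by near: n; exact: nbhs_infty_gt.
have hs : pr (Pr n) [set w | r < `|s w / sigma - 1| ] <= e3.
  by near: n; exact: s_consistent.
have hd : ps != O -> forall w : Omega n, `|s w / sigma - 1| <= 1 / 2 ->
    `|tcoord (Z n w) ps| <= K%:R -> c ps <= `|tstat (X n) (Y n w) (s w) ps|.
  by near: n.
pose F (q : 'I_P.+1) : set 'cV[R]_P :=
  if (ps < q)%N then [set z | `| `|tcoord z q| - c q| <= b] else set0.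
have mF q : measurable (F q).
  rewrite /F; case: ifP => // _; apply: measurable_set_ler => //.
  by apply: measurableT_comp => //; apply: measurable_funB.
pose A1 := [set w : Omega n | r < `|s w / sigma - 1| ].
pose A2 := [set w : Omega n | exists q, F q (Z n w)].
pose G := [set z : 'cV[R]_P | K%:R < `|tcoord z ps| ].
pose A3 := [set w : Omega n | G (Z n w)].
have mZ (D : set 'cV[R]_P) : measurable D -> measurable [set w : Omega n | D (Z n w)].
  move=> mD; rewrite -[X in measurable X]setTI.
  exact: (measurable_noise sigma u (whiten_mx (X n)) measurableT mD).
have mA1 : measurable A1.
  apply: measurable_set_ltr => //; apply: measurableT_comp => //.
  by apply: measurable_funB => //; apply: measurable_funM => //; exact: ms.
have mG : measurable G by exact: measurable_set_ltr.
have mA3 : measurable A3 by exact: mZ.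
have mA2 : measurable A2.
  rewrite (_ : A2 = ~` [set w | forall q, (~` [set w | F q (Z n w)]) w]).
    by apply: measurableC; apply: measurable_forall => q; apply: measurableC; exact: mZ.
  apply/seteqP; split=> w /=; first by move=> [q Fq] h; exact: (h q).
  by move=> h; apply: contrapT => h'; apply: h => q Fq; apply: h'; exists q.
have b2 : pr (Pr n) A2 <= e3.
  apply: le_trans (@le_pr_bigsetU _ _ _ _ _ (fun q => [set w | F q (Z n w)]) _) _.
    by move=> q; exact: mZ.
  apply: (@le_trans _ _ (\sum_(q < P.+1) e')); last first.
    by rewrite sumr_const card_ord -[leLHS]mulr_natr /e' divfK.
  apply: ler_sum => q _; rewrite (whitened_law sigma0 hu hX Pn hnu (mF q)).
  rewrite /F; case: ifP => [pq|_]; last by rewrite pr_set0 ltW.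
  have [j pj _] := gt_lift pq; apply: le_trans (hb (c q)).
  rewrite le_eqVlt; apply/orP; left; apply/eqP; congr fine.
  pose D : set (measurableTypeR R) := [set x | `| `|x| - c q| <= b].
  transitivity (nu [set z | D (z j 0)]).
    by congr (nu _); apply/funext => z; rewrite /D /mkset {1}pj tcoord_lift.
  apply: pr_coord hnu _; apply: measurable_set_ler => //; apply: measurableT_comp => //.
  by apply: measurable_funB => //; exact: measurableT_comp.
have b3 : pr (Pr n) A3 <= e3 by rewrite (whitened_law sigma0 hu hX Pn hnu mG).
have sub : bad (n := n) `<=` (A1 `|` A2) `|` A3.
  move=> w hw; apply: contrapT => /not_orP[/not_orP[n1 n2] n3]; apply: hw.
  have h1 : `|s w / sigma - 1| <= r by rewrite leNgt; apply/negP.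
  apply: (selector_limit Pn r2 h1).
    move=> q pq; rewrite ltNge; apply/negP => h; apply: n2; exists q.
    rewrite /F pq /=; apply: le_trans h (rb q _).
    by apply: hc; exact: leq_ltn_trans pq.
  move=> pO; apply: hd => //; first exact: le_trans r2.
  by rewrite leNgt; apply/negP.
have m12 := measurableU _ _ mA1 mA2.
apply: le_trans (le_pr _ (measurable_bad Pn) (measurableU _ _ m12 mA3) sub) _.
apply: le_trans (le_prU _ m12 mA3) _.
have := le_prU (Pr n) mA1 mA2.
have : e = e3 + e3 + e3 by rewrite /e3; field.
by move: hs; rewrite -/A1; lra.
Unshelve. all: by end_near. Qed.

Lemma selector_cvg (p : 'I_P.+1) (e : R) : 0 < e -> \forall n \near \oo,
  `|pr (Pr n) [set w | sel n w = p] - pr nu [set z | lsel z = p]| <= e.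
Proof.
move=> e0; near=> n.
have Pn : (P < n)%N by near: n; exact: nbhs_infty_gt.
have mL := measurable_limit_selector c ps p.
rewrite -(whitened_law sigma0 hu hX Pn hnu mL).
apply: (@le_trans _ _ (pr (Pr n) (bad (n := n)))); last first.
  by near: n; exact: selector_consistent.
apply: pr_dist; [exact: measurable_selector| |exact: measurable_bad|].
  rewrite -[X in measurable X]setTI.
  exact: (measurable_noise sigma u (whiten_mx (X n)) measurableT mL).
by move=> w /contrapT /= ->.
Unshelve. all: by end_near. Qed.

Variables (k : nat) (A : 'M[R]_(k, P)).

Local Notation error n w :=
  (Num.sqrt n%:R *: (A *m (pms (X n) (Y n w) O c (s w) - theta))).

Lemma pms_selected n (w : Omega n) (p : 'I_P.+1) : (O <= p)%N -> sel n w = p ->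
  pms (X n) (Y n w) O c (s w) = ls (X n) (Y n w) p.
Proof.
move=> Op sp; rewrite /pms (bigD1 p)//= sp eqxx scale1r big1 ?addr0// => q /andP[_ qp].
by rewrite val_eqE eq_sym (negbTE qp) scale0r.
Qed.

Lemma selector_ord n (w : Omega n) : exists2 p : 'I_P.+1, sel n w = p & (O <= p)%N.
Proof.
have h : (sel n w < P.+1)%N by rewrite ltnS; apply/bigmax_leqP => p _; rewrite -ltnS.
have sp : sel n w = Ordinal h by [].
by exists (Ordinal h) => //; move/selectorP: sp => [/andP[]].
Qed.

(** An exact identity, since every order from ps on contains the true model: the remaining
    approximations are the selection and the passage from the sample Gram matrix to Q. *)
Lemma error_limit n (w : Omega n) : (P < n)%N -> sel n w = lsel (Z n w) ->
  error n w = limit_pms A sigma c ps (scaled_gram X n) (Z n w).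
Proof.
move=> Pn ss; have [p lp] := limit_selector_ord c ps (Z n w).
have pp : (ps <= p)%N by rewrite -lp; exact: limit_selector_ge.
rewrite (limit_pmsE _ _ _ lp) (@pms_selected _ _ p) ?ss//; last exact: leq_trans pp.
rewrite scalemxAr (ls_signal (leq_trans (ltn0Sn P) Pn) (scaled_gram_pos_def hX Pn)); last first.
  exact: leq_trans pp.
rewrite (noiseE u sigma0) /limit_error -!scalemxAr -/(whitened _ _ _ _).
by rewrite !mulmxA -first_colsE.
Qed.

Lemma measurable_error n E : (P < n)%N -> measurable E ->
  measurable [set w : Omega n | E (error n w)].
Proof.
move=> Pn mE.
pose err (p : 'I_P.+1) (w : Omega n) := Num.sqrt n%:R *: (A *m (ls (X n) (Y n w) p - theta)).
have merr p : measurable [set w | E (err p w)].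
  rewrite -[X in measurable X]setTI.
  suff : measurable_fun setT (err p) by apply.
  pose B := A *m (first_cols 1%:M p *m (invmx (gram (X n) p) *m (first_cols (X n) p)^T)).
  rewrite (_ : err p = fun w => Num.sqrt n%:R *: (B *m Y n w - A *m theta)).
    have mB : measurable_fun setT (fun w : Omega n => B *m Y n w).
      exact: (measurableT_comp (measurable_mulmx _) (@measurable_response n)).
    apply/measurable_cVP => i.
    rewrite (_ : (fun _ => _) = fun w : Omega n =>
        Num.sqrt n%:R * ((B *m Y n w) i 0 - (A *m theta) i 0)).
      apply: measurable_funM => //; apply: measurable_funB => //.
      exact: (measurableT_comp (measurable_coord i) mB).
    by apply/funext => w; rewrite [LHS]mxE [X in _ * X]mxE [X in _ * (_ + X)]mxE.
  by apply/funext => w; rewrite /err mulmxBr /B /ls /ls_coef !mulmxA.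
rewrite (_ : [set w | _] = ~` [set w | forall p : 'I_P.+1, (O <= p)%N ->
    (~` ([set w | sel n w = p] `&` [set w | E (err p w)])) w]).
  apply: measurableC; apply: measurable_forall => p; apply: measurable_imply_cst.
  by apply: measurableC; apply: measurableI => //; exact: measurable_selector.
apply/seteqP; split=> w /=.
  move=> Ew h; have [p sp Op] := selector_ord w; apply: (h p Op); split=> //=.
  by rewrite /err -(pms_selected Op sp).
move=> h; apply: contrapT => nE; apply: h => p Op [/= sp Ep]; apply: nE.
by rewrite (pms_selected Op sp).
Qed.

Theorem error_tv (e : R) : 0 < e -> \forall n \near \oo, forall E, measurable E ->
  `|pr (Pr n) [set w | E (error n w)] -
    pr nu [set z | E (limit_pms A sigma c ps Q z)]| <= e.
Proof.
move=> e0; have e20 : 0 < e / 2 by rewrite divr_gt0.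
have h1 := selector_consistent e20.
have h2 := limit_pms_tv A sigma c ps hnu limit_pos_def hQ near_scaled_gram_pos_def e20.
near=> n.
have Pn : (P < n)%N by near: n; exact: nbhs_infty_gt.
have h1n : pr (Pr n) (bad (n := n)) <= e / 2 by near: n.
have h2n : forall E, measurable E ->
  `|pr nu [set z | E (limit_pms A sigma c ps (scaled_gram X n) z)] -
    pr nu [set z | E (limit_pms A sigma c ps Q z)]| <= e / 2 by near: n.
move=> E mE.
pose F := [set z | E (limit_pms A sigma c ps (scaled_gram X n) z)].
have mF : measurable F.
  by rewrite -[X in measurable X]setTI; exact: measurable_limit_pms.
have h3 : `|pr (Pr n) [set w | E (error n w)] - pr nu F| <= e / 2.
  rewrite -(whitened_law sigma0 hu hX Pn hnu mF).
  apply: le_trans h1n; apply: pr_dist; [exact: measurable_error| |exact: measurable_bad|].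
    rewrite -[X in measurable X]setTI.
    exact: (measurable_noise sigma u (whiten_mx (X n)) measurableT mF).
  by move=> w /contrapT ss; rewrite /F /= (error_limit Pn ss).
rewrite (splitr e); apply: le_trans (lerD h3 (h2n E mE)).
exact: ler_distD.
Unshelve. all: by end_near. Qed.

End asymptotics.

Lemma tv_dist_cvg0 (R : realType) d (T : measurableType d)
  (L : nat -> set T -> \bar R) (mu : set T -> \bar R) :
  (forall e : R, 0 < e -> \forall n \near \oo, forall E, measurable E ->
     (`|L n E - mu E| <= e%:E)%E) ->
  tv_dist (L n) mu @[n --> \oo] --> 0%E.
Proof.
move=> h.
have tv0 n : (0 <= tv_dist (L n) mu)%E.
  apply: (@le_trans _ _ `|L n setT - mu setT|%E) => //.
  by apply: ereal_sup_ubound; exists setT.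
have tve (e : R) : 0 < e -> \forall n \near \oo, (tv_dist (L n) mu <= e%:E)%E.
  move=> e0; apply: filterS (h e e0) => n hn.
  by apply: ge_ereal_sup => _ [E mE <-]; exact: hn.
have fin : \forall n \near \oo, tv_dist (L n) mu \is a fin_num.
  apply: filterS (tve 1 ltr01) => n hn; rewrite ge0_fin_numE//.
  exact: le_lt_trans hn (ltry _).
apply/fine_cvgP; split=> //; apply/cvgrPdist_le => e e0.
near=> n; rewrite /= sub0r normrN ger0_norm ?fine_ge0//.
rewrite -lee_fin fineK; first by near: n; exact: tve.
by near: n.
Unshelve. all: by end_near. Qed.

Lemma cvg_measure_pr (R : realType) (d : nat -> measure_display)
  (Omega : forall n : nat, measurableType (d n))
  (Pr : forall n : nat, probability (Omega n) R)
  (E : forall n, set (Omega n)) (l : R) :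
  (\forall n \near \oo, measurable (E n)) ->
  (forall e : R, 0 < e -> \forall n \near \oo, `|pr (Pr n) (E n) - l| <= e) ->
  Pr n (E n) @[n --> \oo] --> l%:E.
Proof.
move=> mE h; apply/fine_cvgP; split.
  by apply: filterS mE => n mEn; rewrite -prE.
by apply/cvgrPdist_le => e e0; apply: filterS (h e e0) => n; rewrite distrC.
Qed.

Theorem mainTheorem8 (R : realType) (P k : nat)
  (A : 'M[R]_(k, P)) (O : 'I_P.+1) (c : 'I_P.+1 -> R)
  (X : forall n : nat, 'M[R]_(n, P)) (Q : 'M[R]_P)
  (theta : 'cV[R]_P) (sigma : R)
  (d : nat -> measure_display)
  (Omega : forall n : nat, measurableType (d n))
  (Pr : forall n : nat, probability (Omega n) R)
  (u : forall n : nat, {mfun Omega n >-> 'cV[R]_n})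
  (Phi : 'I_P.+1 -> probability 'cV[R]_k R)
  (ginv : 'I_P.+1 -> 'M[R]_k)
  (hP : (1 <= P)%N) (hk : (1 <= k <= P)%N) (hA : \rank A = k)
  (hO : (O < P)%N)
  (hcO : c O = 0) (hc : forall p : 'I_P.+1, (O < p)%N -> 0 < c p)
  (hX : forall n : nat, (P < n)%N -> \rank (X n) = P)
  (hQ : n%:R^-1 *: ((X n)^T *m X n) @[n --> \oo] --> Q)
  (hQu : Q \in unitmx)
  (hsigma : 0 < sigma)
  (hu : forall n : nat, (P < n)%N ->
     centered_gaussian ((sigma ^+ 2)%:M : 'M[R]_n) (distribution (Pr n) (u n)))
  (hPhi0 : forall E : set 'cV[R]_k, measurable E ->
     Phi ord0 E = \d_(0 : 'cV[R]_k) E)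
  (hPhi : forall p : 'I_P.+1, (0 < p)%N ->
     centered_gaussian (sigma ^+ 2 *: AQA A Q p) (Phi p))
  (hginv : forall p : 'I_P.+1, (0 < p)%N -> is_ginv (AQA A Q p) (ginv p)) :
  let Y n (w : Omega n) : 'cV[R]_n := X n *m theta + u n w in
  let s_hat n (w : Omega n) : R := sigma_hat (X n) (Y n w) in
  (* laws of sqrt(n) A (estimator - theta); their cdfs are G and G* *)
  let lawG n (E : set 'cV[R]_k) : \bar R := Pr n [set w |
    E (Num.sqrt n%:R *: (A *m (pms (X n) (Y n w) O c (s_hat n w) - theta)))] in
  let lawGstar n (E : set 'cV[R]_k) : \bar R := Pr n [set w |
    E (Num.sqrt n%:R *: (A *m (pms (X n) (Y n w) O c sigma - theta)))] in
  let pi_n n (p : 'I_P.+1) : \bar R := Pr n [set w |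
    selector (X n) (Y n w) O c (s_hat n w) = p] in
  let pistar_n n (p : 'I_P.+1) : \bar R := Pr n [set w |
    selector (X n) (Y n w) O c sigma = p] in
  let pstar : 'I_P.+1 := Order.max (order_of theta) O in
  [/\ cvg_tv_to_cdf lawGstar (limit_cdf A Q ginv sigma c Phi pstar),
      cvg_tv_to_cdf lawG (limit_cdf A Q ginv sigma c Phi pstar) &
      forall p : 'I_P.+1, (O <= p)%N ->
        pi_n n p @[n --> \oo] --> (limit_sel_prob Q sigma c pstar p)%:E /\
        pistar_n n p @[n --> \oo] --> (limit_sel_prob Q sigma c pstar p)%:E].
Proof.
move=> Y s_hat lawG lawGstar pi_n pistar_n pstar.
have hM : mx_cvg (scaled_gram X) Q by exact: mx_cvg_of_cvg hQ.
have hpd := limit_pos_def hX hM hQu.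
have [nu hnu] := @exists_std_gaussian R P.
have hOps : (O <= pstar)%N by have : (O <= pstar)%O by rewrite le_max lexx orbT.
have hord : (order_of theta <= pstar)%N.
  by have : (order_of theta <= pstar)%O by rewrite le_max lexx.
have hps : pstar != O -> order_of theta = pstar.
  by rewrite /pstar; case: (leP (order_of theta) O) => // _; rewrite eqxx.
pose mu := image_prob nu (measurable_limit_pms A sigma c pstar Q).
have mu_cdf t : mu (below t) = (limit_cdf A Q ginv sigma c Phi pstar t)%:E.
  rewrite -(pr_limit_pms_below c pstar hsigma hnu hpd hPhi0 hPhi hginv t).
  rewrite [LHS]image_probE; apply/esym/prE; rewrite -[X in measurable X]setTI.
  exact: (measurable_limit_pms A sigma c pstar Q measurableT (measurable_below t)).
(* The known and the estimated variance are treated at once: the scale s only has to be nonnegative,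
   measurable and consistent for sigma. *)
have tv (s : forall n, Omega n -> R) (s_ge0 : forall n w, 0 <= s n w)
    (ms : forall n, (P < n)%N -> measurable_fun setT (s n))
    (hs : forall r e : R, 0 < r -> 0 < e -> \forall n \near \oo,
      pr (Pr n) [set w | r < `|s n w / sigma - 1| ] <= e) :
    cvg_tv_to_cdf (fun n E => Pr n [set w |
      E (Num.sqrt n%:R *: (A *m (pms (X n) (Y n w) O c (s n w) - theta)))])
      (limit_cdf A Q ginv sigma c Phi pstar) /\
    forall p : 'I_P.+1, Pr n [set w | selector (X n) (Y n w) O c (s n w) = p]
      @[n --> \oo] --> (limit_sel_prob Q sigma c pstar p)%:E.
  split.
    exists mu; split=> //; apply: tv_dist_cvg0 => e e0.
    have h := error_tv hsigma hu hX hM hQu hnu hcO hc hOps hord hps s_ge0 ms hs A e0.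
    near=> n => E mE.
    have Pn : (P < n)%N by near: n; exact: nbhs_infty_gt.
    have hn : forall E, measurable E ->
      `|pr (Pr n) [set w | E (Num.sqrt n%:R *: (A *m (pms (X n) (Y n w) O c (s n w) - theta)))] -
        pr nu [set z | E (limit_pms A sigma c pstar Q z)]| <= e by near: n.
    have -> : mu E = (pr nu [set z | E (limit_pms A sigma c pstar Q z)])%:E.
      rewrite [LHS]image_probE; apply/esym/prE; rewrite -[X in measurable X]setTI.
      exact: (measurable_limit_pms A sigma c pstar Q measurableT mE).
    rewrite -prE; first by rewrite lee_fin; exact: hn.
    exact: (measurable_error u hX theta hcO s_ge0 ms A Pn mE).
  move=> p; apply: cvg_measure_pr.
    exists P.+1 => // n Pn.
    exact: (measurable_selector u hX theta hcO s_ge0 ms p Pn).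
  rewrite -(pr_limit_selector A c pstar hsigma hnu p hpd) => e e0.
  exact: (selector_cvg hsigma hu hX hM hQu hnu hcO hc hOps hord hps s_ge0 ms hs p e0).
have [G1 S1] : cvg_tv_to_cdf lawGstar (limit_cdf A Q ginv sigma c Phi pstar) /\
    forall p : 'I_P.+1, pistar_n n p @[n --> \oo] --> (limit_sel_prob Q sigma c pstar p)%:E.
  apply: (tv (fun=> fun=> sigma)) => [n w|//|r e r0 e0]; first exact: ltW.
  near=> n; rewrite [X in pr _ X](_ : _ = set0) ?pr_set0 ?ltW//.
  apply/seteqP; split=> w //=.
  by rewrite divff ?gt_eqF// subrr normr0 ltNge (ltW r0).
have [G2 S2] : cvg_tv_to_cdf lawG (limit_cdf A Q ginv sigma c Phi pstar) /\
    forall p : 'I_P.+1, pi_n n p @[n --> \oo] --> (limit_sel_prob Q sigma c pstar p)%:E.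
  apply: (tv s_hat) => [n w|n Pn|r e r0 e0]; first exact: sqrtr_ge0.
    exact: measurable_sigma_hat.
  exact: (sigma_hat_consistent hsigma hu hX theta hnu r0 e0).
by split=> // p _; split.
Unshelve. all: by end_near. Qed.
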